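(* Let $(X,\mu,\mathcal{R})$ be a discrete p.m.p. equivalence relation and let $\mathcal{F}=\{\mathcal{F}_r\}_{r\in\mathbb{I}}$ be a Borel family of subset functions for $\mathcal{R}$. If $\mathcal{F}$ is either (asymptotically invariant and regular) or (asymptotically invariant, uniform and tempered), then for every $f\in L^1(X,\mu)$, $\mathbb{A}[f|\mathcal{F}_r]$ converges pointwise a.e. to $\mathbb{E}[f|\mathcal{I}(\mathcal{R})]$ as $r\to\infty$.
   Context: $\mathbb{I}$ denotes either $\mathbb{N}$ or $\mathbb{R}_{>0}$. A discrete p.m.p. equivalence relation $(X,\mu,\mathcal{R})$: $(X,\mu)$ is a standard probability space, $\mathcal{R}\subset X\times X$ is a Borel equivalence relation with every class $[x]$ at most countable, and $\mu$ is $\mathcal{R}$-invariant, i.e. $\mu\times c$ and $c\times\mu$ agree on $\mathcal{R}$, where $c$ is counting measure. $\mathrm{Inn}(\mathcal{R})$ is the group of Borel automorphisms of $X$ with graph contained in $\mathcal{R}$. $\Psi\subset\mathrm{Inn}(\mathcal{R})$ generates $\mathcal{R}$ if for $(\mu\times c)$-a.e. $(x,y)\in\mathcal{R}$ there is $\psi$ in the group $\langle\Psi\rangle$ generated by $\Psi$ with $\psi(x)=y$. A subset function $U$ assigns to each $x\in X$ a subset $U(x)\subset[x]$; $U^{-1}(y)=\{x:y\in U(x)\}$; $U_1U_2(x)=\bigcup_{y\in U_2(x)}U_1(y)$. A Borel family of subset functions is a family $\mathcal{F}=\{\mathcal{F}_r\}_{r\in\mathbb{I}}$ of subset functions with $\{(x,y,r):y\in\mathcal{F}_r(x)\}$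 Borel and $\bigcup_{s\le r}\mathcal{F}_s(x)$ finite for all $x,r$. $\mathcal{F}$ is: (i) asymptotically invariant if $|\mathcal{F}_r(x)|\ge1$ for a.e. $x$ and all $r$, and there is a countable generating set $\Psi\subset\mathrm{Inn}(\mathcal{R})$ such that for every $\psi\in\Psi$ and a.e. $x$, $\lim_{r\to\infty}|\mathcal{F}_r(x)\,\Delta\,\psi(\mathcal{F}_r(x))|/|\mathcal{F}_r(x)|=0$; (ii) uniform if there are constants $C_u,a_r,b_r>0$ with $b_r\le C_ua_r$, $a_r\le|\mathcal{F}_r(x)|\le b_r$ and $a_r\le|\mathcal{F}_r^{-1}(x)|\le b_r$ for all $r$ and a.e. $x$; (iii) regular if there is $C_{reg}>0$ with $\left|\bigcup_{s\le r}\mathcal{F}_s^{-1}\mathcal{F}_r(x)\right|\le C_{reg}|\mathcal{F}_r(x)|$ for a.e. $x$ and every $r$; (iv) tempered if $\mathbb{I}=\mathbb{N}$ and there is $C_t$ with $\left|\bigcup_{m\le n-1}\mathcal{F}_m^{-1}\mathcal{F}_n(x)\right|\le C_t|\mathcal{F}_n(x)|$ for a.e. $x$ and every $n$. Averages: $\mathbb{A}[f|\mathcal{F}_r](x)=\frac{1}{|\mathcal{F}_r(x)|}\sum_{x'\in\mathcal{F}_r(x)}f(x')$. $\mathcal{I}(\mathcal{R})$ is the $\sigma$-algebra of $\mathcal{R}$-invariant measurable sets ($E$ is $\mathcal{R}$-invariant if it is a union of classes up to measure zero), and $\mathbb{E}[f|\mathcal{I}(\mathcal{R})]$ is conditional expectation.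 *)

(* Defs.v *)
From HB Require Import structures.
From mathcomp Require Import all_boot all_order all_algebra.
From mathcomp Require Import all_classical all_reals all_analysis.

Set Implicit Arguments.
Unset Strict Implicit.
Unset Printing Implicit Defensive.

Import Order.TTheory GRing.Theory Num.Theory.
Import numFieldNormedType.Exports.

Local Open Scope classical_set_scope.
Local Open Scope ring_scope.

(* A measurable space is standard Borel when it is isomorphic to a Polish space
   with its Borel sigma-algebra.  Library balls only give a pseudometric, hence
   the Hausdorff condition. *)
Definition standard_borel (R : realType) d (X : measurableType d) : Prop :=
  exists (T : completePseudoMetricType R) (h : X -> T),
    [/\ hausdorff_space T, (exists2 D : set T, countable D & dense D),
        bijective h &
        forall A : set X, measurable A <-> <<s [set O : set T | open O] >> (h @` A)].

Section equivalence_relation.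
Context {R : realType} d {X : measurableType d}.
Implicit Types (mu : probability X R) (E : set (X * X)).

Definition eq_class E (x : X) : set X := [set y | E (x, y)].

(* With c the counting measure,
   [(mu \x counting) A] is the mu-integral of x |-> #{y | (x, y) \in A} and
   [(counting \x^ mu) A] is the mu-integral of y |-> #{x | (x, y) \in A}.
   Since c need not be sigma-finite, iterating in the other order
   (e.g. [counting \x mu]) would give a different set function. *)
Record discrete_pmp mu E : Prop := DiscretePmp {
  pmp_standard : standard_borel R X ;
  pmp_measurable : measurable E ;
  pmp_refl : forall x, E (x, x) ;
  pmp_sym : forall x y, E (x, y) -> E (y, x) ;
  pmp_trans : forall x y z, E (x, y) -> E (y, z) -> E (x, z) ;
  pmp_countable : forall x, countable (eq_class E x) ;
  pmp_invariant : forall A : set (X * X), measurable A -> A `<=` E ->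
    (mu \x counting)%E A = (counting \x^ mu)%E A }.

Definition Inn E : set (X -> X) :=
  [set f | [/\ measurable_fun setT f,
               (exists g : X -> X,
                  [/\ measurable_fun setT g, cancel f g & cancel g f]) &
               forall x, E (x, f x)]].

Definition group_of_maps (G : set (X -> X)) : Prop :=
  [/\ G id, (forall f g, G f -> G g -> G (f \o g)) &
      forall f g, G f -> cancel f g -> cancel g f -> G g].

Definition generated_group (Psi : set (X -> X)) : set (X -> X) :=
  smallest group_of_maps Psi.

Definition generates mu E (Psi : set (X -> X)) : Prop :=
  {ae (mu \x counting)%E, forall p : X * X,
     E p -> exists2 psi, generated_group Psi psi & psi p.1 = p.2}.

Definition saturated E (B : set X) : Prop := forall x y, E (x, y) -> B x -> B y.

Definition invariant_sets mu E : set (set X) :=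
  [set A | measurable A /\
           exists2 B, saturated E B & mu.-negligible (A `+` B)].

End equivalence_relation.

Section conditional_expectation.
Context {R : realType} d {X : measurableType d}.
Variable mu : probability X R.

Definition is_cond_exp (G : set (set X)) (f g : X -> R) : Prop :=
  [/\ mu.-integrable setT (EFin \o g),
      (forall B : set R, measurable B -> G (g @^-1` B)) &
      forall A, G A ->
        (\int[mu]_(x in A) (g x)%:E = \int[mu]_(x in A) (f x)%:E)%E].

(* A version of E[f | G], chosen by [get]; versions agree almost everywhere. *)
Definition cond_exp (G : set (set X)) (f : X -> R) : X -> R :=
  get (is_cond_exp G f).

End conditional_expectation.

(* Both index sets are realised as subsets of R, and families are indexed by all
   of R: only the members whose index lies in [index_set k] are ever used. *)
Variant index_kind := IndexNat | IndexPosReal.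

Definition index_set (R : realType) (k : index_kind) : set R :=
  match k with
  | IndexNat => range (fun n : nat => n%:R)
  | IndexPosReal => [set r | 0 < r]
  end.
Arguments index_set : clear implicits.

Definition index_oo (R : realType) (k : index_kind) : set_system R :=
  within (index_set R k) (pinfty_nbhs R).
Arguments index_oo : clear implicits.

Definition index_le (R : realType) (k : index_kind) (r : R) : set R :=
  [set s | index_set R k s /\ s <= r].

Section subset_functions.
Context {R : realType} d {X : measurableType d}.
Implicit Types (mu : probability X R) (E : set (X * X)).
Implicit Types (U : X -> set X) (F : R -> X -> set X) (k : index_kind).

(* Cardinality, equal to +oo on infinite sets. *)
Local Notation card := (@counting X R).

Definition subset_function E U : Prop := forall x, U x `<=` eq_class E x.

Definition sf_inv U : X -> set X := fun y => [set x | U x y].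

Definition sf_comp U1 U2 : X -> set X := fun x => \bigcup_(y in U2 x) U1 y.

Definition borel_family E k F : Prop :=
  [/\ (forall r, index_set R k r -> subset_function E (F r)),
      measurable [set p : X * X * R |
        index_set R k p.2 /\ F p.2 p.1.1 p.1.2] &
      forall x r, index_set R k r ->
        finite_set (\bigcup_(s in index_le k r) F s x)].

Definition asymptotically_invariant mu E k F : Prop :=
  {ae mu, forall x, forall r, index_set R k r -> (1 <= card (F r x))%E} /\
  exists2 Psi : set (X -> X),
    [/\ countable Psi, Psi `<=` Inn E & generates mu E Psi] &
    forall psi, Psi psi -> {ae mu, forall x,
      fine (card (F r x `+` psi @` F r x)) / fine (card (F r x))
        @[r --> index_oo R k] --> (0 : R)}.

Definition uniform_family mu k F : Prop :=
  exists (Cu : R) (a b : R -> R),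
    [/\ 0 < Cu,
        (forall r, index_set R k r ->
           [/\ 0 < a r, 0 < b r & b r <= Cu * a r]) &
        forall r, index_set R k r -> {ae mu, forall x,
          ((a r)%:E <= card (F r x) <= (b r)%:E)%E /\
          ((a r)%:E <= card (sf_inv (F r) x) <= (b r)%:E)%E}].

Definition regular_family mu k F : Prop :=
  exists2 C : R, 0 < C &
    {ae mu, forall x, forall r, index_set R k r ->
      (card (\bigcup_(s in index_le k r) sf_comp (sf_inv (F s)) (F r) x)
         <= C%:E * card (F r x))%E}.

(* The bound n - 1 is a real subtraction: for n = 0 the union is empty. *)
Definition tempered mu k F : Prop :=
  k = IndexNat /\
  exists C : R,
    {ae mu, forall x, forall n, index_set R k n ->
      (card (\bigcup_(m in index_le k (n - 1)) sf_comp (sf_inv (F m)) (F n) x)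
         <= C%:E * card (F n x))%E}.

Definition average (f : X -> R) U (x : X) : R :=
  (fine (card (U x)))^-1 * \sum_(y \in U x) f y.

End subset_functions.

(* Main.v *)
(* Pick a countable group G of Borel automorphisms from the generating set Psi;
   almost everywhere its orbits are the classes, and mass transport holds for G.
   A function f in L1 is approximated by h + c, with h invariant and c a finite
   combination of coboundaries u - u \o psi, u bounded, by minimising an L2
   distance.  Averages of h are h, those of c tend to 0 by asymptotic invariance,
   and those of the remainder, which is small in L1, are controlled by a weak-type
   (1,1) maximal inequality along a Borel-Cantelli subsequence; finally h and f have
   the same integral over invariant sets, so h is the conditional expectation.

   For the maximal inequality, a measurable selection assigns to almost every bad
   point x an index rho(x) at which its average is large, even though for real
   indices the set of bad points is only analytic.  The sets F_rho(x)(x), taken by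
   decreasing index, are given greedy fractional weights covering each point at
   most twice; regularity (or temperedness) and mass transport bound the measure
   of the bad set by the total weighted mass.  Real indices are first discretised
   so finely that meeting sets with almost equal indices have equal indices. *)

Require Import Defs.
From HB Require Import structures.
From mathcomp Require Import all_boot all_order all_algebra.
From mathcomp Require Import all_classical all_reals all_analysis.
From mathcomp Require Import measurable_realfun.
From mathcomp Require Import ring lra zify.
Import Order.TTheory GRing.Theory Num.Theory.
Import numFieldNormedType.Exports.
Local Open Scope classical_set_scope.
Local Open Scope ring_scope.

Set Implicit Arguments.
Unset Strict Implicit.
Unset Printing Implicit Defensive.

(** * Measurable selection *)

(** Choosing disjoint sets greedily would need a measurable way to break ties between points of
    equal rank. Fractional weights make no choice. The price is a factor 2, since a point may be
    covered once by earlier ranks and once by the current one; this gives the constant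
    [2 * (C1 + C2)], where [C1] says how well a set pays for its own point and [C2] counts the
    points of higher rank whose sets meet it.

    Weights are defined by recursion on the rank, so ranks are natural numbers. For real indices a
    rank would mix different indices, while regularity bounds, for a given point, only the meeting
    points of no larger index; hence the need for equal indices within a rank.

    Selection serves twice: to pick a bad index from a continuum, and to pass from a set of pairs
    that is null for [mu \x counting] to almost every point. Elsewhere measurability inside a class
    is pulled back along the maps sending [x] to [(x, g i x)], so that no projection occurs. *)

Definition agree (n : nat) (a b : nat -> nat) : Prop :=
  forall i, (i < n)%N -> a i = b i.

(** The pairing is explicit because prefixes must be tracked: by [nat_pairing_lt], the first [n]
    terms of an interleaved sequence contain the prefix that the condition numbered [n] reads. *)
Definition nat_pairing (i j : nat) : nat := (2 ^ i * j.*2.+1).-1.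
Definition nat_pairing1 (n : nat) : nat := logn 2 n.+1.
Definition nat_pairing2 (n : nat) : nat := (n.+1 %/ 2 ^ logn 2 n.+1)./2.

Lemma nat_pairingS i j : (nat_pairing i j).+1 = (2 ^ i * j.*2.+1)%N.
Proof. by rewrite /nat_pairing prednK// muln_gt0 expn_gt0. Qed.

Lemma logn2_pairing i j : logn 2 (2 ^ i * j.*2.+1) = i.
Proof.
rewrite lognM ?expn_gt0// pfactorK// logn_coprime ?addn0//.
by rewrite coprime2n /= odd_double.
Qed.

Lemma nat_pairing1K i j : nat_pairing1 (nat_pairing i j) = i.
Proof. by rewrite /nat_pairing1 nat_pairingS logn2_pairing. Qed.

Lemma nat_pairing2K i j : nat_pairing2 (nat_pairing i j) = j.
Proof.
rewrite /nat_pairing2 nat_pairingS logn2_pairing mulKn ?expn_gt0//.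
by rewrite -[_.+1]/(true + _)%N half_bit_double.
Qed.

Lemma nat_pairing_lt n j : (j < nat_pairing2 n)%N ->
  (nat_pairing (nat_pairing1 n) j < n)%N.
Proof.
rewrite /nat_pairing2 => jn.
rewrite -ltnS nat_pairingS /nat_pairing1.
have dvd2 : (2 ^ logn 2 n.+1 %| n.+1)%N by apply: pfactor_dvdnn.
have : (j.*2.+1 < n.+1 %/ 2 ^ logn 2 n.+1)%N.
  set q := (_ %/ _)%N in jn *.
  by have := odd_double_half q; move: jn; lia.
by rewrite ltn_divRL// mulnC.
Qed.

(** * Souslin sets depending on a sequence *)

Section souslin.
Context d (X : measurableType d).

(** The Souslin operation with the sequence [a] as a parameter. Condition [n] reads only the first
    [n] terms of [a] and of the witness [b], so only countably many measurable sets are involved. *)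
Definition souslin (B : set (X * (nat -> nat))) : Prop :=
  exists P : nat -> (nat -> nat) -> (nat -> nat) -> set X,
  [/\ (forall n a b, measurable (P n a b)),
      (forall n a b a' b', agree n a a' -> agree n b b' -> P n a b = P n a' b') &
      forall x a, B (x, a) <-> exists b, forall n, P n a b x].

Lemma souslin_bigcup (B : nat -> set (X * (nat -> nat))) :
  (forall i, souslin (B i)) -> souslin (\bigcup_i B i).
Proof.
move=> /choice[P HP].
(* The first term of the witness names the index [i], and the rest is a witness for [B i]. Condition
   0 is void, since it may not read any term. *)
exists (fun n a b => if n is m.+1 then P (b 0%N) m a (fun i => b i.+1) else setT).
split.
- case=> [|n] a b; first exact: measurableT.
  by have [H _ _] := HP (b 0%N); exact: H.
- case=> // n a b a' b' aa' bb'.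
  rewrite (bb' 0%N)//; have [_ H _] := HP (b' 0%N); apply: H => i ni.
    by apply: aa'; exact: ltnW.
  exact: bb'.
- move=> x a; split.
    move=> [i _ Bi]; have [_ _ H] := HP i.
    have /H[b Hb] := Bi; exists (fun n => if n is m.+1 then b m else i).
    by case.
  move=> [b Hb]; exists (b 0%N) => //; have [_ _ ->] := HP (b 0%N).
  by exists (fun i => b i.+1) => n; exact: (Hb n.+1).
Qed.

Lemma souslin_bigcap (B : nat -> set (X * (nat -> nat))) :
  (forall i, souslin (B i)) -> souslin (\bigcap_i B i).
Proof.
move=> /choice[P HP].
(* One witness interleaves witnesses for all the [B i]: term [j] of the [i]-th stands at position
   [nat_pairing i j]. *)
exists (fun n a b => P (nat_pairing1 n) (nat_pairing2 n) a
   (fun j => b (nat_pairing (nat_pairing1 n) j))).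
split.
- by move=> n a b; have [H _ _] := HP (nat_pairing1 n); exact: H.
- move=> n a b a' b' aa' bb'; have [_ H _] := HP (nat_pairing1 n).
  apply: H => i /nat_pairing_lt ni; last exact: bb'.
  apply: aa'; apply: leq_ltn_trans ni; rewrite -ltnS nat_pairingS.
  by rewrite -[i.+1]mul1n leq_mul ?expn_gt0// ltnS -addnn leq_addr.
- move=> x a; split.
    move=> Bx; have /choice[b Hb] : forall i, exists b, forall n, P i n a b x.
      by move=> i; have [_ _ H] := HP i; apply/H; exact: Bx.
    exists (fun n => b (nat_pairing1 n) (nat_pairing2 n)) => n.
    under eq_fun do rewrite nat_pairing1K nat_pairing2K.
    exact: Hb.
  move=> [b Hb] i _; have [_ _ ->] := HP i.
  exists (fun j => b (nat_pairing i j)) => n.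
  by have := Hb (nat_pairing i n); rewrite nat_pairing1K nat_pairing2K.
Qed.

Lemma souslin_cylinder n (Q : (nat -> nat) -> set X) :
  (forall a, measurable (Q a)) -> (forall a b, agree n a b -> Q a = Q b) ->
  souslin [set p | Q p.2 p.1].
Proof.
move=> mQ aQ; exists (fun m a _ => if m == n then Q a else setT); split.
- by move=> m a b; case: ifP.
- by move=> m a b a' b' aa' bb'; case: eqP aa' => // -> /aQ.
- move=> x a /=; split; first by exists id => m; case: eqP.
  by move=> [b /(_ n)]; rewrite eqxx.
Qed.

Lemma souslin_set0 : souslin set0.
Proof.
have := @souslin_cylinder 0 (fun=> set0) (fun=> measurable0) (fun _ _ _ => erefl).
by congr souslin; apply/seteqP; split.
Qed.

Lemma souslinI B C : souslin B -> souslin C -> souslin (B `&` C).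
Proof.
move=> sB sC.
have -> : B `&` C = \bigcap_i (if i is 0%N then B else C).
  apply/seteqP; split=> p; first by move=> [? ?] [|?] _.
  by move=> H; split; [exact: (H 0%N)|exact: (H 1%N)].
by apply: souslin_bigcap => -[|i].
Qed.

End souslin.
Arguments souslin {d X}.

Section souslin_selection.
Context d (X : measurableType d) (R : realType) (mu : probability X R).

(** An intersection of measurable supersets of [G] with measures approaching the infimum attains it;
    cutting it down by a further superset [A] cannot lower its measure. *)
Lemma measurable_hull (G : set X) : exists H, [/\ measurable H, G `<=` H &
  forall A, measurable A -> G `<=` A -> mu (H `\` A) = 0%E].
Proof.
pose I := [set mu A | A in [set A | measurable A /\ G `<=` A]].
have I0 : forall y, I y -> y \is a fin_num.
  by move=> _ [A [mA _]] <-; exact: fin_num_measure.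
have Inf0 : (ereal_inf I \is a fin_num)%E.
  rewrite ge0_fin_numE; last by apply: le_ereal_inf_tmp => _ [A _ <-]; exact: measure_ge0.
  apply: (@le_lt_trans _ _ (mu setT)); last by rewrite probability_setT ltry.
  by apply: ereal_inf_lbound; exists setT => //; split.
have /choice[A HA] : forall n : nat, exists A, [/\ measurable A, G `<=` A &
    (mu A < ereal_inf I + (n.+1%:R^-1)%:E)%E].
  move=> n; have e0 : (0 < n.+1%:R^-1 :> R)%R by rewrite invr_gt0 ltr0n.
  have [_ [A [mA GA] <-] Alt] := lb_ereal_inf_adherent e0 Inf0.
  by exists A.
pose H := \bigcap_n A n.
have mH : measurable H by apply: bigcapT_measurable => n; case: (HA n).
have GH : G `<=` H by move=> x Gx n _; case: (HA n) => _ + _; exact.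
exists H; split => // B mB GB.
have muH : mu H = ereal_inf I.
  apply/eqP; rewrite eq_le; apply/andP; split; last first.
    by apply: ereal_inf_lbound; exists H.
  apply/lee_addgt0Pr => e e0.
  have [n ne] : exists n, (n.+1%:R^-1 < e)%R.
    have := near_infty_natSinv_lt (PosNum e0) => -[n _ Hn]; exists n.
    by apply: Hn => /=.
  apply: (@le_trans _ _ (mu (A n))).
    by apply: le_measure; rewrite ?inE//; [case: (HA n)|move=> x; exact].
  case: (HA n) => _ _ /ltW /le_trans; apply.
  by rewrite leeD2l// lee_fin ltW.
have HB : mu H = mu (H `&` B).
  apply/eqP; rewrite eq_le measureIl// andbT muH; apply: ereal_inf_lbound.
  exists (H `&` B) => //; split; first exact: measurableI.
  by move=> x Gx; split; [exact: GH|exact: GB].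
rewrite measureD//; last by rewrite (le_lt_trans (probability_le1 _ _))// ltry.
transitivity (mu H - mu H)%E; first by congr (_ - _)%E; exact: esym HB.
by apply: subee; exact: fin_num_measure.
Qed.

(* Classical (Lusin, Marczewski): Souslin sets are measurable up to null sets.
   [H s] hulls the set of points with a branch through [s]; outside the null set
   of points lying in [H s] but in no [H (rcons s k)], the leftmost branch
   staying in the hulls never dies. *)
Lemma souslin_selection (Q : nat -> (nat -> nat) -> set X) :
  (forall n a, measurable (Q n a)) ->
  (forall n a b, agree n a b -> Q n a = Q n b) ->
  exists c : X -> nat -> nat,
    (forall i j, measurable [set x | c x i = j]) /\
    {ae mu, forall x, (exists a, forall n, Q n a x) -> forall n, Q n (c x) x}.
Proof.
move=> mQ aQ.
pose G s := [set x | exists a, agree (size s) a (nth 0%N s) /\ forall n, Q n a x].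
have /choice[H0 hullH] := fun s => measurable_hull (G s).
(* Intersecting with [Q] keeps a superset of [G s] and makes membership along a branch yield the
   conclusion. *)
pose H s := H0 s `&` Q (size s) (nth 0%N s).
have mH s : measurable (H s) by apply: measurableI => //; case: (hullH s).
have GH s : G s `<=` H s.
  move=> x Gx; split; first by case: (hullH s) => _ + _; exact.
  by case: Gx => a [/aQ <-].
pose N s := H s `\` \bigcup_k H (rcons s k).
have mN s : measurable (N s).
  by apply: measurableD => //; exact: bigcupT_measurable.
(* A branch through [s] passes through some [rcons s k], so the union of the next hulls is a
   measurable superset of [G s] and misses only a null part of its hull. *)
have N0 s : mu (N s) = 0%E.
  case: (hullH s) => mH0 _ /(_ (\bigcup_k H (rcons s k))) h.
  apply: (subset_measure0 _ _ _ (h _ _)) => //.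
  - by apply: measurableD => //; exact: bigcupT_measurable.
  - by move=> x [[? ?] ?]; split.
  - exact: bigcupT_measurable.
  - move=> x [a [aa Qa]]; exists (a (size s)) => //; apply: GH; exists a; split => //.
    move=> i; rewrite size_rcons ltnS nth_rcons leq_eqVlt.
    by case: ltnP => [/aa//|_]; rewrite orbF => /eqP ->; rewrite eqxx.
pose next s x := if pselect (exists k, `[<H (rcons s k) x>]) is left e
                 then ex_minn e else 0%N.
have nextP s x : H s x -> ~ N s x -> H (rcons s (next s x)) x.
  move=> Hs Ns; rewrite /next; case: pselect => [e|ne].
    by case: ex_minnP => k /asboolP.
  exfalso; apply: Ns; split=> // -[k _ Hk]; apply: ne; exists k; exact/asboolP.
have mnext s k : measurable [set x | next s x = k].
  have -> : [set x | next s x = k] =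
      (H (rcons s k) `\` \bigcup_(j in `I_k) H (rcons s j)) `|`
      (if k == 0%N then ~` (\bigcup_j H (rcons s j)) else set0).
    apply/seteqP; split => x /=.
      rewrite /next; case: pselect => [e|ne].
        case: ex_minnP => m /asboolP Hm mmin <-; left; split => //.
        move=> [j /= jm Hj]; have := mmin j; rewrite leqNgt jm => hmin.
        suff : false by []; apply: hmin.
        exact/asboolP.
      move=> <-; right; rewrite eqxx => -[j _ Hj]; apply: ne; exists j.
      exact/asboolP.
    case=> [[Hk nHk]|].
      rewrite /next; case: pselect => [e|[]]; last by exists k; exact/asboolP.
      case: ex_minnP => m /asboolP Hm mmin; apply/eqP; rewrite eqn_leq.
      rewrite mmin ?andTb; last exact/asboolP.
      by rewrite leqNgt; apply/negP => mk; apply: nHk; exists m.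
    case: ifP => // /eqP -> nH; rewrite /next; case: pselect => // e.
    by exfalso; case: e => j /asboolP Hj; apply: nH; exists j.
  apply: measurableU; first apply: measurableD => //.
    by apply: bigcup_measurable.
  case: ifP => // _; apply: measurableC; exact: bigcupT_measurable.
pose br x := fix br n := if n is m.+1 then rcons (br m) (next (br m) x) else [::].
have szbr x n : size (br x n) = n.
  by elim: n => //= n IH; rewrite size_rcons IH.
have nthbr x n m : (m < n)%N -> nth 0%N (br x n) m = next (br x m) x.
  elim: n => //= n IH; rewrite ltnS leq_eqVlt => /predU1P[->|mn].
    by rewrite nth_rcons szbr ltnn eqxx.
  by rewrite nth_rcons szbr mn IH.
have mbr n s : measurable [set x | br x n = s].
  elim: n s => [|n IH] s.
    have [->|s0] := eqVneq s [::].
      by rewrite (_ : mkset _ = setT)//; apply/seteqP; split.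
    rewrite (_ : mkset _ = set0)//; apply/seteqP; split => x //= /esym s0'.
    by rewrite s0' eqxx in s0.
  case/lastP: s => [|s k].
    rewrite (_ : mkset _ = set0)//; apply/seteqP; split => x //= /eqP.
    by rewrite -size_eq0 size_rcons.
  rewrite (_ : mkset _ = [set x | br x n = s] `&` [set x | next s x = k]).
    exact: measurableI.
  apply/seteqP; split => x /=; first by move=> /rcons_inj[-> <-].
  by move=> [-> ->].
exists (fun x n => next (br x n) x); split.
  move=> i j.
  rewrite (_ : mkset _ =
    \bigcup_(s in [set: seq nat]) ([set x | br x i = s] `&` [set x | next s x = j])).
    apply: countable_bigcupT_measurable; first exact: countableP.
    by move=> s; exact: measurableI.
  apply/seteqP; split => x /=; first by move=> <-; exists (br x i).
  by move=> [s _ [/= -> ->]].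
have Nneg s : mu.-negligible (N s) by exists (N s); split.
have : mu.-negligible (\bigcup_(s in [set: seq nat]) N s).
  have -> : \bigcup_(s in [set: seq nat]) N s =
     \bigcup_i (if unpickle i is Some s then N s else set0).
    apply/seteqP; split => x; first move=> [s _ Ns].
      by exists (pickle s) => //; rewrite pickleK.
    by move=> [i _]; case: unpickle => // s Ns; exists s.
  apply: negligible_bigcup => i; exact: Nneg.
apply: negligibleS => x /= nQ; apply: contrapT => nN; apply: nQ => -[a Qa] n.
have HB m : H (br x m) x.
  elim: m => [|m IH] /=.
    by apply: GH; exists a; split => // i.
  by apply: nextP => // Nx; apply: nN; exists (br x m).
have [_] := HB n; rewrite szbr (aQ _ _ (fun m => next (br x m) x))// => i ni.
by rewrite nthbr.
Qed.

End souslin_selection.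

(* A coding of [S] by the branches [a] of the relation [C], such that belonging
   to a generating set is an open condition on the code [a]. *)
Definition branch (C : nat -> nat -> nat -> Prop) (a : nat -> nat) : Prop :=
  forall n, C n (a n) (a n.+1).

Definition coded d (S : measurableType d) : Prop :=
  exists (C : nat -> nat -> nat -> Prop) (tau : (nat -> nat) -> S)
    (O : set (set S)),
  [/\ forall s, exists2 a, branch C a & tau a = s,
      (measurable : set (set S)) `<=` <<s O >>,
      O `<=` measurable &
      forall U, O U -> exists W : nat -> nat -> Prop, forall a, branch C a ->
        (U (tau a) <-> exists n, W n (a n))].

(** * Coding a Polish space by rapidly converging sequences of dense points *)

Section polish.
Context {R : realType} (T : completePseudoMetricType R).

Lemma countable_dense_seq (D : set T) : countable D -> dense D ->
  exists s : nat -> T, forall U, open U -> U !=set0 -> exists n, U (s n).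
Proof.
move=> /countable_injP[f injf] dD.
have /choice[s Hs] : forall n : nat, exists t,
    (exists2 t', D t' & f t' = n) -> D t /\ f t = n.
  move=> n; have [[t Dt ft]|N] := pselect (exists2 t', D t' & f t' = n).
    by exists t.
  by exists point => /N.
exists s => U oU U0; have [t [Ut Dt]] := dD U U0 oU.
exists (f t); have [|Ds fs] := Hs (f t); first by exists t.
by rewrite (injf _ _ _ _ fs)// inE.
Qed.

Variable s : nat -> T.
Hypothesis hT : hausdorff_space T.
Hypothesis ds : forall U, open U -> U !=set0 -> exists n, U (s n).

Lemma ball_triangle_le (M : pseudoMetricType R) (x y z : M) (e1 e2 e : R) :
  ball x e1 y -> ball y e2 z -> e1 + e2 <= e -> ball x e z.
Proof. by move=> xy yz /le_ball; apply; exact: ball_triangle yz. Qed.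

Let C n i j := ball (s i) (2 ^- n) (s j).

Let r_gt0 n : 0 < 2 ^- n :> R.
Proof. by rewrite invr_gt0 exprn_gt0. Qed.

Let rS n : 2 ^- n = 2 * 2 ^- n.+1 :> R.
Proof. by rewrite exprS invfM mulrA mulfV ?mul1r. Qed.

Lemma rapid_ball a n k : branch C a -> ball (s (a n)) (3 * 2 ^- n) (s (a (n + k)%N)).
Proof.
move=> Ca; apply: (@le_ball _ _ _ (3 * 2 ^- n - 2 * 2 ^- (n + k)%N)).
  by rewrite gerBl mulr_ge0// ltW.
elim: k => [|k IH].
  by rewrite addn0; apply: ballxx; have := r_gt0 n; lra.
rewrite addnS; apply: ball_triangle_le IH (Ca (n + k)%N) _.
by rewrite (rS (n + k)%N); lra.
Qed.

Lemma small_radius e : 0 < e -> \forall n \near \oo, 2 ^- n < e :> R.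
Proof.
move=> e0; have : (fun n => (2^-1 : R) ^+ n) @ \oo --> (0 : R).
  by apply: cvg_expr; rewrite ger0_norm ?invr_ge0// invf_lt1// ltr1n.
move=> /cvgr0Pnorm_lt/(_ _ e0); apply: filterS => n.
by rewrite ger0_norm ?exprn_ge0 ?invr_ge0// exprVn.
Qed.

Let tau a := lim ((s \o a) @ \oo).

Lemma rapid_cvg a : branch C a -> (s \o a) @ \oo --> tau a.
Proof.
move=> Ca; apply: cauchy_cvg; apply: cauchy_exP => e e0.
have [N _ HN] : \forall n \near \oo, 2 ^- n < e / 3 :> R.
  by apply: small_radius; rewrite divr_gt0.
exists (s (a N)); exists N => // n /= Nn.
rewrite -(subnKC Nn).
apply: le_ball (@rapid_ball a N (n - N) Ca).
by have := HN N (leqnn N); rewrite /=; lra.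
Qed.

Lemma rapid_lim_ball a n : branch C a -> ball (s (a n)) (4 * 2 ^- n) (tau a).
Proof.
move=> Ca; have /cvg_ballP/(_ _ (r_gt0 n))[N _ HN] := @rapid_cvg a Ca.
have /= := HN (n + N)%N (leq_addl _ _) => /ball_sym HB.
by apply: ball_triangle_le (@rapid_ball a n N Ca) HB _; lra.
Qed.

Lemma rapid_surj t : exists2 a, branch C a & tau a = t.
Proof.
have /choice[a Ha] : forall n, exists i, ball t (2 ^- n.+2) (s i).
  move=> n; have [||i Hi] := ds (U := interior (ball t (2 ^- n.+2))).
  - exact: open_interior.
  - by exists t; apply: nbhsx_ballx.
  - by exists i; exact: interior_subset.
have Ca : branch C a.
  move=> n; apply: ball_triangle_le (ball_sym (Ha n)) (Ha n.+1) _.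
  by rewrite (rS n) (rS n.+1) (rS n.+2); have := r_gt0 n.+3; lra.
exists a => //; apply: cvg_lim => //; apply/cvg_ballP => e e0.
apply: filterS (small_radius e0) => n /= ne.
apply: le_ball (Ha n); apply: le_trans (ltW ne).
by rewrite (rS n) (rS n.+1); have := r_gt0 n.+2; lra.
Qed.

(** Membership of the limit becomes a condition on a single term of the code. The radius
    [5 * 2 ^- n] is large enough to contain the limit by [rapid_lim_ball]; conversely such a ball
    lies within [9 * 2 ^- n] of the limit, [9] being [4 + 5]. *)
Lemma rapid_open U a : open U -> branch C a ->
  U (tau a) <-> exists n, ball (s (a n)) (5 * 2 ^- n) `<=` U.
Proof.
move=> oU Ca; split; last first.
  move=> [n]; apply; apply: le_ball (@rapid_lim_ball a n Ca).
  by have := r_gt0 n; lra.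
move=> Ut; have /nbhs_ballP[e e0 He] : nbhs (tau a) U by exact: open_nbhs_nbhs.
have [N _ HN] : \forall n \near \oo, 2 ^- n < e / 9 :> R.
  by apply: small_radius; rewrite divr_gt0.
exists N => t Ht; apply: He.
apply: ball_triangle_le (ball_sym (@rapid_lim_ball a N Ca)) Ht _.
by have := HN N (leqnn N); rewrite /=; lra.
Qed.

End polish.

Lemma standard_borel_coded (R : realType) d (S : measurableType d) :
  standard_borel R S -> coded S.
Proof.
move=> [T [h [hT [D cD dD] [g hK gK] mh]]].
have [s ds] := countable_dense_seq cD dD.
exists (fun n i j => ball (s i) (2 ^- n) (s j)).
exists (fun a => g (lim ((s \o a) @ \oo))).
exists [set h @^-1` U | U in [set U | open U]].
have hpre A : h @^-1` (h @` A) = A.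
  apply/seteqP; split => x /=; last by exists x.
  by move=> [y Ay /(can_inj hK) <-].
have him V : h @` (h @^-1` V) = V.
  apply/seteqP; split => x /=; first by move=> [y Vy <-].
  by move=> Vx; exists (g x); rewrite /= gK.
split.
- move=> x; have [a Ca ta] := rapid_surj hT ds (h x).
  by exists a => //; rewrite ta hK.
- move=> A /mh; rewrite -{2}(hpre A).
  move: (h @` A) => V.
  apply: (@smallest_sub _ _ _
    [set V | <<s [set h @^-1` U | U in [set U | open U]] >> (h @^-1` V)]).
    split => /=.
    + exact: sigma_algebra0.
    + by move=> W HW; rewrite setTD preimage_setC; apply: sigma_algebraC.
    + by move=> W HW; rewrite preimage_bigcup; exact: sigma_algebra_bigcup.
  by move=> W oW /=; apply: sub_sigma_algebra; exists W.
- by move=> _ [U oU <-]; apply/mh; rewrite him; exact: sub_sigma_algebra.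
- move=> _ [U oU <-]; exists (fun n i => ball (s i) (5 * 2 ^- n) `<=` U) => a Ca.
  by rewrite /= gK; exact: rapid_open.
Qed.

Lemma standard_borel_real (R : realType) : standard_borel R R.
Proof.
exists R, id; split => //.
- exists [set ratr q | q in [set: rat]].
    by apply: (sub_countable (card_image_le _ _)); exact: countableP.
  exact: dense_rat.
- by exists id.
- move=> A; rewrite image_id; split.
    rewrite [measurable A](_ : _ = (@measurable_realfun.RGenOpens.G R).-sigma.-measurable A).
      apply: smallest_sub; first exact: smallest_sigma_algebra.
      move=> _ [x [y ->]]; apply: sub_sigma_algebra; exact: interval_open.
    by rewrite -measurable_realfun.RGenOpens.measurableE.
  apply: smallest_sub; first exact: sigma_algebra_measurable.
  by move=> U; exact: measurable_realfun.open_measurable.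
Qed.

(** * Almost everywhere defined measurable sections of measurable sets *)

Section measurable_section.
Context d (X : measurableType d) d' (S : measurableType d').
Variables (C : nat -> nat -> nat -> Prop) (tau : (nat -> nat) -> S).
Variable (O : set (set S)).
Hypothesis tau_surj : forall s, exists2 a, branch C a & tau a = s.
Hypothesis subO : (measurable : set (set S)) `<=` <<s O >>.
Hypothesis tauO : forall U, O U -> exists W : nat -> nat -> Prop, forall a,
  branch C a -> (U (tau a) <-> exists n, W n (a n)).

Let decode (B : set (X * S)) : set (X * (nat -> nat)) :=
  [set p | branch C p.2 /\ B (p.1, tau p.2)].

(** Souslin sets are not closed under complement. Asking the property of [B] and of its complement
    gives a sigma-algebra, which then contains all measurable sets. *)
Let bisouslin (B : set (X * S)) :=
  souslin (decode B) /\ souslin (decode (~` B)).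

Let souslin_const A : measurable A -> souslin [set p : X * (nat -> nat) | A p.1].
Proof.
by move=> mA; exact: (@souslin_cylinder _ X 0%N (fun=> A)).
Qed.

Let souslin_prefix n (D : (nat -> nat) -> Prop) :
  (forall a b, agree n a b -> D a = D b) ->
  souslin [set p : X * (nat -> nat) | D p.2].
Proof.
move=> aD; apply: (@souslin_cylinder _ X n (fun a => [set _ | D a])).
  move=> a; have [Da|nDa] := pselect (D a).
    by rewrite (_ : mkset _ = setT)//; apply/seteqP; split.
  by rewrite (_ : mkset _ = set0)//; apply/seteqP; split.
by move=> a b /aD ab; rewrite ab.
Qed.

Let souslin_branch : souslin [set p : X * (nat -> nat) | branch C p.2].
Proof.
rewrite (_ : mkset _ = \bigcap_n [set p : X * (nat -> nat) | C n (p.2 n) (p.2 n.+1)]).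
  apply: souslin_bigcap => n.
  apply: (@souslin_prefix n.+2 (fun a => C n (a n) (a n.+1))) => a b ab.
  by rewrite !ab.
by apply/seteqP; split=> p /= H n => [_|]; exact: H.
Qed.

Let bisouslin_bigcup (B : nat -> set (X * S)) :
  (forall i, bisouslin (B i)) -> bisouslin (\bigcup_i B i).
Proof.
move=> sB; split.
  rewrite (_ : decode _ = \bigcup_i decode (B i)).
    by apply: souslin_bigcup => i; case: (sB i).
  apply/seteqP; split => p; first by move=> [bp [i _ Bi]]; exists i.
  by move=> [i _ [bp Bi]]; split => //; exists i.
rewrite (_ : decode _ = \bigcap_i decode (~` B i)).
  by apply: souslin_bigcap => i; case: (sB i).
apply/seteqP; split => p.
  by move=> [bp nB] i _; split => // Bi; apply: nB; exists i.
move=> H; split; first by case: (H 0%N I).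
by move=> [i _ Bi]; case: (H i I).
Qed.

Let bisouslin_sigma_algebra : sigma_algebra setT bisouslin.
Proof.
split.
- split; last first.
    rewrite (_ : decode _ = [set p | branch C p.2])//.
    by apply/seteqP; split => [p []//|p bp]; split.
  rewrite (_ : decode _ = set0); first exact: souslin_set0.
  by apply/seteqP; split => p [].
- by move=> B [B1 B2]; rewrite setTD; split => //; rewrite setCK.
- exact: bisouslin_bigcup.
Qed.

Let bisouslin_fst A : measurable A -> bisouslin (fst @^-1` A).
Proof.
move=> mA; split.
  exact: souslinI souslin_branch (souslin_const mA).
exact: souslinI souslin_branch (souslin_const (measurableC mA)).
Qed.

(** For a generator the coding gives an existential condition over the terms of the code, and a
    universal one for the complement; a countable union and a countable intersection are both
    Souslin. *)
Let bisouslin_snd V : measurable V -> bisouslin (snd @^-1` V).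
Proof.
move=> /subO; move: V.
apply: (@smallest_sub _ _ _ [set V | bisouslin (snd @^-1` V)]).
  case: bisouslin_sigma_algebra => s0 sC sU; split => /=.
  - by rewrite preimage_set0.
  - by move=> V; rewrite setTD -preimage_setC -setTD; exact: sC.
  - by move=> V HV; rewrite preimage_bigcup; exact: sU.
move=> U /tauO[W HW].
split.
  rewrite (_ : decode _ = [set p | branch C p.2] `&`
      \bigcup_n [set p : X * (nat -> nat) | W n (p.2 n)]).
    apply: souslinI => //; apply: souslin_bigcup => n.
    by apply: (@souslin_prefix n.+1 (fun a => W n (a n))) => a b ->.
  apply/seteqP; split => p /= [Cp].
    by move=> /(HW _ Cp)[n Wn]; split => //; exists n.
  by move=> [n _ Wn]; split => //; apply/(HW _ Cp); exists n.
rewrite (_ : decode _ = [set p | branch C p.2] `&`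
      \bigcap_n [set p : X * (nat -> nat) | ~ W n (p.2 n)]).
  apply: souslinI => //; apply: souslin_bigcap => n.
  by apply: (@souslin_prefix n.+1 (fun a => ~ W n (a n))) => a b ->.
apply/seteqP; split => p /= [Cp].
  by move=> nU; split => // n _ /= Wn; apply: nU; apply/(HW _ Cp); exists n.
by move=> H; split => // /(HW _ Cp)[n Wn]; exact: (H n).
Qed.

Lemma bisouslin_measurable B : measurable B -> bisouslin B.
Proof.
move: B; apply: smallest_sub; first exact: bisouslin_sigma_algebra.
move=> B [] [A mA]; rewrite setTI => <-; [exact: bisouslin_fst|exact: bisouslin_snd].
Qed.

Let measurable_decode (a : X -> nat -> nat) s0 :
  (forall i j, measurable [set x | a x i = j]) ->
  measurable_fun setT (fun x => if `[< branch C (a x) >] then tau (a x) else s0).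
Proof.
move=> ma.
have mD n (D : nat -> Prop) : measurable [set x | D (a x n)].
  rewrite (_ : mkset _ = \bigcup_(j in D) [set x | a x n = j]).
    exact: bigcup_measurable.
  by apply/seteqP; split => x /=; [move=> Dx; exists (a x n)|move=> [j Dj /= ->]].
have mbr : measurable [set x | branch C (a x)].
  rewrite (_ : mkset _ = \bigcap_n [set x | C n (a x n) (a x n.+1)]); last first.
    by apply/seteqP; split=> p /= H n => [_|]; exact: H.
  apply: bigcapT_measurable => n.
  rewrite (_ : mkset _ = \bigcup_j ([set x | a x n = j] `&` [set x | C n j (a x n.+1)])).
    by apply: bigcupT_measurable => j; apply: measurableI => //; exact: mD.
  apply/seteqP; split => x /=; first by move=> ?; exists (a x n).
  by move=> [j _ [/= ->]].
move=> _ V mV; rewrite setTI.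
pose br := [set x | branch C (a x)].
rewrite (_ : _ @^-1` _ = (br `&` [set x | V (tau (a x))]) `|`
    (~` br `&` [set _ | V s0])); last first.
  apply/seteqP; split => x /=; case: asboolP => bx.
  - by left.
  - by right.
  - by case=> [][].
  - by case=> [][].
apply: measurableU.
  move: V mV => V /subO; move: V.
  apply: (@smallest_sub _ _ _ [set V | measurable (br `&` [set x | V (tau (a x))])]).
    split => /=.
    - by rewrite (_ : mkset _ = set0) ?setI0//; apply/seteqP; split.
    - move=> V mV; rewrite (_ : _ `&` _ = br `\` (br `&` [set x | V (tau (a x))])).
        exact: measurableD.
      apply/seteqP; split => x /=; first by move=> [? [_ ?]]; split => // -[].
      by move=> [? H]; split => //; split => // ?; apply: H.
    - move=> V mV; rewrite (_ : _ `&` _ = \bigcup_i (br `&` [set x | V i (tau (a x))])).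
        exact: bigcupT_measurable.
      by rewrite -setI_bigcupr; congr (_ `&` _); apply/seteqP; split.
  move=> U /tauO[W HW] /=.
  rewrite (_ : _ `&` _ = br `&` \bigcup_n [set x | W n (a x n)]).
    by apply: measurableI => //; apply: bigcupT_measurable => n; exact: (mD n (W n)).
  apply/seteqP; split => x /= [bx].
    by move=> /(HW _ bx)[n Wn]; split => //; exists n.
  by move=> [n _ Wn]; split => //; apply/(HW _ bx); exists n.
apply: measurableI; first exact: measurableC.
have [Vs|nVs] := pselect (V s0).
  by rewrite (_ : mkset _ = setT)//; apply/seteqP; split.
by rewrite (_ : mkset _ = set0)//; apply/seteqP; split.
Qed.

Lemma ae_measurable_section_of_coding (R : realType) (mu : probability X R)
    (B : set (X * S)) : measurable B ->
  exists rho : X -> S, measurable_fun setT rho /\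
    {ae mu, forall x, (exists s, B (x, s)) -> B (x, rho x)}.
Proof.
move=> /bisouslin_measurable[[P [mP aP HP]] _].
(* Even terms of the branch code the point of [S], odd terms the Souslin witness; the first [n]
   terms determine [n./2] terms of each. *)
pose Q n c := P n./2 (fun i => c i.*2) (fun i => c i.*2.+1).
have [||c [mc ae_c]] := @souslin_selection _ X R mu Q.
- by move=> n a; exact: mP.
- move=> n a b ab; apply: aP => i ni; apply: ab; lia.
pose a x i := c x i.*2.
exists (fun x => if `[< branch C (a x) >] then tau (a x) else point); split.
  by apply: measurable_decode => i j; exact: mc.
apply: filterS ae_c => x Hx [s Bs].
have [ba Ba] : decode B (x, a x).
  apply/HP; exists (fun i => c x i.*2.+1) => n.
  have /(_ _ n.*2) := Hx; rewrite /Q doubleK; apply.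
  have [e be te] := tau_surj s.
  have /HP[b Hb] : decode B (x, e) by split => //=; rewrite te.
  exists (fun i => if odd i then b i./2 else e i./2) => m.
  rewrite /Q (aP _ _ _ e b)// => i _; first by rewrite odd_double doubleK.
  by rewrite /= odd_double /= uphalf_double.
by case: asboolP.
Qed.

End measurable_section.

Lemma ae_measurable_section (R : realType) d (X : measurableType d)
    d' (S : measurableType d') (mu : probability X R) (B : set (X * S)) :
  standard_borel R S -> measurable B ->
  exists rho : X -> S, measurable_fun setT rho /\
    {ae mu, forall x, (exists s, B (x, s)) -> B (x, rho x)}.
Proof.
move=> hS; have [C [tau [G [surj subG _ tauG]]]] := standard_borel_coded hS.
exact: (ae_measurable_section_of_coding surj subG tauG).
Qed.

(** * Countable group actions and mass transport *)

Section actions.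
Context {R : realType} d {X : measurableType d}.

Record pmp_action (mu : probability X R) (g : nat -> X -> X) : Prop := PmpAction {
  pa_meas : forall i, measurable_fun setT (g i) ;
  pa_inv : forall i, exists j, cancel (g i) (g j) /\ cancel (g j) (g i) ;
  pa_comp : forall i j, exists k, g i \o g j = g k ;
  pa_id : exists i, g i = id ;
  pa_pres : forall i A, measurable A -> mu (g i @^-1` A) = mu A ;
  pa_eq : forall i j, measurable [set x | g i x = g j x] }.

Definition gorbit (g : nat -> X -> X) (x : X) : set X := range (g^~ x).

(** Keeps the least index for each point of the orbit, so that a sum over an orbit is a series with
    measurable terms even where the action is not free. *)
Definition fresh (g : nat -> X -> X) (i : nat) : set X :=
  [set x | forall j, (j < i)%N -> g j x <> g i x].

Variables (mu : probability X R) (g : nat -> X -> X).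
Hypothesis ga : pmp_action mu g.

Lemma gorbit_refl x : gorbit g x x.
Proof. by have [i gi] := pa_id ga; exists i => //; rewrite gi. Qed.

Lemma gorbit_sym x y : gorbit g x y -> gorbit g y x.
Proof.
by move=> [i _ <-]; have [j [ij _]] := pa_inv ga i; exists j => //; rewrite ij.
Qed.

Lemma gorbit_trans x y z : gorbit g x y -> gorbit g y z -> gorbit g x z.
Proof.
move=> [i _ <-] [j _ <-]; have [k gk] := pa_comp ga j i.
by exists k => //; rewrite -gk.
Qed.

Lemma gorbit_g i x : gorbit g x (g i x).
Proof. by exists i. Qed.

Lemma measurable_fresh i : measurable (fresh g i).
Proof.
rewrite (_ : fresh g i = \bigcap_(j in `I_i) ~` [set x | g j x = g i x]).
  by apply: bigcap_measurableType => j _; apply: measurableC; exact: pa_eq ga _ _.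
by apply/seteqP; split.
Qed.

Lemma fresh_ex x y : gorbit g x y -> exists2 i, fresh g i x & g i x = y.
Proof.
move=> [i _ gi].
have e : exists i, `[< g i x = y >] by exists i; exact/asboolP.
case: (ex_minnP e) => m /asboolP gm mmin; exists m => // j jm gj.
by have := mmin j; rewrite leqNgt jm => H; suff : false by []; apply: H;
  apply/asboolP; rewrite gj.
Qed.

Lemma fresh_inj x i j : fresh g i x -> fresh g j x -> g i x = g j x -> i = j.
Proof.
move=> fi fj gij; case: (ltngtP i j) => // ij.
  by case: (fj _ ij gij).
by case: (fi _ ij (esym gij)).
Qed.

Local Open Scope ereal_scope.

Lemma fresh_bij x : set_bij [set i | fresh g i x] (gorbit g x) (g^~ x).
Proof.
split.
- by move=> i _ /=; exact: gorbit_g.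
- by move=> i j; rewrite !inE => fi fj; exact: fresh_inj.
- by move=> y /fresh_ex[i fi <-]; exists i.
Qed.

Lemma esum_mkcondT (T : choiceType) (A : set T) (a : T -> \bar R) :
  \esum_(i in A) a i = \esum_(i in [set: T]) ((\1_A i)%:E * a i).
Proof.
rewrite esum_mkcond; apply: eq_esum => i _.
by rewrite indicE; case: ifP; rewrite ?mul1e ?mul0e.
Qed.

Lemma gorbit_esum_series (a : X -> \bar R) x : (forall y, 0 <= a y) ->
  \esum_(y in gorbit g x) a y = \sum_(i <oo) (\1_(fresh g i) x)%:E * a (g i x).
Proof.
move=> a0; rewrite (reindex_esum _ _ _ _ (fresh_bij x)) esum_mkcondT nneseries_esumT.
  by apply: eq_esum => i _; rewrite /= !indicE.
by move=> i; rewrite mule_ge0// lee_fin.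
Qed.

Lemma measurable_gorbit_esum (K : X -> X -> \bar R) : (forall x y, 0 <= K x y) ->
  (forall i, measurable_fun setT (fun x => K x (g i x))) ->
  measurable_fun setT (fun x => \esum_(y in gorbit g x) K x y).
Proof.
move=> K0 mK.
under eq_fun do rewrite gorbit_esum_series//.
apply: ge0_emeasurable_sum => i.
  by move=> *; rewrite mule_ge0// lee_fin.
move=> _; apply: emeasurable_funM; last exact: mK.
apply/measurable_EFinP; apply: measurable_indic; exact: measurable_fresh.
Qed.

Lemma integral_action i (f : X -> \bar R) : (forall x, 0 <= f x) ->
  measurable_fun setT f -> \int[mu]_x f (g i x) = \int[mu]_x f x.
Proof.
move=> f0 mf.
rewrite -(@ge0_integral_pushforward _ _ _ _ _ _ (pa_meas ga i) mu setT)//.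
apply: eq_measure_integral => [|mg A mA _]; first exact: pa_meas ga _.
exact: (pa_pres ga i mA).
Qed.

(** The term [K x (g i x)] is moved by the inverse of [g i], which preserves [mu]. For fixed [y],
    the points [x] sent to [y] by an index fresh at [x] run through the orbit of [y] exactly
    once. *)
Lemma mass_transport (K : X -> X -> \bar R) : (forall x y, 0 <= K x y) ->
  (forall i, measurable_fun setT (fun x => K x (g i x))) ->
  \int[mu]_x (\esum_(y in gorbit g x) K x y) =
  \int[mu]_x (\esum_(y in gorbit g x) K y x).
Proof.
move=> K0 mK.
have /choice[h gh] := pa_inv ga.
under eq_integral do rewrite gorbit_esum_series//.
have mF i : measurable_fun setT (fun x => (\1_(fresh g i) x)%:E * K x (g i x)).
  apply: emeasurable_funM; last exact: mK.
  by apply/measurable_EFinP; apply: measurable_indic; exact: measurable_fresh.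
have F0 i x : 0 <= (\1_(fresh g i) x)%:E * K x (g i x) by rewrite mule_ge0// lee_fin.
rewrite integral_nneseries//.
under eq_eseriesr => i _ do rewrite -(@integral_action (h i))//.
rewrite -integral_nneseries//; last first.
  by move=> i; exact: (measurableT_comp (mF i) (pa_meas ga (h i))).
apply: eq_integral => y _.
rewrite (reindex_esum [set i | fresh g i (g (h i) y)] _ (fun i => g (h i) y)).
  rewrite esum_mkcondT nneseries_esumT//.
  by apply: eq_esum => i _; rewrite /= !indicE (gh i).2.
split.
- by move=> i _ /=; exact: gorbit_g.
- move=> i j; rewrite !inE /= => fi fj e.
  apply: (@fresh_inj (g (h i) y)) => //; first by rewrite e.
  by rewrite {2}e !(gh _).2.
- move=> x /= /gorbit_sym/fresh_ex[i fi gi].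
  by exists i => /=; rewrite -gi (gh i).1.
Qed.

Lemma ae_gorbit (P : X -> Prop) : {ae mu, forall x, P x} ->
  {ae mu, forall x, forall y, gorbit g x y -> P y}.
Proof.
move=> [N [mN N0 PN]].
exists (\bigcup_i g i @^-1` N); split.
- by apply: bigcupT_measurable => i; rewrite -[_ @^-1` _]setTI; exact: pa_meas ga _ _ _ mN.
- apply/eqP; rewrite -measure_le0.
  apply: (le_trans (measure_sigma_subadditive _ _ _ (@subset_refl _ _))).
  + by move=> i; rewrite -[_ @^-1` _]setTI; exact: pa_meas ga _ _ _ mN.
  + by apply: bigcupT_measurable => i; rewrite -[_ @^-1` _]setTI; exact: pa_meas ga _ _ _ mN.
  + by rewrite eseries0// => i _ _; exact: etrans (pa_pres ga i mN) N0.
- move=> x /= /existsNP[y /not_implyP[[i _ <-] nP]]; exists i => //; exact: PN.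
Qed.

(** The exceptional null set is enlarged by its countably many translates. Later arguments run
    pointwise on an invariant conull set obtained in this way. *)
Lemma ae_conull_invariant (P : X -> Prop) : {ae mu, forall x, P x} ->
  exists X1, [/\ measurable X1, mu (~` X1) = 0, X1 `<=` P &
    forall x y, gorbit g x y -> X1 x -> X1 y].
Proof.
move=> /ae_gorbit [N [mN N0 PN]].
have mg i A : measurable A -> measurable (g i @^-1` A).
  by move=> mA; rewrite -[_ @^-1` _]setTI; exact: pa_meas ga _ _ _ mA.
exists (\bigcap_i g i @^-1` (~` N)); split.
- by apply: bigcapT_measurable => i; apply: mg; exact: measurableC.
- rewrite setC_bigcap; apply/eqP; rewrite -measure_le0.
  apply: (le_trans (measure_sigma_subadditive _ _ _ (@subset_refl _ _))).
  + by move=> i; rewrite preimage_setC setCK; exact: mg.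
  + by apply: bigcupT_measurable => i; rewrite preimage_setC setCK; exact: mg.
  + rewrite eseries0// => i _ _; rewrite /= preimage_setC setCK.
    exact: etrans (pa_pres ga i mN) N0.
- move=> x Hx; apply: contrapT => nP; have [i gi] := pa_id ga.
  by apply: (Hx i I); rewrite gi; apply: PN => /(_ x (gorbit_refl x)).
- by move=> x _ [i _ <-] Hx j _ /=; have [k gk] := pa_comp ga j i;
    have := Hx k I; rewrite -gk.
Qed.

End actions.

Section counting_esum.
Local Open Scope ereal_scope.
Context {R : realType} {T : choiceType}.

Lemma counting_ge0 (A : set T) : 0 <= counting A :> \bar R.
Proof. by rewrite /counting; case: ifPn; rewrite ?lee_fin// lee_pinfty. Qed.

Lemma subset_esum (A B : set T) (a : T -> \bar R) : A `<=` B ->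
  (forall x, 0 <= a x) -> \esum_(x in A) a x <= \esum_(x in B) a x.
Proof.
move=> AB a0; rewrite esum_mkcond [leRHS]esum_mkcond.
apply: le_esum => i _; case: ifPn => [/set_mem/AB/mem_set ->//|_].
by case: ifP.
Qed.

Lemma counting_esum (A : set T) : counting A = \esum_(x in A) 1 :> \bar R.
Proof.
have fin (B : set T) : finite_set B -> (\esum_(x in B) 1 = counting B :> \bar R)%E.
  move=> fB; rewrite esum_fset// fsbig_finite//= sumEFin /counting asboolT//.
  by rewrite big_const_seq count_predT iter_addr_0 finmap.cardfE -finmap.cardfE.
have [fA|iA] := pselect (finite_set A); first by rewrite fin.
rewrite /counting asboolF//; apply/esym/eqyP => r r0.
have [B] := infinite_set_fset (Num.truncn r).+1 iA.
set C := (X in X `<=` _) => CA nB.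
have fC : finite_set C by exact: finite_fset.
have cC : counting C = ((size (finmap.enum_fset B))%:R)%:E :> \bar R.
  by rewrite /counting asboolT// /C set_fsetK.
rewrite (le_trans _ (@subset_esum C A (fun=> 1) CA _))// fin// cC.
by rewrite lee_fin (le_trans (ltW (truncnS_gt _)))// ler_nat.
Qed.

Lemma counting_set1 (x : T) : counting [set x] = 1 :> \bar R.
Proof. by rewrite counting_esum esum_set1. Qed.

Lemma counting_set0 : counting (@set0 T) = 0 :> \bar R.
Proof. by rewrite counting_esum esum_set0. Qed.

Lemma le_counting (A B : set T) : A `<=` B -> counting A <= counting B :> \bar R.
Proof. by move=> AB; rewrite !counting_esum; exact: subset_esum. Qed.

Lemma counting_fin (A : set T) : (counting A < +oo :> \bar R) -> finite_set A.
Proof. by rewrite /counting; case: asboolP. Qed.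

End counting_esum.

Section lower_integral.
Local Open Scope ereal_scope.
Context {R : realType} d {X : measurableType d} (mu : probability X R).
Import HBNNSimple.

(* The integral of a nonnegative function is its lower integral, whether or not
   the function is measurable. *)
Lemma le_measure_integral (f : X -> \bar R) (Y : set X) : measurable Y ->
  (forall x, 0 <= f x) -> (forall x, Y x -> 1 <= f x) ->
  mu Y <= \int[mu]_x f x.
Proof.
move=> mY f0 f1; rewrite ge0_integralE// patch_setT.
have <- : \int[mu]_x (\1_Y x)%:E = mu Y by rewrite integral_indic// setIT.
rewrite (_ : \1_Y = indic_nnsfun R mY)// integralT_nnsfun.
apply: ereal_sup_ubound; exists (indic_nnsfun R mY) => // x.
rewrite -[indic_nnsfun R mY x]/(\1_Y x) indicE.
by case: (boolP (x \in Y)) => [/set_mem|_]; [exact: f1|move=> /=; exact: f0].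
Qed.

End lower_integral.

(** * A countable group whose orbits are almost everywhere the classes *)

Section generated_action.
Context {R : realType} d {X : measurableType d}.
Variables (mu : probability X R) (E : set (X * X)).

(** Small balls around a dense sequence separate points. Countable separation makes the diagonal
    measurable, and with it graphs and coincidence sets. *)
Lemma separating_sequence : standard_borel R X ->
  exists2 U : nat -> set X, (forall n, measurable (U n)) &
    forall x y, (forall n, U n x -> U n y) -> x = y.
Proof.
move=> [T [h [hT [D cD dD] [h' hK h'K] mh]]].
have [s ds] := countable_dense_seq cD dD.
pose V n i := h @^-1` (interior (ball (s i) (2 ^- n : R))).
exists (fun k => V (nat_pairing1 k) (nat_pairing2 k)).
  move=> k; move: (nat_pairing1 k) (nat_pairing2 k) => n i.
  apply/mh; rewrite (_ : _ @` _ = interior (ball (s i) (2 ^- n))).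
    by apply: sub_sigma_algebra; exact: open_interior.
  apply/seteqP; split => t /=; first by move=> [x Vx <-].
  by move=> Ht; exists (h' t) => //; rewrite /V /= h'K.
move=> x y xy; apply: (can_inj hK).
apply: hT; rewrite -closeEnbhs ball_close => e.
have [N _ HN] : \forall n \near \oo, 2 ^- n < e%:num / 2 :> R by exact: small_radius.
have r0 : 0 < 2 ^- N.+1 :> R by rewrite invr_gt0 exprn_gt0.
have rN : 2 ^- N = 2 * 2 ^- N.+1 :> R.
  by rewrite exprS invfM mulrA mulfV ?mul1r.
have [||i /interior_subset Hi] := ds (interior (ball (h x) (2 ^- N.+1 : R))).
- exact: open_interior.
- by exists (h x); apply: nbhsx_ballx.
have Vx : V N i x.
  apply/nbhs_ballP; exists (2 ^- N.+1) => //= t ht.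
  by apply: ball_triangle_le (ball_sym Hi) ht _; rewrite rN; lra.
have := xy (nat_pairing N i); rewrite nat_pairing1K nat_pairing2K.
move=> /(_ Vx)/interior_subset Vy.
apply: ball_triangle_le Hi Vy _; have := HN N (leqnn N); rewrite /= rN; lra.
Qed.

Hypothesis hE : discrete_pmp mu E.

Lemma measurable_diagonal : measurable [set p : X * X | p.1 = p.2].
Proof.
have [U mU Usep] := separating_sequence (pmp_standard hE).
rewrite (_ : mkset _ = \bigcap_n ((~` (U n) `*` setT) `|` (setT `*` U n))).
  apply: bigcapT_measurable => n; apply: measurableU; apply: measurableX => //.
  exact: measurableC.
apply/seteqP; split => [[x y] /= <- n _|[x y] /= H].
  by have [Ux|nUx] := pselect (U n x); [right|left].
by apply: Usep => n Ux; case: (H n I) => -[].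
Qed.

Lemma measurable_eq_fun (f g : X -> X) : measurable_fun setT f ->
  measurable_fun setT g -> measurable [set x | f x = g x].
Proof.
move=> mf mg.
have mfg : measurable_fun setT (fun x => (f x, g x)).
  exact: measurable_fun_pair.
by have := mfg measurableT _ measurable_diagonal; rewrite setTI.
Qed.

Lemma measurable_graph (f : X -> X) : measurable_fun setT f ->
  measurable [set p : X * X | f p.1 = p.2].
Proof.
move=> mf.
have mfg : measurable_fun setT (fun p : X * X => (f p.1, p.2)).
  by apply: measurable_fun_pair => //; exact: measurableT_comp.
by have := mfg measurableT _ measurable_diagonal; rewrite setTI.
Qed.

Lemma Inn_id : Inn E id.
Proof.
by split => //; [exists id; split|exact: pmp_refl hE].
Qed.

Lemma Inn_comp f g : Inn E f -> Inn E g -> Inn E (f \o g).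
Proof.
move=> [mf [f' [mf' fK f'K]] Ef] [mg [g' [mg' gK g'K]] Eg]; split.
- exact: measurableT_comp.
- exists (g' \o f'); split; [exact: measurableT_comp|exact: can_comp|exact: can_comp].
- by move=> x; apply: (pmp_trans hE (Eg x)); exact: Ef.
Qed.

Lemma Inn_inv f g : Inn E f -> cancel f g -> cancel g f -> Inn E g.
Proof.
move=> [mf [f' [mf' fK f'K]] Ef] fg gf.
have -> : g = f' by apply/funext => x; rewrite -[in LHS](f'K x) fg.
split => //; first by exists f.
by move=> x; apply: (pmp_sym hE); have := Ef (f' x); rewrite f'K.
Qed.

(** Invariance of [mu] is applied to the part of the graph of [f] with second coordinate in [A]: its
    sections are single points, over the preimage of [A] in one direction and over [A] in the
    other. *)
Lemma Inn_pres f A : Inn E f -> measurable A -> mu (f @^-1` A) = mu A.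
Proof.
move=> [mf [f' [mf' fK f'K]] Ef] mA.
pose G := [set p : X * X | f p.1 = p.2] `&` (setT `*` A).
have mG : measurable G.
  by apply: measurableI; [exact: measurable_graph|exact: measurableX].
have GE : G `<=` E by move=> [x y] [/= <- _]; exact: Ef.
have := pmp_invariant hE mG GE.
rewrite /product_measure1 /product_measure2.
have -> : (counting \o xsection G = (fun x => (\1_(f @^-1` A) x)%:E : \bar R))%E.
  apply/funext => x /=; rewrite indicE.
  case: (boolP (x \in _)) => [/set_mem Ax|/negP nAx].
    rewrite (_ : xsection G x = [set f x]); first exact: counting_set1.
    apply/seteqP; split => [y /xsectionP[/= <-]//|_ ->].
    by apply/xsectionP; split.
  rewrite (_ : xsection G x = set0); first exact: counting_set0.
  apply/seteqP; split => [y /xsectionP[/= <- [_ Ay]]|//].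
  by apply: nAx; rewrite inE.
have -> : (counting \o ysection G = (fun x => (\1_A x)%:E : \bar R))%E.
  apply/funext => y /=; rewrite indicE.
  case: (boolP (y \in _)) => [/set_mem Ay|/negP nAy].
    rewrite (_ : ysection G y = [set f' y]); first exact: counting_set1.
    apply/seteqP; split => [x /ysectionP[/= <- _]|_ ->]; first by rewrite fK.
    by apply/ysectionP; split => //=; rewrite f'K.
  rewrite (_ : ysection G y = set0); first exact: counting_set0.
  apply/seteqP; split => [x /ysectionP[/= _ [_ Ay]]|//].
  by apply: nAy; rewrite inE.
rewrite !integral_indic// ?setIT//.
by rewrite -[_ @^-1` _]setTI; exact: mf.
Qed.

(** The group is enumerated by words in elements of [Psi] and their inverses. Were classes larger
    than orbits on a non-null set, a measurable choice [rho x] of a missed point would put a graph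
    of positive mass into a null set of [mu \x counting]. *)
Lemma generated_action (Psi : set (X -> X)) :
  countable Psi -> Psi `<=` Inn E -> generates mu E Psi ->
  exists g : nat -> X -> X, [/\ pmp_action mu g, Psi `<=` range g,
    (forall i, generated_group Psi (g i)) &
    {ae mu, forall x, forall y, E (x, y) -> gorbit g x y}].
Proof.
move=> /countable_injP[code injcode] PsiE gen.
have gen_id : generated_group Psi id by move=> G [[]].
have gen_comp f h : generated_group Psi f -> generated_group Psi h ->
    generated_group Psi (f \o h).
  by move=> gf gh G GP; have [[_ GM _] _] := GP; apply: GM; [exact: gf|exact: gh].
have gen_inv f h : generated_group Psi f -> cancel f h -> cancel h f ->
    generated_group Psi h.
  by move=> gf fh hf G GP; have [[_ _ GV] _] := GP; apply: GV fh hf; exact: gf.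
(* Numbers that code no element of [Psi] stand for the identity. *)
have /choice[e He] : forall n, exists f, (Inn E f /\ generated_group Psi f) /\
    forall psi, Psi psi -> code psi = n -> f = psi.
  move=> n; have [[psi Pp pn]|N] := pselect (exists2 psi, Psi psi & code psi = n).
    exists psi; split.
      by split; [exact: PsiE|exact: sub_gen_smallest].
    by move=> psi' Pp' pn'; apply: injcode; rewrite ?inE// pn.
  by exists id; split; [split => //; exact: Inn_id|move=> psi Pp pn; case: N; exists psi].
have /choice[e' He'] : forall n, exists f, cancel (e n) f /\ cancel f (e n).
  by move=> n; case: (He n) => -[[_ [f [_ ? ?]] _] _] _; exists f.
pose letter (p : bool * nat) := if p.1 then e p.2 else e' p.2.
pose word s : X -> X := foldr (fun p f => letter p \o f) id s.
pose wordV s : X -> X := word (rev [seq (~~ p.1, p.2) | p <- s]).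
have word_cat s t : word (s ++ t) = word s \o word t.
  by elim: s => //= p s ->.
have letterK p : cancel (letter p) (letter (~~ p.1, p.2)).
  by case: p => [[] n] x; rewrite /letter /=; case: (He' n) => H1 H2; rewrite ?H1 ?H2.
have wordK s : cancel (word s) (wordV s) /\ cancel (wordV s) (word s).
  rewrite /wordV; elim: s => //= p s [IH1 IH2]; rewrite rev_cons -cats1; split => x.
    by rewrite word_cat /= letterK IH1.
  rewrite word_cat /= IH2; have := letterK (~~ p.1, p.2); rewrite /= negbK.
  by case: p => ? ?; exact.
have letterE p : Inn E (letter p) /\ generated_group Psi (letter p).
  case: p => [[] n]; rewrite /letter /=; first by case: (He n).
  case: (He n) => -[/Inn_inv H /gen_inv H'] _; case: (He' n) => ? ?.
  by split; [exact: H|exact: H'].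
have wordE s : Inn E (word s).
  elim: s => [|p s IH]; first exact: Inn_id.
  by apply: Inn_comp => //; case: (letterE p).
have wordG s : generated_group Psi (word s).
  elim: s => [|p s IH]; first exact: gen_id.
  by apply: gen_comp => //; case: (letterE p).
pose dec n : seq (bool * nat) := odflt [::] (unpickle n).
pose enc (s : seq (bool * nat)) : nat := pickle s.
have decK s : dec (enc s) = s by rewrite /dec /enc pickleK.
pose g n := word (dec n).
have gword s : g (enc s) = word s by rewrite /g decK.
have ga : pmp_action mu g.
  split.
  - by move=> i; case: (wordE (dec i)).
  - move=> i; exists (enc (rev [seq (~~ p.1, p.2) | p <- dec i])); rewrite gword.
    exact: (wordK (dec i)).
  - by move=> i j; exists (enc (dec i ++ dec j));
      rewrite gword word_cat.
  - by exists (enc ([::] : seq (bool * nat))); rewrite gword.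
  - by move=> i A mA; apply: Inn_pres => //; exact: wordE.
  - by move=> i j; apply: measurable_eq_fun;
      [case: (wordE (dec i))|case: (wordE (dec j))].
have Psig : Psi `<=` range g.
  move=> psi Pp; exists (enc [:: (true, code psi)]) => //.
  rewrite gword; apply/funext => x /=; rewrite /letter/=.
  by case: (He (code psi)) => _ /(_ psi Pp erefl) ->.
exists g; split => //; first by move=> i; exact: wordG.
have gengrp : generated_group Psi `<=` range g.
  apply: smallest_sub => //; split.
  - by have [i gi] := pa_id ga; exists i.
  - by move=> _ _ [i _ <-] [j _ <-]; have [k gk] := pa_comp ga i j; exists k.
  - move=> _ f' [i _ <-] gf fg; have [j [ij ji]] := pa_inv ga i.
    by exists j => //; apply/funext => x; rewrite -[in LHS](fg x) ij.
move: gen => [N [mN N0 bN]].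
pose B := E `&` ~` \bigcup_i [set p : X * X | g i p.1 = p.2].
have mB : measurable B.
  apply: measurableI; first exact: pmp_measurable hE.
  apply: measurableC; apply: bigcupT_measurable => i; apply: measurable_graph.
  exact: pa_meas ga i.
have BN : B `<=` N.
  move=> p [Ep np]; apply: bN => /= /(_ Ep)[psi /gengrp[i _ <-] gp].
  by apply: np; exists i.
have [rho [mrho rhoP]] := ae_measurable_section mu (pmp_standard hE) mB.
pose Y := [set x | B (x, rho x)].
have mY : measurable Y.
  have mp : measurable_fun setT (fun x => (x, rho x)) by exact: measurable_fun_pair.
  by have := mp measurableT _ mB; rewrite setTI.
have Y0 : mu Y = 0%E.
  apply/eqP; rewrite -measure_le0 -N0; apply: le_measure_integral => //.
  move=> x Yx /=; rewrite -(counting_set1 (rho x)); apply: le_counting => _ ->.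
  by apply/xsectionP; exact: BN.
have : {ae mu, forall x, ~ Y x} by exists Y; split => // x /= /contrapT.
apply: filterS2 rhoP => x Hx nY y Exy; apply: contrapT => nO.
apply/nY/Hx; exists y; split => // -[i _ /= gi]; apply: nO; exists i => //.
Qed.

Lemma Inn_ae f (P : X -> Prop) : Inn E f -> {ae mu, forall x, P x} ->
  {ae mu, forall x, P (f x)}.
Proof.
move=> If [N [mN N0 PN]]; exists (f @^-1` N); split.
- by rewrite -[_ @^-1` _]setTI; case: If => + _ _; exact.
- by rewrite -N0; exact: Inn_pres.
- by move=> x /= nP; exact: PN.
Qed.

Lemma generated_Inn (Psi : set (X -> X)) : Psi `<=` Inn E ->
  generated_group Psi `<=` Inn E.
Proof.
move=> PsiE; apply: smallest_sub => //; split; first exact: Inn_id.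
- exact: Inn_comp.
- exact: Inn_inv.
Qed.

Lemma generated_invariant (Psi : set (X -> X)) (T : Type) (h : X -> T) : Psi `<=` Inn E ->
  (forall psi, Psi psi -> {ae mu, forall x, h (psi x) = h x}) ->
  forall f, generated_group Psi f -> {ae mu, forall x, h (f x) = h x}.
Proof.
move=> PsiE Psih f genf.
(* [Inn E] is carried through the induction because composition and inversion move null sets, which
   must stay null. *)
suff [] : Inn E f /\ {ae mu, forall x, h (f x) = h x} by [].
move: f genf.
apply: (@smallest_sub _ _ _ [set f | Inn E f /\ {ae mu, forall x, h (f x) = h x}]).
  split => /=.
  - by split; [exact: Inn_id|exact: aeW].
  - move=> f f' [If hf] [If' hf']; split; first exact: Inn_comp.
    by apply: filterS2 (Inn_ae If' hf) hf' => x /= -> ->.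
  - move=> f f' [If hf] ff' f'f; split; first exact: Inn_inv ff' f'f.
    by apply: filterS (Inn_ae (Inn_inv If ff' f'f) hf) => x; rewrite f'f => ->.
by move=> psi Pp; split; [exact: PsiE|exact: Psih].
Qed.

End generated_action.

Section esum_lemmas.
Local Open Scope ereal_scope.
Context {R : realType} {T : choiceType}.

Lemma le_esumZ (A : set T) (a : R) (K : T -> \bar R) : (0 <= a)%R ->
  (forall x, 0 <= K x) ->
  \esum_(x in A) (a%:E * K x) <= a%:E * \esum_(x in A) K x.
Proof.
move=> a0 K0; apply: ge_ereal_sup => _ [F [fF FA] <-].
rewrite -ge0_mule_fsumr//; apply: lee_pmul => //.
- exact: fsume_ge0.
- by apply: ereal_sup_ubound; exists F.
Qed.

Lemma esumZ (A : set T) (a : \bar R) (K : T -> \bar R) : a \is a fin_num ->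
  0 <= a -> (forall x, 0 <= K x) ->
  \esum_(x in A) (a * K x) = a * \esum_(x in A) K x.
Proof.
move=> /fineK <-; rewrite lee_fin => a0 K0.
apply/eqP; rewrite eq_le le_esumZ//=.
have [->|ap] := eqVneq (fine a) 0%R.
  by rewrite mul0e esum_ge0// => x _; rewrite mul0e.
have a_gt0 : (0 < fine a)%R by rewrite lt_def ap.
rewrite muleC -lee_pdivlMr// muleC.
have := @le_esumZ A (fine a)^-1 (fun x => (fine a)%:E * K x).
have KE x : (fine a)^-1%:E * ((fine a)%:E * K x) = K x.
  by rewrite muleA -EFinM mulVf// mul1e.
under eq_esum do rewrite KE.
by apply; [rewrite invr_ge0|move=> x; rewrite mule_ge0].
Qed.

Lemma esum_cst (A : set T) (a : \bar R) : a \is a fin_num -> 0 <= a ->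
  \esum_(x in A) a = a * counting A.
Proof.
move=> fa a0; rewrite counting_esum -esumZ//.
by apply: eq_esum => x _; rewrite mule1.
Qed.

End esum_lemmas.

(** * Measurable relations inside the orbits *)

Section orbit_relations.
Local Open Scope ereal_scope.
Context {R : realType} d {X : measurableType d}.
Variables (mu : probability X R) (g : nat -> X -> X).

(** Measurability is tested along the graphs of the [g i], which together cover the orbit relation.
    In this form composites are countable unions. *)
Definition orbit_rel (A : X -> set X) : Prop :=
  (forall x, A x `<=` gorbit g x) /\ forall i, measurable [set x | A x (g i x)].

Hypothesis ga : pmp_action mu g.

Lemma measurable_pull i A : measurable A -> measurable [set x | A (g i x)].
Proof. by move=> mA; rewrite -[mkset _]setTI; exact: pa_meas ga _ _ _ mA. Qed.

Lemma orbit_relI A (Q : X -> X -> Prop) : orbit_rel A ->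
  (forall i, measurable [set x | Q x (g i x)]) ->
  orbit_rel (fun x => [set y | A x y /\ Q x y]).
Proof.
move=> [oA mA] mQ; split; first by move=> x y [/oA Ay _].
by move=> i; exact: (measurableI _ _ (mA i) (mQ i)).
Qed.

Lemma orbit_rel_inv A : orbit_rel A -> orbit_rel (fun x => [set y | A y x]).
Proof.
move=> [oA mA]; split; first by move=> x y /= /oA /(gorbit_sym ga).
move=> i; have [j [ij ji]] := pa_inv ga i.
rewrite (_ : mkset _ = g i @^-1` [set x | A x (g j x)]); first exact: measurable_pull.
by apply/seteqP; split => x /=; rewrite ij.
Qed.

Lemma orbit_rel_comp A B : orbit_rel A -> orbit_rel B ->
  orbit_rel (fun x => [set y | exists u, A x u /\ B u y]).
Proof.
move=> [oA mA] [oB mB]; split.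
  by move=> x y /= [u [/oA xu /oB]]; exact: (gorbit_trans ga xu).
move=> i.
rewrite (_ : mkset _ = \bigcup_j ([set x | A x (g j x)] `&`
    [set x | B (g j x) (g i x)])).
  apply: bigcupT_measurable => j; apply: measurableI => //.
  have [j' [jj' j'j]] := pa_inv ga j.
  have [k gk] := pa_comp ga i j'.
  rewrite (_ : mkset _ = g j @^-1` [set x | B x (g k x)]); first exact: measurable_pull.
  by apply/seteqP; split => x /=; rewrite -gk /= jj'.
apply/seteqP; split => x /=.
  by move=> [u [Axu Buy]]; have [j _ gj] := oA _ _ Axu; exists j; rewrite //= gj.
by move=> [j _ [/= ? ?]]; exists (g j x).
Qed.

Lemma orbit_rel_esumE A (K : X -> \bar R) x : orbit_rel A ->
  \esum_(y in A x) K y = \esum_(y in gorbit g x) (if y \in A x then K y else 0).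
Proof.
by move=> [oA _]; rewrite -esum_mkcondr setIidr.
Qed.

Let mif A (K : X -> X -> \bar R) i : orbit_rel A ->
  measurable_fun setT (fun x => K x (g i x)) ->
  measurable_fun setT (fun x => if g i x \in A x then K x (g i x) else 0).
Proof.
move=> [_ mA] mK.
rewrite (_ : (fun x => _) = (fun x => (\1_[set x | A x (g i x)] x)%:E * K x (g i x))).
  apply: emeasurable_funM => //; apply/measurable_EFinP.
  exact: measurable_indic.
apply/funext => x; rewrite indicE.
rewrite (_ : (x \in [set x | A x (g i x)]) = (g i x \in A x)); last first.
  by apply/idP/idP; rewrite !inE.
by case: ifP; rewrite ?mul1e ?mul0e.
Qed.

Lemma measurable_esum_rel A (K : X -> X -> \bar R) : orbit_rel A ->
  (forall x y, 0 <= K x y) ->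
  (forall i, measurable_fun setT (fun x => K x (g i x))) ->
  measurable_fun setT (fun x => \esum_(y in A x) K x y).
Proof.
move=> rA K0 mK; under eq_fun do rewrite orbit_rel_esumE//.
apply: (measurable_gorbit_esum ga) => [x y|i]; first by case: ifP.
exact: mif.
Qed.

Lemma measurable_counting_rel A : orbit_rel A ->
  measurable_fun setT (fun x => counting (A x) : \bar R).
Proof.
move=> rA; under eq_fun do rewrite counting_esum.
exact: measurable_esum_rel.
Qed.

Lemma mass_transport_rel A (K : X -> X -> \bar R) : orbit_rel A ->
  (forall x y, 0 <= K x y) ->
  (forall i, measurable_fun setT (fun x => K x (g i x))) ->
  \int[mu]_x (\esum_(y in A x) K x y) =
  \int[mu]_x (\esum_(y in [set y | A y x]) K y x).
Proof.
move=> rA K0 mK; under eq_integral do rewrite orbit_rel_esumE//.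
rewrite (mass_transport ga) => [|x y|i]; [|by case: ifP|exact: mif].
apply: eq_integral => x _.
rewrite -(setIidr ((orbit_rel_inv rA).1 x)) esum_mkcondr.
apply: eq_esum => y _.
rewrite (_ : (y \in [set y | A y x]) = (x \in A y))//.
Qed.

End orbit_relations.

(** * The maximal inequality *)

Section covering.
Local Open Scope ereal_scope.
Context {R : realType} d {X : measurableType d}.
Variables (mu : probability X R) (g : nat -> X -> X).
Hypothesis ga : pmp_action mu g.
Variables (Y : set X) (S : X -> set X) (q : X -> nat) (N : nat) (c : X -> R).
Hypothesis mY : measurable Y.
Hypothesis rS : orbit_rel g S.
Hypothesis mq : forall j, measurable [set x | q x = j].
Hypothesis mc : measurable_fun setT c.
Hypothesis c0 : forall x, (0 <= c x)%R.
Hypothesis qN : forall x, Y x -> (q x < N)%N.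

Let meets z : set X := [set z' | exists u, S z u /\ S z' u].

(** The capacity left at [z]. It is reduced by all weights of sets meeting [S z], a total which
    dominates the weight lying over any single point of [S z]. *)
Let load (w : X -> \bar R) z : \bar R := maxe 0 (1 - \esum_(z' in meets z) w z').

(* A fractional Vitali cover: a point of rank [n] gets its weight [c] scaled by
   what the weights of the points of lower rank meeting it leave available. *)
Fixpoint weight (n : nat) : X -> \bar R :=
  if n is m.+1 then fun z => weight m z +
    (\1_(Y `&` [set z | q z = m]) z)%:E * ((c z)%:E * load (weight m) z)
  else cst 0.

Let load01 w z : (forall x, 0 <= w x) -> 0 <= load w z <= 1.
Proof.
move=> w0; rewrite le_max lexx/= ge_max lee01/=.
by rewrite -[leRHS]sube0 leeB// esum_ge0.
Qed.

Let wt_ge0 n z : 0 <= weight n z.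
Proof.
elim: n z => //= n IH z; rewrite adde_ge0// mule_ge0 ?lee_fin// mule_ge0 ?lee_fin//.
by have /andP[] := load01 z IH.
Qed.

Let wt_out n z : ~ Y z -> weight n z = 0.
Proof.
move=> nY; elim: n => //= n ->; rewrite indicE memNset ?mul0e ?adde0//.
by move=> [].
Qed.

Let wt_high n z : (n <= q z)%N -> weight n z = 0.
Proof.
elim: n => //= n IH nq; rewrite IH ?(ltnW nq)// add0e indicE memNset ?mul0e//.
by move=> [_ /= qn]; rewrite qn ltnn in nq.
Qed.

Let wt_stable n z : (q z < n)%N -> weight n z = weight (q z).+1 z.
Proof.
elim: n => // n IH; rewrite ltnS leq_eqVlt => /predU1P[<-//|qn].
rewrite [LHS]/= IH// indicE memNset ?mul0e ?adde0//.
by move=> [_ /= e]; rewrite e ltnn in qn.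
Qed.

Let wt_at z : Y z -> weight (q z).+1 z = (c z)%:E * load (weight (q z)) z.
Proof.
move=> Yz; rewrite /= wt_high// add0e indicE mem_set ?mul1e//.
Qed.

Let wt_le n z : weight n z <= (c z)%:E.
Proof.
have [Yz|nY] := pselect (Y z); last by rewrite wt_out// lee_fin.
have [nq|qn] := leqP n (q z); first by rewrite wt_high// lee_fin.
rewrite wt_stable// wt_at// -[leRHS]mule1 lee_pmul ?lee_fin//.
  by have /andP[] := load01 z (wt_ge0 (q z)).
by have /andP[] := load01 z (wt_ge0 (q z)).
Qed.

Let wt_fin n z : weight n z \is a fin_num.
Proof.
by rewrite ge0_fin_numE ?(le_lt_trans (wt_le _ _))// ltry.
Qed.

Let rmeets : orbit_rel g meets.
Proof. exact: (orbit_rel_comp ga rS (orbit_rel_inv ga rS)). Qed.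

Let wt_meas n : measurable_fun setT (weight n).
Proof.
elim: n => [|n IH] /=; first exact: measurable_cst.
apply: emeasurable_funD => //; apply: emeasurable_funM.
  by apply/measurable_EFinP; apply: measurable_indic; exact: measurableI.
apply: emeasurable_funM; first exact/measurable_EFinP.
apply: measurable_maxe => //; apply: emeasurable_funB => //.
apply: (measurable_esum_rel ga) => // i.
exact: (measurableT_comp IH (pa_meas ga i)).
Qed.

(** Replaces disjointness: the unscaled weights of one rank cover no point more than once. *)
Hypothesis H2 : forall y j,
  \esum_(z in [set z | [/\ S z y, Y z & q z = j]]) (c z)%:E <= 1.

(** If rank [n] adds anything over [y], some [z0] over [y] still has capacity. The earlier weights
    over [y] all belong to sets meeting [S z0], so they sum to at most 1, and the new rank adds at
    most 1 by [H2]. *)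
Let wt_mult n y : \esum_(z in [set z | S z y]) weight n z <= 2%:E.
Proof.
elim: n => [|n IH]; first by rewrite esum1// lee_fin.
rewrite [leLHS]/= esumD//; last first.
  move=> z _; rewrite mule_ge0 ?lee_fin// mule_ge0 ?lee_fin//.
  by have /andP[] := load01 z (wt_ge0 n).
set new := (X in _ + X).
have newE : new = \esum_(z in [set z | [/\ S z y, Y z & q z = n]])
    ((c z)%:E * load (weight n) z).
  rewrite /new esum_mkcond [RHS]esum_mkcond; apply: eq_esum => z _.
  rewrite indicE.
  case: ifPn => [|]; rewrite ?inE/= ?notin_setE/= => Szy.
    case: ifPn => [|]; rewrite ?inE/= ?notin_setE/= => H.
      by rewrite mem_set ?mul1e//; case: H.
    by rewrite memNset ?mul0e// => -[Yz qz]; apply: H.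
  by case: ifPn => //; rewrite inE => -[].
have [[z0 [Sz0 Yz0 qz0 l0]]|none] := pselect (exists z0,
    [/\ S z0 y, Y z0, q z0 = n & 0 < load (weight n) z0]).
  rewrite (_ : 2%:E = 1 + 1)//; apply: leeD.
    apply: (@le_trans _ _ (\esum_(z' in meets z0) weight n z')).
      by apply: subset_esum => // z Szy; exists y.
    move: l0; rewrite /load lt_max ltxx/= sube_gt0 => /ltW; exact.
  rewrite newE; apply: le_trans (H2 y n); apply: le_esum => z _.
  rewrite -[leRHS]mule1 lee_pmul ?lee_fin//;
    by have /andP[] := load01 z (wt_ge0 n).
suff -> : new = 0 by rewrite adde0.
rewrite newE esum1// => z [Szy Yz qz].
apply/eqP; rewrite mule_eq0; apply/orP; right.
have /andP[l0 _] := load01 z (wt_ge0 n).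
by rewrite eq_le l0 andbT leNgt; apply/negP => l1; apply: none; exists z.
Qed.

Variables (C1 C2 lam : R) (f : X -> \bar R).
Hypothesis C1_ge0 : (0 <= C1)%R.
Hypothesis C2_ge0 : (0 <= C2)%R.
Hypothesis lam_ge0 : (0 <= lam)%R.
Hypothesis mf : measurable_fun setT f.
Hypothesis f0 : forall x, 0 <= f x.
Hypothesis f_fin : forall x, f x \is a fin_num.
Hypothesis H1 : forall z, Y z -> 1 <= C1%:E * ((c z)%:E * counting (S z)).
Hypothesis H3 : forall z, Y z ->
  counting [set y | [/\ Y y, (q z < q y)%N & meets z y]] <= C2%:E * counting (S z).
Hypothesis H5 : forall z, Y z -> lam%:E * counting (S z) <= \esum_(y in S z) f y.

Let w := weight N.
Let below z : set X := [set z' | [/\ Y z, Y z', (q z' < q z)%N & meets z z']].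

Let load_esum z : Y z -> \esum_(z' in meets z) weight (q z) z' =
  \esum_(z' in below z) w z'.
Proof.
move=> Yz; rewrite esum_mkcond [RHS]esum_mkcond; apply: eq_esum => z' _.
case: ifPn => [|]; rewrite ?inE/= ?notin_setE/= => zz'; last first.
  by case: ifPn => //; rewrite inE => -[].
case: ifPn => [|]; rewrite ?inE/= ?notin_setE/= => H.
  by case: H => _ Yz' qq _; rewrite /w !wt_stable// ?qN.
have [Yz'|nY] := pselect (Y z'); last by rewrite wt_out.
by apply: wt_high; rewrite leqNgt; apply/negP => qq; apply: H.
Qed.

(** Either the earlier weights meeting [z] already sum to 1, or [z] received the fraction [c z] of
    what is missing, and [H1] turns this back into the whole of it. *)
Let cover_pointwise z : Y z ->
  1 <= C1%:E * (w z * counting (S z)) + \esum_(z' in below z) w z'.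
Proof.
move=> Yz; rewrite -load_esum//; set s := \esum_(_ in _) _.
have s0 : 0 <= s by exact: esum_ge0.
have [s1|s1] := leP 1 s.
  rewrite (le_trans s1)// leeDr// mule_ge0 ?lee_fin// mule_ge0//.
  exact: wt_ge0.
have fs : s \is a fin_num by rewrite ge0_fin_numE// (lt_trans s1)// ltry.
have s1' : 0 <= 1 - s by rewrite sube_ge0 ?fs ?orbT// ltW.
rewrite /w wt_stable ?qN// wt_at// /load -/s max_r//.
rewrite -leeBlDr//.
rewrite (_ : C1%:E * _ = (1 - s) * (C1%:E * ((c z)%:E * counting (S z)))).
  by rewrite -[leLHS]mule1 lee_pmul// H1.
by rewrite -!muleA; rewrite [RHS]muleCA; congr (_ * _); rewrite muleCA.
Qed.

Let rbelow : orbit_rel g below.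
Proof.
rewrite (_ : below = fun z => [set z' | meets z z' /\
    (Y z /\ (Y z' /\ exists j, q z = j /\ (q z' < j)%N))]); last first.
  apply/funext => z; apply/seteqP; split => z' /=.
    by move=> [Yz Yz' qq zz']; split => //; split => //; split => //; exists (q z).
  by move=> [zz' [Yz [Yz' [j [qj qq]]]]]; split => //; rewrite qj.
apply: (orbit_relI rmeets (Q := fun z z' =>
  Y z /\ (Y z' /\ exists j, q z = j /\ (q z' < j)%N))) => i.
have mlt : measurable [set x | exists j, q x = j /\ (q (g i x) < j)%N].
  rewrite (_ : mkset _ = \bigcup_j ([set x | q x = j] `&`
      \bigcup_(k in [set k | (k < j)%N]) [set x | q (g i x) = k])).
    apply: bigcupT_measurable => j; apply: measurableI => //.
    by apply: bigcup_measurable => k _; exact: (measurable_pull ga i (mq k)).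
  apply/seteqP; split => x /=.
    by move=> [j [qj qq]]; exists j => //; split => //; exists (q (g i x)).
  by move=> [j _ [/= qj [k /= kj qk]]]; exists j; rewrite qk.
exact: (measurableI _ _ mY (measurableI _ _ (measurable_pull ga i mY) mlt)).
Qed.

Let mass := \int[mu]_z (w z * counting (S z)).

Let mass_meas : measurable_fun setT (fun z => w z * counting (S z)).
Proof.
by apply: emeasurable_funM; [exact: wt_meas|exact: (measurable_counting_rel ga)].
Qed.

Let mass_ge0 z : 0 <= w z * counting (S z).
Proof. by rewrite mule_ge0 ?counting_ge0//; exact: wt_ge0. Qed.

(** After integrating [cover_pointwise], mass transport replaces the weights that [z] meets from
    lower ranks by its own weight counted at the points of higher rank it meets; [H3] bounds their
    number. *)
Let mu_le_mass : mu Y <= (C1 + C2)%:E * mass.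
Proof.
have mbel : measurable_fun setT (fun z => \esum_(z' in below z) w z').
  apply: (measurable_esum_rel ga) => // [x y|i]; first exact: wt_ge0.
  exact: (measurableT_comp (wt_meas N) (pa_meas ga i)).
have bel0 z : 0 <= \esum_(z' in below z) w z'.
  by apply: esum_ge0 => ? _; exact: wt_ge0.
have mC1 : measurable_fun setT (fun z => C1%:E * (w z * counting (S z))).
  exact: measurable_funeM.
have C10 z : 0 <= C1%:E * (w z * counting (S z)) by rewrite mule_ge0.
apply: (@le_trans _ _ (\int[mu]_z (C1%:E * (w z * counting (S z)) +
    \esum_(z' in below z) w z'))).
  by apply: le_measure_integral => // z; rewrite adde_ge0.
rewrite ge0_integralD// ge0_integralZl_EFin//.
rewrite EFinD ge0_muleDl ?lee_fin//; apply: leeD => //.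
rewrite (mass_transport_rel ga rbelow (K := fun _ z' => w z')); first last.
- by move=> i; exact: (measurableT_comp (wt_meas N) (pa_meas ga i)).
- by move=> ? ?; exact: wt_ge0.
rewrite -ge0_integralZl_EFin//; apply: ge0_le_integral => //.
- by move=> z _; apply: esum_ge0 => ? _; exact: wt_ge0.
- apply: (measurable_esum_rel ga) => [|x y|i].
  + exact: (orbit_rel_inv ga rbelow).
  + exact: wt_ge0.
  + exact: wt_meas.
- exact: measurable_funeM.
move=> z _; rewrite esum_cst; [|exact: wt_fin|exact: wt_ge0].
have [Yz|nY] := pselect (Y z); last by rewrite {1}/w wt_out// mul0e mule_ge0.
rewrite muleCA; apply: lee_pmul => //; first exact: wt_ge0.
apply: le_trans (H3 Yz); apply: le_counting => y [Yy _ qq [u [? ?]]].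
by split => //; exists u.
Qed.

(** [H5] compares the mass at [z] with a weighted sum of [f] over [S z]. After mass transport each
    [f y] is multiplied by the total weight over [y], at most 2 by [wt_mult]. *)
Let mass_le_int : lam%:E * mass <= 2%:E * \int[mu]_x f x.
Proof.
rewrite -ge0_integralZl_EFin//.
apply: (@le_trans _ _ (\int[mu]_z (\esum_(y in S z) (w z * f y)))).
  apply: ge0_le_integral => //.
  - by move=> z _; rewrite mule_ge0.
  - exact: measurable_funeM.
  - apply: (measurable_esum_rel ga) => // [x y|i].
      by rewrite mule_ge0//; exact: wt_ge0.
    apply: emeasurable_funM; first exact: wt_meas.
    exact: (measurableT_comp mf (pa_meas ga i)).
  move=> z _; rewrite esumZ//; [|exact: wt_fin|exact: wt_ge0].
  have [Yz|nY] := pselect (Y z); last by rewrite /w wt_out// !mul0e mule0.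
  rewrite muleCA; apply: lee_pmul => //; first exact: wt_ge0.
    by rewrite mule_ge0 ?lee_fin ?counting_ge0.
  exact: H5.
rewrite (mass_transport_rel ga rS (K := fun z y => w z * f y)); first last.
- move=> i; apply: emeasurable_funM; first exact: wt_meas.
  exact: (measurableT_comp mf (pa_meas ga i)).
- by move=> x y; rewrite mule_ge0//; exact: wt_ge0.
rewrite -ge0_integralZl_EFin//; apply: ge0_le_integral => //.
- by move=> y _; apply: esum_ge0 => z _; rewrite mule_ge0//; exact: wt_ge0.
- apply: (measurable_esum_rel ga) => [|x y|i].
  + exact: (orbit_rel_inv ga rS).
  + by rewrite mule_ge0//; exact: wt_ge0.
  + apply: emeasurable_funM => //.
    exact: (measurableT_comp (wt_meas N) (pa_meas ga i)).
- exact: measurable_funeM.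
move=> y _; under eq_esum do rewrite muleC.
rewrite esumZ//; last by move=> ?; exact: wt_ge0.
rewrite muleC; apply: lee_pmul => //; last exact: wt_mult.
by apply: esum_ge0 => ? _; exact: wt_ge0.
Qed.

Lemma covering_maximal : lam%:E * mu Y <= (2 * (C1 + C2))%:E * \int[mu]_x f x.
Proof.
apply: (@le_trans _ _ (lam%:E * ((C1 + C2)%:E * mass))).
  by apply: lee_pmul => //; rewrite lee_fin.
rewrite muleCA mulrC EFinM -muleA; apply: lee_pmul => //.
- by rewrite lee_fin addr_ge0.
- by rewrite mule_ge0// ?lee_fin// integral_ge0.
Qed.

End covering.

Section measure_lemmas.
Context {R : realType} d {X : measurableType d}.

Lemma measurable_setltr (f g : X -> R) : measurable_fun setT f ->
  measurable_fun setT g -> measurable [set x | f x < g x].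
Proof.
move=> /measurable_EFinP mf /measurable_EFinP mg.
by have := measurable_lte measurableT mf mg; rewrite setTI.
Qed.

Lemma measurable_setler (f g : X -> R) : measurable_fun setT f ->
  measurable_fun setT g -> measurable [set x | f x <= g x].
Proof.
move=> /measurable_EFinP mf /measurable_EFinP mg.
by have := measurable_lee measurableT mf mg; rewrite setTI.
Qed.

Lemma measurable_truncn (f : X -> R) j : measurable_fun setT f ->
  measurable [set x | Num.truncn (f x) = j].
Proof.
move=> mf.
have mle n : measurable [set x | (Num.truncn (f x) <= n)%N].
  rewrite (_ : mkset _ = [set x | f x < n.+1%:R]).
    exact: measurable_setltr.
  by apply/seteqP; split => x /=; rewrite truncn_le_nat.
rewrite (_ : mkset _ = [set x | (Num.truncn (f x) <= j)%N] `\`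
   (if j is i.+1 then [set x | (Num.truncn (f x) <= i)%N] else set0)).
  by apply: measurableD => //; case: j.
apply/seteqP; split => x /=.
  move=> xj; split; first by rewrite xj.
  by case: j xj => [_ []|i xj]; rewrite /= xj ltnn.
case: j => [|i] [/= le_j H]; first by apply/eqP; rewrite -leqn0.
by apply/eqP; rewrite eqn_leq le_j/= ltnNge; apply/negP.
Qed.

Lemma measurable_fun_nat (nu : X -> nat) (phi : nat -> R) :
  (forall j, measurable [set x | nu x = j]) -> measurable_fun setT (phi \o nu).
Proof.
move=> mnu _ B mB; rewrite setTI.
rewrite (_ : _ @^-1` _ = \bigcup_(j in phi @^-1` B) [set x | nu x = j]).
  exact: bigcup_measurable.
by apply/seteqP; split => x /=; [move=> Bx; exists (nu x)|move=> [j Bj /= ->]].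
Qed.

Lemma mu_bigcup_le (mu : probability X R) (A : nat -> set X) (lam : R) b :
  (forall n, measurable (A n)) -> (forall n, A n `<=` A n.+1) ->
  (forall n, lam%:E * mu (A n) <= b)%E -> (lam%:E * mu (\bigcup_n A n) <= b)%E.
Proof.
move=> mA ndA bA.
have cA : (mu \o A) x @[x --> \oo] --> mu (\bigcup_n A n).
  apply: nondecreasing_cvg_mu => //; first exact: bigcupT_measurable.
  by apply/nondecreasing_seqP => n; exact/subsetPset.
have cl := cvgeZl (isT : lam%:E \is a fin_num) cA.
rewrite -(cvg_lim _ cl)//; apply: lime_le; first by apply/cvg_ex; eexists; exact: cl.
exact: nearW.
Qed.

Lemma finite_nat_bound (T : choiceType) (A : set T) (P : T -> nat -> Prop) :
  finite_set A -> (forall y n m, (n <= m)%N -> P y n -> P y m) ->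
  (forall y, A y -> exists n, P y n) -> exists n, forall y, A y -> P y n.
Proof.
move=> fA mono Pex.
have /choice[e He] : forall y, exists n, A y -> P y n.
  by move=> y; have [Ay|nA] := pselect (A y); [have [n] := Pex y Ay; exists n|exists 0%N].
have /finite_seqP[s sA] := fA.
exists (\max_(y <- s) e y)%N => y Ay.
apply: mono (He y Ay); apply: leq_bigmax_seq => //.
by move: Ay; rewrite sA.
Qed.

End measure_lemmas.

Lemma measurable_index_set (R : realType) k : measurable (index_set R k).
Proof.
case: k => /=; last first.
  rewrite (_ : mkset _ = `]0, +oo[%classic); first exact: measurable_itv.
  by rewrite set_itvoy.
rewrite (_ : range _ = \bigcup_n [set (n%:R : R)]).
  by apply: bigcupT_measurable => n; exact: measurable_set1.
by apply/seteqP; split => [_ [n _ <-]|_ [n _ ->]]; exists n.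
Qed.

Lemma index_set_ge0 (R : realType) k r : index_set R k r -> 0 <= r.
Proof. by case: k => /= [[n _ <-]|/ltW]. Qed.

(** * Maximal inequalities for families of subset functions *)

Section family.
Context {R : realType} d {X : measurableType d}.
Variables (mu : probability X R) (E : set (X * X)) (k : index_kind).
Variables (F : R -> X -> set X) (g : nat -> X -> X) (X1 : set X).
Hypothesis ga : pmp_action mu g.
Hypothesis hF : borel_family E k F.
Hypothesis mX1 : measurable X1.
Hypothesis X1_inv : forall x y, gorbit g x y -> X1 x -> X1 y.
Hypothesis X1_orbit : forall x, X1 x -> forall y, E (x, y) -> gorbit g x y.
Hypothesis X1_ge1 : forall x, X1 x -> forall r, index_set R k r ->
  (1 <= (counting (F r x) : \bar R))%E.

Let F_orbit x r : X1 x -> index_set R k r -> F r x `<=` gorbit g x.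
Proof.
move=> Xx ir y Fy; apply: X1_orbit => //; case: hF => /(_ r ir x y Fy) + _ _; exact.
Qed.

Lemma family_finite x r : index_set R k r -> finite_set (F r x).
Proof.
move=> ir; case: hF => _ _ /(_ x r ir); apply: sub_finite_set => y Fy.
by exists r.
Qed.

Let mF := let: And3 _ mF _ := hF in mF.

(** A sum over [F r x] as a function of the pair [(x, r)]. The series form is jointly measurable, as
    the selection of an index depending on [x] requires. *)
Let joint_sum (f : X -> \bar R) (p : X * R) : \bar R :=
  (\sum_(i <oo) (\1_(fresh g i) p.1)%:E *
    ((\1_[set p : X * X * R | index_set R k p.2 /\ F p.2 p.1.1 p.1.2]
       (p.1, g i p.1, p.2))%:E * f (g i p.1)))%E.

Let joint_sumE f x r : (forall x, 0 <= f x)%E -> X1 x -> index_set R k r ->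
  joint_sum f (x, r) = (\esum_(y in F r x) f y)%E.
Proof.
move=> f0 Xx ir; set a := fun y => ((\1_[set p : X * X * R | index_set R k p.2 /\
  F p.2 p.1.1 p.1.2] (x, y, r))%:E * f y)%E.
transitivity (\esum_(y in gorbit g x) a y)%E.
  by rewrite gorbit_esum_series// => y; rewrite mule_ge0// lee_fin.
rewrite -[in RHS](setIidr (F_orbit Xx ir)) esum_mkcondr.
apply: eq_esum => y _; rewrite /a indicE.
case: ifPn => [|]; rewrite ?inE/= ?notin_setE/= => H.
  by rewrite mem_set ?mul1e.
by rewrite memNset ?mul0e// => -[].
Qed.

Let measurable_joint_sum f : (forall x, 0 <= f x)%E -> measurable_fun setT f ->
  measurable_fun setT (joint_sum f).
Proof.
move=> f0 mf; apply: ge0_emeasurable_sum => [i p _ _|i _].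
  by rewrite mule_ge0 ?lee_fin// mule_ge0 ?lee_fin.
have mgi : measurable_fun setT (fun p : X * R => g i p.1).
  exact: (measurableT_comp (pa_meas ga i) measurable_fst).
apply: emeasurable_funM; last apply: emeasurable_funM.
- apply/measurable_EFinP; apply: measurableT_comp measurable_fst.
  exact: measurable_indic (measurable_fresh ga i).
- apply/measurable_EFinP.
  have mp : measurable_fun setT (fun p : X * R => (p.1, g i p.1, p.2)).
    by apply: measurable_fun_pair => //; exact: measurable_fun_pair.
  by apply: measurableT_comp mp; exact: measurable_indic mF.
- exact: (measurableT_comp mf mgi).
Qed.

(** Empty off [X1] and at invalid indices, so that it is an orbit relation on the whole space. *)
Definition stopped (rho : X -> R) (z : X) : set X :=
  [set y | X1 z /\ (index_set R k (rho z) /\ F (rho z) z y)].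

Lemma stopped_rel rho : measurable_fun setT rho -> orbit_rel g (stopped rho).
Proof.
move=> mrho; split; first by move=> x y [Xx [ir Fy]]; exact: (F_orbit Xx ir).
move=> i.
have mp : measurable_fun setT (fun x => (x, g i x, rho x)).
  apply: measurable_fun_pair => //; apply: measurable_fun_pair => //.
  exact: pa_meas ga i.
have := mp measurableT _ mF; rewrite setTI => mA.
exact: (measurableI _ _ mX1 mA).
Qed.

(** The maximal inequality for an index already chosen measurably; [weak_type_bound] supplies the
    choice. *)
Definition stopping_bound (C : R) := forall (rho : X -> R) (Y : set X) (lam : R)
    (f : X -> \bar R),
  measurable_fun setT rho -> measurable Y ->
  (forall z, Y z -> X1 z /\ index_set R k (rho z)) ->
  0 <= lam -> (forall x, 0 <= f x)%E -> measurable_fun setT f ->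
  (forall x, f x \is a fin_num) ->
  (forall z, Y z -> lam%:E * counting (F (rho z) z) <= \esum_(y in F (rho z) z) f y)%E ->
  (lam%:E * mu Y <= C%:E * \int[mu]_x f x)%E.

(** [Y] is where the selected index is bad. It is measurable as a preimage, and almost every point
    of [X1] outside it has no bad index at all, even among uncountably many. *)
Lemma weak_type_bound C : stopping_bound C -> forall (lam : R) (f : X -> \bar R),
  0 <= lam -> (forall x, 0 <= f x)%E -> measurable_fun setT f ->
  (forall x, f x \is a fin_num) ->
  exists Y, [/\ measurable Y, (lam%:E * mu Y <= C%:E * \int[mu]_x f x)%E &
    {ae mu, forall x, X1 x -> ~ Y x -> forall r, index_set R k r ->
      (\esum_(y in F r x) f y <= lam%:E * counting (F r x))%E}].
Proof.
move=> bound lam f lam0 f0 mf ff.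
pose B := [set p : X * R | lam%:E * joint_sum (cst 1) p < joint_sum f p]%E `&`
          (X1 `*` index_set R k).
have mB : measurable B.
  apply: measurableI; last exact: (measurableX mX1 (measurable_index_set k)).
  rewrite -[X in measurable X]setTI; apply: measurable_lte => //.
    by apply: measurable_funeM; apply: measurable_joint_sum => // x; rewrite lee01.
  exact: measurable_joint_sum.
have [rho [mrho rhoP]] := ae_measurable_section mu (standard_borel_real R) mB.
pose Y := [set x | B (x, rho x)].
have mY : measurable Y.
  have mp : measurable_fun setT (fun x => (x, rho x)) by exact: measurable_fun_pair.
  by have := mp measurableT _ mB; rewrite setTI.
have le01' x : (0 <= (cst 1 : X -> \bar R) x)%E by rewrite lee01.
exists Y; split => //.
  apply: (bound rho) => // [z [_ []]//|z [/= lt [/= Xz iz]]].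
  move: lt; rewrite !joint_sumE// => /ltW; by rewrite counting_esum.
apply: filterS rhoP => x Hx Xx nY r ir; rewrite leNgt; apply/negP => lt.
apply/nY/Hx; exists r; split => //=.
by rewrite !joint_sumE// -counting_esum.
Qed.

(** * The regular case *)

Section regular.
Variable C : R.
Hypothesis C_gt0 : 0 < C.
Hypothesis Freg : forall x, X1 x -> forall r, index_set R k r ->
  (counting (\bigcup_(s in index_le k r) sf_comp (sf_inv (F s)) (F r) x)
     <= C%:E * counting (F r x))%E.

Section truncated.
Variables (rho : X -> R) (Y : set X) (N : nat).
Hypothesis mrho : measurable_fun setT rho.
Hypothesis mY : measurable Y.
Hypothesis Y_idx : forall z, Y z -> X1 z /\ index_set R k (rho z).
Hypothesis Y_rho : forall z, Y z -> rho z <= N%:R.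
Hypothesis Y_card : forall z, Y z -> (counting (stopped rho z) <= (N%:R : R)%:E)%E.

Let S := stopped rho.
Let rS : orbit_rel g S := stopped_rel mrho.

Let meets z : set X := [set z' | exists u, S z u /\ S z' u].

Let SE z : Y z -> S z = F (rho z) z.
Proof.
by move=> /Y_idx[Xz iz]; apply/seteqP; split => [y [_ []]//|y Fy]; split.
Qed.

Let meets_le z : Y z -> (counting [set y | [/\ Y y, (rho y <= rho z)%R & meets z y]]
  <= C%:E * counting (S z))%E.
Proof.
move=> Yz; have [Xz iz] := Y_idx Yz; rewrite SE//.
apply: le_trans (Freg Xz iz); apply: le_counting => y [Yy le_yz [u [Szu Syu]]].
exists (rho y); first by split => //; exact: (Y_idx Yy).2.
by exists u; [case: Szu => _ []|case: Syu => _ []].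
Qed.

Let late z : set X := [set y | meets z y /\ (Y z /\ Y y) /\ rho z <= rho y].

Let mrhoi i : measurable_fun setT (fun x => rho (g i x)).
Proof. exact: (measurableT_comp mrho (pa_meas ga i)). Qed.

Let rlate : orbit_rel g late.
Proof.
apply: (orbit_relI (orbit_rel_comp ga rS (orbit_rel_inv ga rS))
  (Q := fun z y => (Y z /\ Y y) /\ rho z <= rho y)) => i.
apply: (measurableI _ _ (measurableI _ _ mY (measurable_pull ga i mY))).
exact: measurable_setler.
Qed.

(** Mass transport exchanges the mean number of meeting points that stop no earlier with that of
    those that stop no later, which regularity and [Y_card] bound by [C * N]. Finiteness leaves a
    gap above [rho z], so that [z] belongs to [meshed] for a fine enough mesh. *)
Let ae_late_finite : {ae mu, forall z, finite_set (late z)}.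
Proof.
have mlate := measurable_counting_rel ga rlate.
suff : {ae mu, forall z, setT z -> (counting (late z) : \bar R) \is a fin_num}.
  by apply: filterS => z /(_ I); rewrite fin_numElt => /andP[_] /counting_fin.
apply: integrable_ae => //; apply/integrableP; split => //.
under eq_integral do rewrite gee0_abs ?counting_ge0//.
under eq_integral do rewrite counting_esum.
rewrite (mass_transport_rel ga rlate (K := fun _ _ => 1%E))//.
apply: (@le_lt_trans _ _ (\int[mu]_x (C * N%:R)%:E)%E); last first.
  rewrite (integral_cst mu measurableT).
  by rewrite [X in (_ * X)%E](@probability_setT _ _ _ mu) mule1 ltry.
have mlate' := measurable_counting_rel ga (orbit_rel_inv ga rlate).
under eq_integral do rewrite -counting_esum.
apply: ge0_le_integral => //.
move=> z _; have [Yz|nY] := pselect (Y z); last first.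
  rewrite (_ : [set y | late y z] = set0); last first.
    by apply/seteqP; split => // y [_ [[_ /nY]]].
  by rewrite counting_set0 lee_fin mulr_ge0// ltW.
rewrite EFinM; apply: (@le_trans _ _ (C%:E * counting (S z)))%E; last first.
  by rewrite lee_pmul ?lee_fin ?counting_ge0 ?(ltW C_gt0)// Y_card.
apply: le_trans (meets_le Yz); apply: le_counting => y [[u [? ?]] [[Yy _] le]].
by split => //; exists u.
Qed.

Section mesh.
Variable n : nat.

(* Points meeting no point that stops just after them: two of them that meet
   within one cell of the mesh stop at the same time. *)
Definition meshed : set X :=
  [set z | Y z /\ ~ exists y, meets z y /\ (Y y /\ rho z < rho y < rho z + n.+1%:R^-1)].

Lemma measurable_meshed : measurable meshed.
Proof.
pose bad z := [set y | meets z y /\ (Y y /\ rho z < rho y < rho z + n.+1%:R^-1)].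
have rbad : orbit_rel g bad.
  apply: (orbit_relI (orbit_rel_comp ga rS (orbit_rel_inv ga rS))
    (Q := fun z y => Y y /\ rho z < rho y < rho z + n.+1%:R^-1)) => i.
  apply: (measurableI _ _ (measurable_pull ga i mY)).
  rewrite (_ : (fun x => _) = [set x | rho x < rho (g i x)] `&`
      [set x | rho (g i x) < rho x + n.+1%:R^-1]).
    apply: measurableI; first exact: measurable_setltr.
    by apply: measurable_setltr => //; exact: measurable_funD.
  by apply/seteqP; split => x /=; [move=> /andP[]|move=> [-> ->]].
rewrite (_ : meshed = Y `\` [set z | (0 < (counting (bad z) : \bar R))%E]).
  apply: measurableD => //.
  rewrite -[X in measurable X]setTI; apply: measurable_lte => //.
  exact: (measurable_counting_rel ga rbad).
apply/seteqP; split => z /= [Yz nbad]; split => //.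
  move=> lt0; apply: nbad; apply: contrapT => nex.
  move: lt0; rewrite (_ : bad z = set0) ?counting_set0 ?ltxx//.
  by apply/seteqP; split => // y Hy; apply: nex; exists y.
move=> [y Hy]; apply: nbad; apply: lt_le_trans lte01 _.
by rewrite -(counting_set1 y); apply: le_counting => _ ->.
Qed.

(** Cells of width [n.+1%:R^-1] counted downwards from [N]: large indices get low rank and receive
    their weights first. *)
Let q z : nat := Num.truncn ((N%:R - rho z) * n.+1%:R).

Let q_lt z y : (q z < q y)%N -> rho y < rho z.
Proof.
apply: contraTT; rewrite -leNgt -leqNgt => le_zy.
by apply: le_truncn; rewrite ler_pM2r ?ltr0n// lerB.
Qed.

Let q_eq z y : meshed z -> meshed y -> meets z y -> q z = q y -> rho z = rho y.
Proof.
have aux z' y' : meshed z' -> meshed y' -> meets z' y' -> q z' = q y' ->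
    ~ rho z' < rho y'.
  move=> [Yz nz] [Yy _] zy qq lt; apply: nz; exists y'; split => //; split => //.
  rewrite lt /=; have := Y_rho Yy; have := Y_rho Yz => rz ry.
  have z0 : 0 <= (N%:R - rho z') * n.+1%:R by rewrite mulr_ge0// subr_ge0.
  have y0 : 0 <= (N%:R - rho y') * n.+1%:R by rewrite mulr_ge0// subr_ge0.
  have /andP[_ zu] := truncn_itv z0; have /andP[yl _] := truncn_itv y0.
  have nn : (0 : R) < n.+1%:R by rewrite ltr0n.
  have : (rho y' - rho z') * n.+1%:R < 1.
    move: zu yl; rewrite -/(q z') -/(q y') qq -natr1 => zu yl.
    rewrite mulrBl in zu; rewrite mulrBl in yl; rewrite mulrBl; lra.
  by rewrite -ltr_pdivlMr// div1r ltrBlDl.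
move=> mz my zy qq; apply/eqP; rewrite eq_le !leNgt; apply/andP; split; apply/negP.
  apply: aux => //; case: zy => u [? ?]; by exists u.
exact: aux.
Qed.

Lemma meshed_bound (lam : R) (f : X -> \bar R) :
  0 <= lam -> (forall x, 0 <= f x)%E -> measurable_fun setT f ->
  (forall x, f x \is a fin_num) ->
  (forall z, Y z -> lam%:E * counting (F (rho z) z) <= \esum_(y in F (rho z) z) f y)%E ->
  (lam%:E * mu meshed <= (4 * C)%:E * \int[mu]_x f x)%E.
Proof.
move=> lam0 f0 mf ff HY.
pose cd z : R := fine (counting (S z)).
have cdE z : Y z -> counting (S z) = (cd z)%:E.
  move=> Yz; rewrite /cd fineK// ge0_fin_numE ?counting_ge0//.
  by rewrite (le_lt_trans (Y_card Yz))// ltry.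
have cd1 z : Y z -> 1 <= cd z.
  move=> Yz; rewrite -lee_fin -cdE// SE//; have [Xz iz] := Y_idx Yz.
  exact: X1_ge1.
(* By regularity at most [C * cd z] points of the rank of [z] have a set through a given point of
   [S z], so these weights satisfy [H2]. *)
pose c z := (C * cd z)^-1.
have c0 z : 0 <= c z.
  by rewrite invr_ge0 mulr_ge0 ?(ltW C_gt0)// fine_ge0// counting_ge0.
have mcd : measurable_fun setT cd.
  exact: (measurableT_comp (fine_measurable measurableT) (measurable_counting_rel ga rS)).
have -> : 4 * C = 2 * (C + C) by ring.
(* Both covering constants are [C]. The bound on ranks takes a successor because the index 0 has
   rank exactly [N * n.+1]. *)
apply: (covering_maximal ga (Y := meshed) (S := S) (q := q) (c := c)
  (N := (N * n.+1).+1)) => //.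
- exact: measurable_meshed.
- move=> j; apply: measurable_truncn; apply: measurable_funM => //.
  exact: measurable_funB.
- have cdN z : cd z = (Num.truncn (cd z))%:R.
    by rewrite /cd /counting; case: asboolP => _ /=; rewrite ?natrK// truncn0.
  rewrite (_ : c = (fun j => (C * j%:R)^-1) \o (fun z => Num.truncn (cd z))).
    by apply: measurable_fun_nat => j; exact: measurable_truncn.
  by apply/funext => z; rewrite /c [in LHS]cdN.
- move=> z [Yz _]; rewrite ltnS truncn_le_nat; apply: (@le_lt_trans _ _ (N * n.+1)%:R).
    rewrite natrM ler_pM2r ?ltr0n// gerBl.
    exact: index_set_ge0 (Y_idx Yz).2.
  by rewrite ltr_nat.
(* All points of [A] meet at [y] and share their rank, hence their index. Regularity at any [z] in
   [A] therefore bounds the size of [A] by [C * cd z], so each weight is at most the inverse of that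
   size. *)
- move=> y j; set A := mkset _.
  have [A0|/set0P[z0 [Sz0 mz0 qz0]]] := eqVneq A set0; first by rewrite A0 esum_set0 lee01.
  have AC z : A z -> (counting A <= C%:E * counting (S z))%E.
    move=> [Sz mz qz]; have [Xz iz] := Y_idx mz.1.
    rewrite SE; last exact: mz.1.
    apply: le_trans (Freg Xz iz); apply: le_counting => z' [Sz' mz' qz'].
    have e : rho z' = rho z.
      by apply: q_eq => //; [exists y|rewrite qz'].
    exists (rho z); first by split.
    exists y; first by case: Sz => _ [].
    by rewrite /sf_inv /= -e; case: Sz' => _ [].
  have finA : (counting A : \bar R) \is a fin_num.
    rewrite ge0_fin_numE ?counting_ge0//.
    apply: (le_lt_trans (AC z0 _)) => //; rewrite cdE; last exact: mz0.1.
    by rewrite -EFinM ltry.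
  pose D := fine (counting A : \bar R).
  have D1 : 1 <= D.
    rewrite -lee_fin fineK// -(counting_set1 z0); apply: le_counting => _ ->.
    by split.
  have D0 : 0 < D := lt_le_trans ltr01 D1.
  apply: (@le_trans _ _ (\esum_(z in A) (D^-1)%:E)%E).
    apply: le_esum => z Az; have Yz : Y z by case: Az => _ [].
    have cpos : 0 < C * cd z by rewrite mulr_gt0// (lt_le_trans ltr01)// cd1.
    rewrite lee_fin lef_pV2 ?posrE// -lee_fin EFinM -cdE// fineK//.
    exact: AC.
  rewrite esum_cst ?lee_fin ?invr_ge0 ?(ltW D0)//.
  by rewrite -(fineK finA) -EFinM mulVf// gt_eqF.
- exact: ltW.
- exact: ltW.
- move=> z [Yz _]; rewrite cdE// -!EFinM lee_fin /c invfM.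
  have := cd1 z Yz => cdz.
  rewrite (_ : C * (_ * _) = 1)//; field.
  by rewrite !gt_eqF// (lt_le_trans ltr01).
- move=> z [Yz _]; apply: le_trans (meets_le Yz); apply: le_counting.
  move=> y [[Yy _] qq [u [? ?]]]; split => //; last by exists u.
  exact/ltW/q_lt.
- by move=> z [Yz _]; rewrite SE//; exact: HY.
Qed.

End mesh.

Lemma truncated_bound (lam : R) (f : X -> \bar R) :
  0 <= lam -> (forall x, 0 <= f x)%E -> measurable_fun setT f ->
  (forall x, f x \is a fin_num) ->
  (forall z, Y z -> lam%:E * counting (F (rho z) z) <= \esum_(y in F (rho z) z) f y)%E ->
  (lam%:E * mu Y <= (4 * C)%:E * \int[mu]_x f x)%E.
Proof.
move=> lam0 f0 mf ff HY.
apply: (@le_trans _ _ (lam%:E * mu (\bigcup_n meshed n))%E); last first.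
  apply: mu_bigcup_le => n; first exact: measurable_meshed.
  - move=> z [Yz nz]; split => // -[y [zy [Yy /andP[lt1 lt2]]]]; apply: nz.
    exists y; split => //; split => //; rewrite lt1/= (lt_le_trans lt2)//.
    by rewrite lerD2l lef_pV2 ?posrE ?ltr0n// ler_nat.
  - exact: meshed_bound.
apply: lee_pmul => //.
have mU : measurable (\bigcup_n meshed n).
  by apply: bigcupT_measurable => n; exact: measurable_meshed.
(* Among finitely many late points, those with an index above [rho z] stay at a positive distance
   from it, and a finer mesh resolves that distance. *)
have : mu (Y `\` \bigcup_n meshed n) = 0%E.
  apply/negligibleP; first exact: measurableD.
  apply: negligibleS ae_late_finite => z /= [Yz nz] fl; apply: nz.
  have [n Hn] : exists n : nat, forall y, late z y -> rho z < rho y ->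
      rho z + n.+1%:R^-1 <= rho y.
    apply: (finite_nat_bound (P := fun y n => rho z < rho y ->
      rho z + n.+1%:R^-1 <= rho y)) => //.
      move=> y i j ij + lt => /(_ lt); apply: le_trans.
      by rewrite lerD2l lef_pV2 ?posrE ?ltr0n// ler_nat.
    move=> y _; have [lt|nlt] := boolP (rho z < rho y); last by exists 0%N.
    have e0 : 0 < rho y - rho z by rewrite subr_gt0.
    have [i _ Hi] := near_infty_natSinv_lt (PosNum e0).
    by exists i => _; rewrite -lerBrDl ltW// Hi/=.
  exists n => //; split => // -[y [zy [Yy /andP[lt1 lt2]]]].
  have := Hn y; rewrite leNgt lt2 => H.
  suff : false by []; apply: H => //; split => //; split => //; exact: ltW.
move=> mu0; rewrite (measureDI mu mY mU) [X in (X + _)%E](mu0 : _ = 0%E) add0e.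
exact: measureIr.
Qed.

End truncated.

Lemma regular_stopping_bound : stopping_bound (4 * C).
Proof.
move=> rho Y lam f mrho mY Yidx lam0 f0 mf ff HY.
pose YN N := Y `&` ([set z | rho z <= N%:R] `&`
   [set z | (counting (stopped rho z) <= (N%:R : R)%:E)%E]).
have mYN N : measurable (YN N).
  apply: measurableI => //; apply: measurableI; first exact: measurable_setler.
  rewrite -[X in measurable X]setTI; apply: measurable_lee => //.
  exact: (measurable_counting_rel ga (stopped_rel mrho)).
have YU : Y = \bigcup_N YN N.
  apply/seteqP; split => [z Yz|z [N _ []]//].
  have [Xz iz] := Yidx z Yz.
  have fS : finite_set (stopped rho z).
    by apply: sub_finite_set (family_finite z iz) => y [_ []].
  have [M HM] : exists M : nat, (counting (stopped rho z) = (M%:R : R)%:E)%E.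
    by rewrite /counting asboolT//; eexists; reflexivity.
  exists (maxn M (Num.truncn (rho z)).+1) => //; split => //; split => /=.
    by rewrite (le_trans (ltW (truncnS_gt _)))// ler_nat leq_maxr.
  by rewrite HM lee_fin ler_nat leq_maxl.
rewrite YU; apply: mu_bigcup_le => // N.
  move=> z [Yz [/= r1 c1]]; split => //; split => /=.
    by rewrite (le_trans r1)// ler_nat.
  by rewrite (le_trans c1)// lee_fin ler_nat.
apply: (@truncated_bound rho (YN N) N) => //.
- by move=> z [/Yidx].
- by move=> z [_ []].
- by move=> z [_ []].
- by move=> z [/HY].
Qed.

End regular.

(** * The uniform and tempered case *)

Section tempered.
Variables (Cu Ct : R) (a b : R -> R).
Hypothesis kN : k = IndexNat.
Hypothesis Cu_gt0 : 0 < Cu.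
Hypothesis Ct_ge0 : 0 <= Ct.
Hypothesis b_gt0 : forall r, index_set R k r -> 0 < b r.
Hypothesis b_le : forall r, index_set R k r -> b r <= Cu * a r.
Hypothesis F_ge : forall x, X1 x -> forall r, index_set R k r ->
  ((a r)%:E <= counting (F r x))%E.
Hypothesis Finv_le : forall x, X1 x -> forall r, index_set R k r ->
  (counting (sf_inv (F r) x) <= (b r)%:E)%E.
Hypothesis Ftemp : forall x, X1 x -> forall n, index_set R k n ->
  (counting (\bigcup_(m in index_le k (n - 1)) sf_comp (sf_inv (F m)) (F n) x)
     <= Ct%:E * counting (F n x))%E.

(** Temperedness reaches only strictly smaller indices, which is exactly what [H3] asks about higher
    ranks. Overlaps within one index are left to uniformity. *)
Lemma tempered_stopping_bound : stopping_bound (2 * (Cu + Ct)).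
Proof.
move=> rho Y0 lam f mrho mY0 Y0idx lam0 f0 mf ff HY0.
pose nu z : nat := Num.truncn (rho z).
have mnu j : measurable [set z | nu z = j] by exact: measurable_truncn.
pose YN N := Y0 `&` [set z | (nu z <= N)%N].
have mYN N : measurable (YN N).
  apply: measurableI => //.
  rewrite (_ : mkset _ = \bigcup_(j in [set j | (j <= N)%N]) [set z | nu z = j]).
    exact: bigcup_measurable.
  by apply/seteqP; split => z /=; [move=> zN; exists (nu z)|move=> [j /= jN ->]].
have YU : Y0 = \bigcup_N YN N.
  apply/seteqP; split => [z Yz|z [N _ []]//].
  by exists (nu z) => //; split => //=.
rewrite YU; apply: mu_bigcup_le => // N.
  by move=> z [Yz /= zN]; split => //=; exact: leq_trans zN _.
set Y := YN N.
have Yidx z : Y z -> X1 z /\ index_set R k (rho z) by move=> [/Y0idx].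
have rhoE z : Y z -> rho z = (nu z)%:R.
  by move=> /Yidx[_]; rewrite kN => -[n _ rn]; rewrite /nu -rn natrK.
have SE z : Y z -> stopped rho z = F (rho z) z.
  by move=> /Yidx[Xz iz]; apply/seteqP; split => [y [_ []]//|y Fy]; split.
have idxN n : index_set R k n%:R by rewrite kN; exists n.
(* At most [b] sets of a given index contain a given point, whence [H2]; their size is at least [a],
   and [b <= Cu * a] gives [H1] with constant [Cu]. *)
pose c z := (b (nu z)%:R)^-1.
have c0 z : 0 <= c z by rewrite invr_ge0 ltW// b_gt0.
have rS := stopped_rel mrho.
apply: (covering_maximal ga (Y := Y) (S := stopped rho) (q := fun z => (N - nu z)%N)
  (c := c) (N := N.+1)) => //.
- exact: (mYN N).
- move=> j; rewrite (_ : mkset _ =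
      \bigcup_(i in [set i | (N - i)%N = j]) [set z | nu z = i]).
    exact: bigcup_measurable.
  by apply/seteqP; split => z /=; [move=> zN; exists (nu z)|move=> [i /= iN ->]].
- exact: (measurable_fun_nat (fun n => (b n%:R)^-1) mnu).
- by move=> z _; rewrite ltnS leq_subr.
- move=> y j; set A := mkset _.
  have [A0|/set0P[z0 [Sz0 Yz0 qz0]]] := eqVneq A set0; first by rewrite A0 esum_set0 lee01.
  have nuA z : A z -> nu z = nu z0.
    by move=> [_ [_ /= zN] qz]; case: Yz0 => _ /= z0N; lia.
  have Xy : X1 y by apply: X1_inv (Yidx _ Yz0).1; exact: (rS.1 _ _ Sz0).
  apply: (@le_trans _ _ (\esum_(z in A) (c z0)%:E)%E).
    by apply: le_esum => z Az; rewrite /c (nuA z Az).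
  rewrite esum_cst ?lee_fin//.
  apply: (@le_trans _ _ ((c z0)%:E * (b (nu z0)%:R)%:E)%E).
    apply: lee_pmul => //; first by rewrite lee_fin.
    apply: le_trans (Finv_le Xy (idxN _)); apply: le_counting => z Az.
    have Yz : Y z by case: Az.
    rewrite /sf_inv /= -(nuA z Az) -rhoE//.
    by case: Az => -[_ []].
  by rewrite -EFinM mulVf// gt_eqF// b_gt0.
- exact: ltW.
- move=> z Yz; have [Xz iz] := Yidx z Yz; rewrite SE//.
  apply: (@le_trans _ _ (Cu%:E * ((c z)%:E * (a (rho z))%:E))%E); last first.
    rewrite lee_wpmul2l ?lee_fin ?(ltW Cu_gt0)// lee_wpmul2l ?lee_fin//.
    exact: F_ge.
  rewrite -!EFinM lee_fin /c -rhoE// mulrCA -ler_pdivrMl ?invr_gt0 ?b_gt0// invrK mulr1.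
  exact: b_le.
- move=> z Yz; have [Xz iz] := Yidx z Yz; rewrite SE//.
  apply: le_trans (Ftemp Xz iz); apply: le_counting => y [Yy qq [u [Szu Syu]]].
  exists (rho y); first split.
  + exact: (Yidx y Yy).2.
  + rewrite !rhoE//; case: Yz => _ /= zN; case: Yy => _ /= yN.
    by rewrite -lerBlDr opprK natr1 ler_nat; lia.
  + by exists u => //; case: Syu => _ [].
- by move=> z Yz; rewrite SE//; apply: HY0; case: Yz.
Qed.

End tempered.

End family.

(** * Decomposition in L1 *)

Section integrable_functions.
Context {R : realType} d {X : measurableType d}.
Variable mu : probability X R.
Implicit Types u v f : X -> R.

Definition L1 u := mu.-integrable setT (EFin \o u).

Lemma L1_meas u : L1 u -> measurable_fun setT u.
Proof. by move=> /measurable_int/measurable_EFinP. Qed.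

Lemma L1D u v : L1 u -> L1 v -> L1 (fun x => u x + v x).
Proof. by move=> Lu Lv; exact: (integrableD measurableT Lu Lv). Qed.

Lemma L1B u v : L1 u -> L1 v -> L1 (fun x => u x - v x).
Proof. by move=> Lu Lv; exact: (integrableB measurableT Lu Lv). Qed.

Lemma L1Z a u : L1 u -> L1 (fun x => a * u x).
Proof. by move=> Lu; exact: (integrableZl measurableT a Lu). Qed.

Lemma L1norm u : L1 u -> L1 (fun x => `|u x|).
Proof. by move=> Lu; exact: (integrable_norm Lu). Qed.

Lemma L1_le u v : measurable_fun setT u -> L1 v -> (forall x, `|u x| <= v x) -> L1 u.
Proof.
move=> mu_ Lv uv; apply: (le_integrable measurableT _ _ Lv).
  exact/measurable_EFinP.
by move=> x _; rewrite /= lee_fin (le_trans (uv x))// ler_norm.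
Qed.

Lemma L1_cst a : L1 (fun=> a).
Proof. exact: finite_measure_integrable_cst. Qed.

Lemma L1_bounded u M : measurable_fun setT u -> (forall x, `|u x| <= M) -> L1 u.
Proof. by move=> mu_ uM; apply: L1_le (L1_cst M) uM. Qed.

Definition mean u : R := \int[mu]_x u x.

Lemma meanD u v : L1 u -> L1 v -> mean (fun x => u x + v x) = mean u + mean v.
Proof. by move=> Lu Lv; exact: (RintegralD measurableT Lu Lv). Qed.

Lemma meanB u v : L1 u -> L1 v -> mean (fun x => u x - v x) = mean u - mean v.
Proof. by move=> Lu Lv; exact: (RintegralB measurableT Lu Lv). Qed.

Lemma meanZ a u : L1 u -> mean (fun x => a * u x) = a * mean u.
Proof. by move=> Lu; exact: (RintegralZl a measurableT Lu). Qed.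

Lemma le_mean u v : L1 u -> L1 v -> (forall x, u x <= v x) -> mean u <= mean v.
Proof. by move=> Lu Lv uv; apply: le_Rintegral => // x _; exact: uv. Qed.

Lemma mean_ge0 u : (forall x, 0 <= u x) -> 0 <= mean u.
Proof. by move=> u0; apply: Rintegral_ge0 => x _; exact: u0. Qed.

Lemma mean_cst a : mean (fun=> a) = a.
Proof.
rewrite /mean Rintegral_cst//.
rewrite (_ : fine _ = 1) ?mulr1//.
by rewrite [X in fine X](@probability_setT _ _ _ mu).
Qed.

Lemma EFin_mean u : L1 u -> (mean u)%:E = (\int[mu]_x (u x)%:E)%E.
Proof. by move=> Lu; rewrite /mean /Rintegral fineK//; exact: integrable_fin_num. Qed.

Lemma mean_normB_le u v w : L1 u -> L1 v -> L1 w ->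
  mean (fun x => `|u x - w x|) <= mean (fun x => `|u x - v x|) + mean (fun x => `|v x - w x|).
Proof.
move=> Lu Lv Lw; rewrite -meanD; [|exact/L1norm/L1B..].
apply: le_mean; [exact/L1norm/L1B|by apply: L1D; exact/L1norm/L1B|].
by move=> x; exact: ler_distD.
Qed.

Lemma mean_normBC u v : mean (fun x => `|u x - v x|) = mean (fun x => `|v x - u x|).
Proof. by congr mean; apply/funext => x; rewrite distrC. Qed.

Lemma mean_norm_eq0 u : L1 u -> mean (fun x => `|u x|) = 0 -> {ae mu, forall x, u x = 0}.
Proof.
move=> Lu mean0.
have : ae_eq mu setT (EFin \o u) (cst 0%E).
  apply/ae_eq_integral_abs => //; first exact/measurable_EFinP/L1_meas.
  by have := EFin_mean (L1norm Lu); rewrite mean0 => /esym.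
by apply: filterS => x /(_ I) /= [].
Qed.

Lemma bounded_increments_cvg (s : nat -> R) (M : R) :
  (forall n, \sum_(0 <= i < n) `|s i.+1 - s i| <= M) -> cvg (s @ \oo).
Proof.
move=> sM.
have : cvgn (series (telescope s)).
  apply: normed_cvg; apply: nondecreasing_is_cvgn.
    by apply: nondecreasing_series => // i _ _; exact: normr_ge0.
  by exists M => _ [n _ <-]; exact: sM.
move=> cs; have -> : s = (fun n => s 0%N + series (telescope s) n).
  by apply/funext => n; rewrite -eq_sum_telescope.
by apply: is_cvgD => //; exact: is_cvg_cst.
Qed.

(** The sum of the absolute increments is integrable, so the sequence converges almost everywhere,
    dominated by the absolute value of [v 0] plus that sum. *)
Lemma L1_complete (v : nat -> X -> R) K : (forall n, L1 (v n)) ->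
  (forall n, mean (fun x => `|v n.+1 x - v n x|) <= K * 2 ^- n) ->
  exists h, L1 h /\ mean (fun x => `|v n x - h x|) @[n --> \oo] --> (0 : R).
Proof.
move=> Lv vK.
have K0 : 0 <= K.
  by have := vK 0%N; rewrite expr0 invr1 mulr1; apply: le_trans; exact: mean_ge0.
pose s n x := `|v n.+1 x - v n x|.
have Ls n : L1 (s n) by exact/L1norm/L1B.
pose G x := (\sum_(n <oo) (s n x)%:E)%E.
have ms n : measurable_fun setT (fun x => (s n x)%:E).
  by apply/measurable_EFinP; exact: L1_meas.
have mG : measurable_fun setT G.
  by apply: ge0_emeasurable_sum => // n x _ _; rewrite lee_fin normr_ge0.
have G0 x : (0 <= G x)%E.
  by apply: nneseries_ge0 => n _ _; rewrite lee_fin normr_ge0.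
have iG : (\int[mu]_x G x <= (2 * K)%:E)%E.
  rewrite integral_nneseries//; last by move=> n x _; rewrite lee_fin normr_ge0.
  apply: lime_le.
    by apply: is_cvg_nneseries => n _ _; apply: integral_ge0 => x _; rewrite lee_fin normr_ge0.
  apply: nearW => n; under eq_bigr do rewrite -EFin_mean//.
  rewrite sumEFin lee_fin.
  (* The subtracted remainder of the geometric series lets the induction close. *)
  have : \sum_(0 <= i < n) mean (s i) <= 2 * K - 2 * K * 2 ^- n.
    elim: n => [|n IH]; first by rewrite big_geq// expr0 invr1 mulr1 subrr.
    rewrite big_nat_recr//=; have := vK n; rewrite -/(s n) exprS invfM => vn.
    apply: le_trans (lerD IH vn) _; lra.
  move/le_trans; apply; rewrite gerBl mulr_ge0// ?invr_ge0 ?exprn_ge0//.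
  by rewrite mulr_ge0.
pose dom x := (`|v 0%N x|%:E + G x)%E.
have idom : mu.-integrable setT dom.
  apply: integrableD => //; first exact: (L1norm (Lv 0%N)).
  apply/integrableP; split => //.
  under eq_integral do rewrite gee0_abs//.
  by rewrite (le_lt_trans iG)// ltry.
have sumG n x : ((\sum_(0 <= i < n) s i x)%:E <= G x)%E.
  rewrite -sumEFin; apply: nneseries_lim_ge => i _.
  by rewrite lee_fin normr_ge0.
have v_dom n x : (`|(v n x)%:E| <= dom x)%E.
  apply: (@le_trans _ _ ((`|v 0%N x| + \sum_(0 <= i < n) s i x)%:E)%E).
    rewrite abse_EFin lee_fin; elim: n => [|n IH]; first by rewrite big_geq// addr0.
    rewrite big_nat_recr//= addrA.
    apply: (@le_trans _ _ (`|v n x| + s n x)); last by rewrite lerD2r.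
    by rewrite -{1}(subrK (v n x) (v n.+1 x)) addrC; exact: ler_normD.
  by rewrite EFinD /dom leeD2l.
(* The upper limit is measurable and defined also where the sequence diverges. *)
pose h x := fine (limn_esup (fun n => (v n x)%:E)).
have mh : measurable_fun setT h.
  apply: (measurableT_comp (fine_measurable measurableT)).
  by apply: measurable_fun_limn_esup => n; apply/measurable_EFinP; exact: L1_meas.
have cvh : {ae mu, forall x, setT x -> (v n x)%:E @[n --> \oo] --> (h x)%:E}.
  have iG' : mu.-integrable setT G.
    apply/integrableP; split => //; under eq_integral do rewrite gee0_abs//.
    by rewrite (le_lt_trans iG)// ltry.
  apply: filterS (integrable_ae measurableT iG') => x /(_ I) fG _.
  have : cvg ((v ^~ x) @ \oo).
    apply: (@bounded_increments_cvg _ (fine (G x))) => n.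
    by rewrite -lee_fin fineK//; exact: sumG.
  move=> /cvg_ex[l vl].
  have vlE : (v n x)%:E @[n --> \oo] --> l%:E by apply/fine_cvgP; split => //; exact: nearW.
  by rewrite /h is_cvg_limn_esupE ?(cvg_lim _ vlE)//; apply/cvg_ex; exists l%:E.
have [] := @dominated_convergence _ _ _ mu setT measurableT
  (fun n x => (v n x)%:E) (EFin \o h) dom.
- by move=> n; apply/measurable_EFinP; exact: L1_meas.
- exact/measurable_EFinP.
- exact: cvh.
- exact: idom.
- by apply: aeW => x n _; exact: v_dom.
move=> Lh cv0 _; exists h; split => //.
have -> : (fun n => mean (fun x => `|v n x - h x|)) =
    (fun n => fine (\int[mu]_x `|(v n x)%:E - (h x)%:E|)%E) by [].
exact: (@fine_cvg _ _ _ _ _ 0 cv0).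
Qed.

End integrable_functions.

Section bounded_measurable.
Context {R : realType} d {X : measurableType d}.
Variable mu : probability X R.
Implicit Types u v f : X -> R.

Definition bounded_meas u := measurable_fun setT u /\ exists M, forall x, `|u x| <= M.

Lemma bounded_meas_L1 u : bounded_meas u -> L1 mu u.
Proof. by move=> [mu_ [M uM]]; exact: L1_bounded mu_ uM. Qed.

Lemma bounded_measD u v : bounded_meas u -> bounded_meas v ->
  bounded_meas (fun x => u x + v x).
Proof.
move=> [mu_ [M uM]] [mv [N vN]]; split; first exact: measurable_funD.
by exists (M + N) => x; rewrite (le_trans (ler_normD _ _))// lerD.
Qed.

Lemma bounded_measM u v : bounded_meas u -> bounded_meas v ->
  bounded_meas (fun x => u x * v x).
Proof.
move=> [mu_ [M uM]] [mv [N vN]]; split; first exact: measurable_funM.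
by exists (M * N) => x; rewrite normrM ler_pM.
Qed.

Lemma bounded_meas_cst a : bounded_meas (fun=> a).
Proof. by split => //; exists `|a|. Qed.

Lemma bounded_measZ a u : bounded_meas u -> bounded_meas (fun x => a * u x).
Proof. exact: bounded_measM (bounded_meas_cst a). Qed.

Lemma bounded_measB u v : bounded_meas u -> bounded_meas v ->
  bounded_meas (fun x => u x - v x).
Proof.
move=> bu /(bounded_measZ (-1)) bv; have := bounded_measD bu bv.
by congr bounded_meas; apply/funext => x; rewrite mulN1r.
Qed.

Lemma bounded_meas_sq u : bounded_meas u -> bounded_meas (fun x => u x ^+ 2).
Proof. by move=> bu; exact: bounded_measM. Qed.

Lemma bounded_meas_comp u psi : measurable_fun setT psi -> bounded_meas u ->
  bounded_meas (u \o psi).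
Proof.
move=> mpsi [mu_ [M uM]]; split; first exact: measurableT_comp.
by exists M => x; exact: uM.
Qed.

Lemma mean_parallelogram u v : bounded_meas u -> bounded_meas v ->
  mean mu (fun x => (u x - v x) ^+ 2) =
  2 * mean mu (fun x => u x ^+ 2) + 2 * mean mu (fun x => v x ^+ 2) -
  4 * mean mu (fun x => (2^-1 * (u x + v x)) ^+ 2).
Proof.
move=> bu bv; have Lu := bounded_meas_L1 (bounded_meas_sq bu).
have Lv := bounded_meas_L1 (bounded_meas_sq bv).
have Lw := bounded_meas_L1 (bounded_meas_sq (bounded_measZ 2^-1 (bounded_measD bu bv))).
rewrite -!meanZ// -meanD; [|exact: L1Z..].
rewrite -meanB; [|by apply: L1D; exact: L1Z|exact: L1Z].
by congr mean; apply/funext => x; field.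
Qed.

(** Integrates [0 <= (a - t) ^+ 2] with [a] the absolute value of [u x]. It plays the part of the
    Cauchy-Schwarz inequality, with [t] to be chosen at each use. *)
Lemma mean_norm_le_sq u t : bounded_meas u -> 0 < t ->
  mean mu (fun x => `|u x|) <= t / 2 + mean mu (fun x => u x ^+ 2) / (2 * t).
Proof.
move=> bu t0; have Lu := bounded_meas_L1 (bounded_meas_sq bu).
rewrite [X in _ + X]mulrC -meanZ// -[t / 2](mean_cst mu) -meanD; [|exact: L1_cst|exact: L1Z].
apply: le_mean; [exact/L1norm/bounded_meas_L1|apply: L1D; [exact: L1_cst|exact: L1Z]|move=> x].
rewrite -[u x ^+ 2]real_normK ?num_real//; set a := `|u x|.
rewrite -subr_ge0 (_ : _ - _ = (a - t) ^+ 2 / (2 * t)); last by field; rewrite gt_eqF.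
by rewrite divr_ge0 ?sqr_ge0// mulr_ge0// ltW.
Qed.

Lemma mean_ae_eq u v : L1 mu u -> L1 mu v -> {ae mu, forall x, u x = v x} ->
  mean mu u = mean mu v.
Proof.
move=> Lu Lv uv; congr fine; apply: ae_eq_integral => //.
- exact/measurable_EFinP/(L1_meas Lu).
- exact/measurable_EFinP/(L1_meas Lv).
- by apply: filterS uv => x -> _.
Qed.

Lemma L1_indic A u : measurable A -> L1 mu u -> L1 mu (fun x => \1_A x * u x).
Proof.
move=> mA Lu; apply: L1_le (L1norm Lu) _.
  by apply: measurable_funM; [exact: measurable_indic|exact: L1_meas Lu].
move=> x; rewrite normrM indicE; case: (x \in A); rewrite ?normr1 ?mul1r//.
by rewrite normr0 mul0r.
Qed.

Lemma ler_mean_indic A u : measurable A -> L1 mu u ->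
  `|mean mu (fun x => \1_A x * u x)| <= mean mu (fun x => `|u x|).
Proof.
move=> mA Lu; apply: le_trans (le_normr_Rintegral measurableT (L1_indic mA Lu)) _.
apply: le_mean; [exact: L1norm (L1_indic mA Lu)|exact: L1norm|move=> x].
by rewrite normrM indicE; case: (x \in A); rewrite ?normr1 ?mul1r// normr0 mul0r.
Qed.

End bounded_measurable.

(** * The invariant part of an integrable function *)

Section ergodic_decomposition.
Context {R : realType} d {X : measurableType d}.
Variables (mu : probability X R) (g : nat -> X -> X).
Hypothesis ga : pmp_action mu g.
Implicit Types u v f h : X -> R.

Lemma L1_action i u : L1 mu u -> L1 mu (fun x => u (g i x)).
Proof.
move=> /integrableP[mu_ fu]; apply/integrableP; split.
  exact: measurableT_comp mu_ (pa_meas ga i).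
rewrite [X in (X < _)%E](_ : _ = (\int[mu]_x `|(u x)%:E|)%E)//.
apply: (integral_action ga i (f := fun x => `|(u x)%:E|%E)) => //.
exact: measurableT_comp.
Qed.

Lemma mean_action i u : L1 mu u -> mean mu (fun x => u (g i x)) = mean mu u.
Proof.
move=> Lu; congr fine.
rewrite -[LHS](@integral_pushforward _ _ X X R _ (pa_meas ga i) mu setT (EFin \o u)).
- apply: eq_measure_integral => [|mg A mA _]; first exact: pa_meas ga _.
  exact: (pa_pres ga i mA).
- by case/integrableP : Lu.
- exact: L1_action Lu.
- exact: measurableT.
Qed.

Definition ginv (A : set X) : Prop :=
  measurable A /\ forall x y, gorbit g x y -> A x -> A y.

(** An invariant function is positive, respectively negative, on an invariant set up to a null set;
    its L1 norm is the difference of the two integrals, whence the factor 2. *)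
Lemma L1_small_of_ginv u e : L1 mu u -> {ae mu, forall x, forall i, u (g i x) = u x} ->
  (forall A, ginv A -> `|mean mu (fun x => \1_A x * u x)| <= e) ->
  mean mu (fun x => `|u x|) <= 2 * e.
Proof.
move=> Lu iu Hu; have [X1 [mX1 X10 X1u X1inv]] := ae_conull_invariant ga iu.
have mu_ := L1_meas Lu.
pose A1 := X1 `&` [set x | 0 < u x]; pose A2 := X1 `&` [set x | u x < 0].
have gA1 : ginv A1.
  split; first by apply: measurableI => //; exact: measurable_setltr.
  move=> x y xy [Xx ux]; split; first exact: X1inv xy Xx.
  by case: xy => i _ <- /=; rewrite X1u.
have gA2 : ginv A2.
  split; first by apply: measurableI => //; exact: measurable_setltr.
  move=> x y xy [Xx ux]; split; first exact: X1inv xy Xx.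
  by case: xy => i _ <- /=; rewrite X1u.
have L1A := L1_indic gA1.1 Lu; have L2A := L1_indic gA2.1 Lu.
have -> : mean mu (fun x => `|u x|) =
    mean mu (fun x => \1_A1 x * u x - \1_A2 x * u x).
  apply: mean_ae_eq; [exact: L1norm|exact: L1B|].
  have : {ae mu, forall x, X1 x}.
    by exists (~` X1); split => //; exact: measurableC.
  apply: filterS => x Xx; rewrite !indicE.
  have [ux|ux|ux] := ltgtP (u x) 0.
  - rewrite ltr0_norm// [in X in X - _]memNset; last by move=> [_ /=]; rewrite ltNge ltW.
    by rewrite mem_set// mul0r mul1r sub0r.
  - rewrite gtr0_norm// [in X in _ - X]memNset; last by move=> [_ /=]; rewrite ltNge ltW.
    by rewrite mem_set// mul0r mul1r subr0.
  - by rewrite ux normr0 !mulr0 subr0.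
rewrite meanB//; have := Hu _ gA1; have := Hu _ gA2.
by rewrite !ler_norml => /andP[? ?] /andP[? ?]; lra.
Qed.

Variables (Psi : set (X -> X)) (C : set (X -> R)).
Hypothesis Psig : Psi `<=` range g.
Hypothesis C_bounded : forall c, C c -> bounded_meas c.
Hypothesis C0 : C (fun=> 0).
Hypothesis C_lin : forall a c1 c2, C c1 -> C c2 -> C (fun x => c1 x + a * c2 x).
Hypothesis C_cob : forall u psi, bounded_meas u -> Psi psi -> C (fun x => u x - u (psi x)).

Definition decomposes f h : Prop :=
  [/\ L1 mu h, (forall psi, Psi psi -> {ae mu, forall x, h (psi x) = h x}) &
    forall e, 0 < e -> exists2 c, C c & mean mu (fun x => `|f x - h x - c x|) <= e].

Let Psi_meas psi : Psi psi -> measurable_fun setT psi.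
Proof. by move=> /Psig[i _ <-]; exact: pa_meas ga i. Qed.

Let L1_psi psi u : Psi psi -> L1 mu u -> L1 mu (fun x => u (psi x)).
Proof. by move=> /Psig[i _ <-]; exact: L1_action. Qed.

Let mean_psi psi u : Psi psi -> L1 mu u -> mean mu (fun x => u (psi x)) = mean mu u.
Proof. by move=> /Psig[i _ <-]; exact: mean_action. Qed.

Let limit_invariant (v : nat -> X -> R) h psi : Psi psi -> (forall n, L1 mu (v n)) ->
  L1 mu h -> mean mu (fun x => `|v n x - h x|) @[n --> \oo] --> (0 : R) ->
  mean mu (fun x => `|v n x - v n (psi x)|) @[n --> \oo] --> (0 : R) ->
  {ae mu, forall x, h (psi x) = h x}.
Proof.
move=> Pp Lv Lh vh vpsi.
have Lhp := L1_psi Pp Lh.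
suff mean0 : mean mu (fun x => `|h (psi x) - h x|) = 0.
  by apply: filterS (mean_norm_eq0 (L1B Lhp Lh) mean0) => x /eqP; rewrite subr_eq0 => /eqP.
apply/eqP; rewrite eq_le mean_ge0 ?andbT//.
have lim0 : (mean mu (fun x => `|v n x - h x|) + mean mu (fun x => `|v n x - v n (psi x)|) +
    mean mu (fun x => `|v n x - h x|)) @[n --> \oo] --> (0 : R).
  by rewrite -[0]addr0 -[X in X + _]addr0; apply: cvgD => //; exact: cvgD.
rewrite -(cvg_lim _ lim0)//; apply: limr_ge; first by apply/cvg_ex; exists 0.
apply: nearW => n; have Lvp := L1_psi Pp (Lv n).
apply: le_trans (mean_normB_le Lhp Lvp Lh) _.
rewrite -addrA; apply: lerD.
  rewrite mean_normBC.
  by rewrite (mean_psi (u := fun x => `|v n x - h x|) Pp (L1norm (L1B (Lv n) Lh))).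
apply: le_trans (mean_normB_le Lvp (Lv n) Lh) _.
by rewrite lerD2r mean_normBC.
Qed.

Let pow4 n : (2 ^- n) ^+ 2 = 4 ^- n :> R.
Proof. by rewrite exprVn -exprM mulnC exprM; congr (_ ^- n); ring. Qed.

(* [c n] minimises the L2 distance from [f] to [C].  By the parallelogram law
   [f - c n] is Cauchy, and, [C] containing the coboundaries, nearly invariant. *)
Lemma bounded_decomposes f : bounded_meas f -> exists h, decomposes f h.
Proof.
move=> bf.
pose Q := [set mean mu (fun x => (f x - c x) ^+ 2) | c in C].
have Q0 : Q !=set0 by exists (mean mu (fun x => (f x - 0) ^+ 2)); exists (fun=> 0).
have lbQ : lbound Q 0 by move=> _ [c _ <-]; apply: mean_ge0 => x; exact: sqr_ge0.
have infQ : has_inf Q by split => //; exists 0.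
have /choice[c Hc] : forall n, exists c, C c /\
    mean mu (fun x => (f x - c x) ^+ 2) < inf Q + 4 ^- n.
  move=> n; have e0 : 0 < 4 ^- n :> R by rewrite invr_gt0 exprn_gt0.
  by have [_ [c Cc <-] lt] := inf_adherent e0 infQ; exists c.
have Cc n : C (c n) by case: (Hc n).
pose v n x := f x - c n x.
have bv n : bounded_meas (v n) by apply: bounded_measB => //; exact: C_bounded.
have Lv n : L1 mu (v n) by exact: bounded_meas_L1.
have vlt n : mean mu (fun x => v n x ^+ 2) < inf Q + 4 ^- n by case: (Hc n).
have Qle c' : C c' -> inf Q <= mean mu (fun x => (f x - c' x) ^+ 2).
  by move=> Cc'; apply: inf_lbound; [case: infQ|exists c'].
have r0 n : 0 < 2 ^- n :> R by rewrite invr_gt0 exprn_gt0.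
(* With [t = 2 * 2 ^- n] both terms of [mean_norm_le_sq] are at most [2 ^- n]. *)
have small u n : bounded_meas u -> mean mu (fun x => u x ^+ 2) <= 4 * 4 ^- n ->
    mean mu (fun x => `|u x|) <= 2 * 2 ^- n.
  move=> bu u2; have t0 : 0 < 2 * 2 ^- n :> R by rewrite mulr_gt0.
  apply: le_trans (mean_norm_le_sq mu bu t0) _.
  apply: (@le_trans _ _ (2 * 2 ^- n / 2 + 4 * 4 ^- n / (2 * (2 * 2 ^- n)))).
    by rewrite lerD2l ler_pM2r// invr_gt0 mulr_gt0.
  rewrite -pow4 le_eqVlt; apply/orP; left; apply/eqP; field.
  by rewrite expf_neq0.
have [h [Lh vh]] : exists h, L1 mu h /\
    mean mu (fun x => `|v n x - h x|) @[n --> \oo] --> (0 : R).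
  apply: (@L1_complete _ _ _ _ _ 2) => // n.
  apply: small; first exact: bounded_measB.
  rewrite mean_parallelogram//.
  (* The midpoint of [v n.+1] and [v n] is [f] minus an element of [C], so [inf Q] bounds its mean
     square from below. *)
  have := Qle (fun x => 0 + 2^-1 * c n.+1 x + 2^-1 * c n x) _.
  have -> : (fun x => (f x - (0 + 2^-1 * c n.+1 x + 2^-1 * c n x)) ^+ 2) =
      (fun x => (2^-1 * (v n.+1 x + v n x)) ^+ 2).
    by apply/funext => x; rewrite /v; field.
  move=> H; have {}H : inf Q <= mean mu (fun x => (2^-1 * (v n.+1 x + v n x)) ^+ 2).
    by apply: H; apply: C_lin => //; exact: C_lin.
  have := vlt n; have := vlt n.+1; have r4 : 4 ^- n.+1 <= 4 ^- n :> R.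
    by rewrite lef_pV2 ?posrE ?exprn_gt0// ler_weXn2l ?ler1n.
  move: H r4; set a := mean _ _; set b := mean _ _; set e := mean _ _; lra.
exists h; split => //.
- move=> psi Pp; apply: (limit_invariant Pp Lv) => //.
  have bp n : bounded_meas (fun x => v n (psi x)).
    exact: bounded_meas_comp (Psi_meas Pp) (bv n).
  have le n : mean mu (fun x => `|v n x - v n (psi x)|) <= 2 * 2 ^- n.
    apply: small; first exact: bounded_measB.
    rewrite mean_parallelogram//.
    rewrite (mean_psi (u := fun x => v n x ^+ 2) Pp
      (bounded_meas_L1 mu (bounded_meas_sq (bv n)))).
    (* Adding half the coboundary of [v n] to [c n] stays in [C] and turns [v n] into the midpoint
       of [v n] and its translate by [psi]. *)
    have := Qle (fun x => c n x + 2^-1 * (v n x - v n (psi x))) _.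
    have -> : (fun x => (f x - (c n x + 2^-1 * (v n x - v n (psi x)))) ^+ 2) =
        (fun x => (2^-1 * (v n x + v n (psi x))) ^+ 2).
      by apply/funext => x; rewrite /v; field.
    move=> H; have {}H : inf Q <= mean mu (fun x => (2^-1 * (v n x + v n (psi x))) ^+ 2).
      by apply: H; apply: C_lin => //; exact: C_cob.
    by have := vlt n; move: H; set a := mean _ _; set b := mean _ _; lra.
  apply: (@squeeze_cvgr _ _ _ _ (fun=> 0) (fun n => 2 * 2 ^- n)).
  + by apply: nearW => n; rewrite le mean_ge0.
  + exact: cvg_cst.
  + rewrite -[X in _ --> X](mulr0 2); apply: cvgMr.
    under eq_fun do rewrite -exprVn.
    by apply: cvg_expr; rewrite ger0_norm ?invr_ge0// invf_lt1// ltr1n.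
- move=> e e0; have /cvgr0Pnorm_le/(_ _ e0)[n _ Hn] := vh.
  exists (c n) => //.
  have -> : (fun x => `|f x - h x - c n x|) = (fun x => `|v n x - h x|).
    by apply/funext => x; rewrite /v addrAC.
  by apply: le_trans (Hn n (leqnn n)); exact: ler_norm.
Qed.

Hypothesis C_int : forall c A, C c -> ginv A -> mean mu (fun x => \1_A x * c x) = 0.
Hypothesis Psi_gen : forall h, (forall psi, Psi psi -> {ae mu, forall x, h (psi x) = h x}) ->
  forall i, {ae mu, forall x, h (g i x) = h x}.

Lemma decomposes_mean f h A : L1 mu f -> decomposes f h -> ginv A ->
  mean mu (fun x => \1_A x * f x) = mean mu (fun x => \1_A x * h x).
Proof.
move=> Lf [Lh _ Hh] gA.
apply/eqP; rewrite -subr_eq0 -normr_eq0 eq_le normr_ge0 andbT.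
apply/ler_addgt0Pr => e e0; rewrite add0r; have [c Cc] := Hh e e0; apply: le_trans.
have Lc := bounded_meas_L1 mu (C_bounded Cc).
have Lfhc : L1 mu (fun x => f x - h x - c x) by apply: L1B => //; exact: L1B.
apply: le_trans (ler_mean_indic gA.1 Lfhc).
have LA u : L1 mu u -> L1 mu (fun x => \1_A x * u x) by exact: L1_indic gA.1.
suff -> : mean mu (fun x => \1_A x * (f x - h x - c x)) =
    mean mu (fun x => \1_A x * f x) - mean mu (fun x => \1_A x * h x) by [].
under eq_fun do rewrite !mulrBr.
rewrite meanB; [|exact: L1B (LA _ Lf) (LA _ Lh)|exact: LA].
by rewrite meanB ?(C_int Cc gA) ?subr0//; exact: LA.
Qed.

Lemma decomposes_ae_invariant f h : decomposes f h ->
  {ae mu, forall x, forall i, h (g i x) = h x}.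
Proof. by move=> [_ /Psi_gen Hh _]; exact: ae_foralln. Qed.

Lemma bounded_meas_dense f e : L1 mu f -> 0 < e ->
  exists2 f', bounded_meas f' & mean mu (fun x => `|f x - f' x|) <= e.
Proof.
move=> Lf e0.
pose A n := [set x | `|f x| <= n%:R].
have mA n : measurable (A n).
  apply: measurable_setler => //; apply: measurableT_comp => //; exact: L1_meas Lf.
have mt n : measurable_fun setT (fun x => \1_(A n) x * f x).
  by apply: measurable_funM; [exact: measurable_indic|exact: L1_meas Lf].
have [] := @dominated_convergence _ _ _ mu setT measurableT
  (fun n x => (\1_(A n) x * f x)%:E) (EFin \o f) (fun x => `|f x|%:E).
- by move=> n; apply/measurable_EFinP.
- exact/measurable_EFinP/(L1_meas Lf).
- apply: aeW => x _; apply/fine_cvgP; split; first exact: nearW.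
  apply: cvg_near_cst.
  exists (Num.truncn `|f x|).+1 => // n /= ltn.
  rewrite indicE mem_set ?mul1r// /A /=.
  by rewrite (le_trans (ltW (truncnS_gt _)))// ler_nat.
- exact: (L1norm Lf).
- apply: aeW => x n _; rewrite abse_EFin lee_fin normrM indicE.
  by case: (x \in A n); rewrite ?normr1 ?mul1r// normr0 mul0r.
move=> _ cv0 _.
have /cvgr0Pnorm_le/(_ _ e0)[n _ Hn] : mean mu (fun x => `|\1_(A n) x * f x - f x|)
    @[n --> \oo] --> (0 : R).
  exact: (@fine_cvg _ _ _ _ _ 0 cv0).
exists (fun x => \1_(A n) x * f x).
  split => //; exists n%:R => x; rewrite indicE.
  have [/set_mem//|_] := boolP (x \in A n); first by rewrite mul1r.
  by rewrite mul0r normr0.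
by rewrite mean_normBC; apply: le_trans (Hn n (leqnn n)); exact: ler_norm.
Qed.

(** The invariant parts of bounded approximations converge: over invariant sets they integrate as
    the approximations do, so by [L1_small_of_ginv] they are at most twice as far apart. Successive
    approximations differ by at most [2 * 2 ^- n] in L1, whence the constant 4. *)
Lemma L1_decomposes f : L1 mu f -> exists h, decomposes f h.
Proof.
move=> Lf.
have r0 n : 0 < 2 ^- n :> R by rewrite invr_gt0 exprn_gt0.
have rS n : 2 ^- n.+1 <= 2 ^- n :> R.
  by rewrite lef_pV2 ?posrE ?exprn_gt0// ler_weXn2l ?ler1n.
have /choice[f' Hf'] : forall n, exists f',
    bounded_meas f' /\ mean mu (fun x => `|f x - f' x|) <= 2 ^- n.
  by move=> n; have [f' bf' lef'] := bounded_meas_dense Lf (r0 n); exists f'.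
have bf n : bounded_meas (f' n) by case: (Hf' n).
have Lf' n : L1 mu (f' n) by exact: bounded_meas_L1.
have /choice[h Hh] := fun n => bounded_decomposes (bf n).
have Lh n : L1 mu (h n) by case: (Hh n).
have [hl [Lhl hlim]] : exists hl, L1 mu hl /\
    mean mu (fun x => `|h n x - hl x|) @[n --> \oo] --> (0 : R).
  apply: (@L1_complete _ _ _ _ _ 4) => // n.
  have -> : 4 * 2 ^- n = 2 * (2 * 2 ^- n) :> R by ring.
  apply: L1_small_of_ginv; first exact: L1B.
    apply: filterS2 (decomposes_ae_invariant (Hh n)) (decomposes_ae_invariant (Hh n.+1)).
    by move=> x h1 h2 i; rewrite h1 h2.
  move=> A gA; have mA := gA.1.
  have -> : mean mu (fun x => \1_A x * (h n.+1 x - h n x)) =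
      mean mu (fun x => \1_A x * (f' n.+1 x - f' n x)).
    under [in LHS]eq_fun do rewrite mulrBr; under [in RHS]eq_fun do rewrite mulrBr.
    rewrite !meanB; try exact: L1_indic.
    by rewrite !(decomposes_mean (Lf' _) (Hh _) gA).
  apply: le_trans (ler_mean_indic mA (L1B (Lf' n.+1) (Lf' n))) _.
  apply: le_trans (mean_normB_le (Lf' n.+1) Lf (Lf' n)) _.
  rewrite mean_normBC; have [_ h1] := Hf' n; have [_ h2] := Hf' n.+1.
  by have := rS n; lra.
exists hl; split => //.
- move=> psi Pp; apply: (limit_invariant Pp Lh) => //.
  rewrite (_ : (fun n => _) = (fun=> 0)); first exact: cvg_cst.
  apply/funext => n; rewrite -[RHS](mean_cst mu); apply: mean_ae_eq.
  + exact/L1norm/L1B/L1_psi.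
  + exact: L1_cst.
  + have [_ /(_ psi Pp) + _] := Hh n.
    by apply: filterS => x ->; rewrite subrr normr0.
- move=> e e0; have e3 : 0 < e / 3 by rewrite divr_gt0.
  have /cvgr0Pnorm_le/(_ _ e3)[n1 _ Hn1] := hlim.
  have [n2 _ Hn2] := small_radius e3.
  pose n := maxn n1 n2.
  have hn : mean mu (fun x => `|h n x - hl x|) <= e / 3.
    by apply: le_trans (ler_norm _) (Hn1 n _); rewrite /= leq_maxl.
  have fn : mean mu (fun x => `|f x - f' n x|) <= e / 3.
    by have [_ /le_trans] := Hf' n; apply; apply/ltW/Hn2; rewrite /= leq_maxr.
  have [_ _ /(_ _ e3)[c Cc cn]] := Hh n.
  have Lc := bounded_meas_L1 mu (C_bounded Cc).
  exists c => //.
  have -> : e = e / 3 + (e / 3 + e / 3) by field.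
  apply: le_trans (lerD fn (lerD cn hn)).
  have N1 : L1 mu (fun x => `|f x - f' n x|) by exact/L1norm/L1B.
  have N2 : L1 mu (fun x => `|f' n x - h n x - c x|).
    by apply: L1norm; apply: L1B => //; exact: L1B.
  have N3 : L1 mu (fun x => `|h n x - hl x|) by exact/L1norm/L1B.
  rewrite -(meanD N2 N3) -(meanD N1 (L1D N2 N3)).
  apply: le_mean; [|exact: L1D N1 (L1D N2 N3)|].
    by apply: L1norm; apply: L1B => //; exact: L1B.
  move=> x; rewrite (_ : f x - hl x - c x =
    (f x - f' n x) + ((f' n x - h n x - c x) + (h n x - hl x))); last by ring.
  by apply: le_trans (ler_normD _ _) _; rewrite lerD2l ler_normD.
Qed.

End ergodic_decomposition.

(** * Pointwise convergence *)

Section averages.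
Context {R : realType} d {X : measurableType d}.
Implicit Types (A B : set X) (u v : X -> R).

Lemma ler_fsum A u v : finite_set A -> (forall x, A x -> u x <= v x) ->
  \sum_(x \in A) u x <= \sum_(x \in A) v x.
Proof.
move=> fA uv; rewrite -subr_ge0.
have -> : \sum_(x \in A) v x - \sum_(x \in A) u x = \sum_(x \in A) (v x - u x).
  rewrite fsbig_split//=; congr (_ + _); rewrite -mulN1r mulr_fsumr.
  by apply: eq_fsbigr => x _; rewrite mulN1r.
by apply: fsumr_ge0 => x Ax; rewrite subr_ge0 uv.
Qed.

Lemma fsumB A u v : finite_set A ->
  \sum_(x \in A) (u x - v x) = \sum_(x \in A) u x - \sum_(x \in A) v x.
Proof.
move=> fA; rewrite fsbig_split//=; congr (_ + _); rewrite -mulN1r mulr_fsumr.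
by apply: eq_fsbigr => x _; rewrite mulN1r.
Qed.

Lemma ler_norm_fsum A u : finite_set A ->
  `|\sum_(x \in A) u x| <= \sum_(x \in A) `|u x|.
Proof.
move=> fA; rewrite ler_norml; apply/andP; split; last first.
  by apply: ler_fsum => // x _; exact: ler_norm.
rewrite -mulN1r mulr_fsumr; apply: ler_fsum => // x _.
by rewrite mulN1r lerNl -normrN ler_norm.
Qed.

Lemma fsum_cst A (a : R) : finite_set A ->
  \sum_(x \in A) a = a * fine (counting A : \bar R).
Proof.
move=> fA; have -> : \sum_(x \in A) a = a * \sum_(x \in A) (1 : R).
  by rewrite mulr_fsumr; apply: eq_fsbigr => x _; rewrite mulr1.
congr (_ * _); rewrite counting_esum esum_fset//.
rewrite !fsbig_finite//=.
by rewrite sumEFin.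
Qed.

Lemma esum_fsum A u : finite_set A -> (forall x, 0 <= u x) ->
  (\esum_(x in A) (u x)%:E = (\sum_(x \in A) u x)%:E)%E.
Proof.
move=> fA u0; rewrite esum_fset//; last by move=> x _; rewrite lee_fin.
by rewrite !fsbig_finite//= sumEFin.
Qed.

(** The sum of [u \o psi] over [A] is the sum of [u] over the image of [A]. The common part cancels,
    leaving the symmetric difference. *)
Lemma fsum_cob_le A u (psi : X -> X) (M : R) : finite_set A -> injective psi ->
  (forall x, `|u x| <= M) ->
  `|\sum_(x \in A) (u x - u (psi x))| <= M * fine (counting (A `+` psi @` A) : \bar R).
Proof.
move=> fA ipsi uM; have fB : finite_set (psi @` A) by exact: finite_image.
rewrite fsumB//.
have -> : \sum_(x \in A) u (psi x) = \sum_(x \in psi @` A) u x.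
  by rewrite fsbig_image// => x y _ _; exact: ipsi.
set B := psi @` A in fB *.
rewrite [X in `|X - _|](fsbigID B)// [X in `|_ - X|](fsbigID A)//= [in X in _ - X]setIC.
rewrite opprD addrACA subrr add0r.
have fAB : finite_set (A `&` ~` B) by exact: finite_setIl.
have fBA : finite_set (B `&` ~` A) by exact: finite_setIl.
apply: le_trans (ler_normB _ _) _.
apply: le_trans (lerD (ler_norm_fsum u fAB) (ler_norm_fsum u fBA)) _.
rewrite -fsbigU0//; last by move=> x [[? ?] [? ?]].
rewrite -fsum_cst; last first.
  by rewrite finite_setU; split; exact: finite_setD.
rewrite (_ : A `+` B = (A `&` ~` B) `|` (B `&` ~` A))//.
by apply: ler_fsum => //; rewrite finite_setU.
Qed.

Lemma counting_fine_ge1 A : finite_set A -> (1 <= (counting A : \bar R))%E ->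
  1 <= fine (counting A : \bar R).
Proof.
move=> fA A1; rewrite -lee_fin fineK// ge0_fin_numE ?counting_ge0//.
by rewrite /counting asboolT// ltry.
Qed.

Lemma average_cst (U : X -> set X) (f : X -> R) x : finite_set (U x) ->
  (1 <= (counting (U x) : \bar R))%E ->
  (forall y, U x y -> f y = f x) -> average f U x = f x.
Proof.
move=> fA A1 fx; rewrite /average (eq_fsbigr (fun=> f x)); last first.
  by move=> y; rewrite inE => /fx.
rewrite fsum_cst// mulrCA mulVf ?mulr1// gt_eqF// (lt_le_trans ltr01)//.
exact: counting_fine_ge1.
Qed.

End averages.

(** * Identification of the invariant part with the conditional expectation *)

Section conditional_expectation.
Context {R : realType} d {X : measurableType d}.
Variables (mu : probability X R) (E : set (X * X)) (g : nat -> X -> X).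
Hypothesis hE : discrete_pmp mu E.
Hypothesis ga : pmp_action mu g.
Hypothesis gE : forall x y, gorbit g x y -> E (x, y).
Hypothesis Eg : {ae mu, forall x, forall y, E (x, y) -> gorbit g x y}.
Implicit Types (A B : set X) (u f h : X -> R).

Lemma conull_ae A : measurable A -> mu (~` A) = 0%E -> {ae mu, forall x, A x}.
Proof. by move=> mA A0; exists (~` A); split => //; exact: measurableC. Qed.

Lemma ae_and (P Q : X -> Prop) : {ae mu, forall x, P x} ->
  {ae mu, forall x, Q x} -> {ae mu, forall x, P x /\ Q x}.
Proof. exact: filterS2. Qed.

Lemma invariant_sets_ginv A : invariant_sets mu E A ->
  exists2 A', ginv g A' & {ae mu, forall x, A x <-> A' x}.
Proof.
move=> [mA [B sB [N [mN N0 ABN]]]].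
have NN : {ae mu, forall x, ~ N x} by exists N; split => // x /= /contrapT.
have [X1 [mX1 X10 X1P X1inv]] := ae_conull_invariant ga NN.
have AB x : X1 x -> (A x <-> B x).
  move=> /X1P nN; split => [Ax|Bx]; apply: contrapT => H; apply: nN; apply: ABN.
    by left.
  by right.
exists (A `&` X1).
  split; first exact: measurableI.
  move=> x y xy [Ax Xx]; have Xy := X1inv _ _ xy Xx; split => //.
  by apply/AB => //; apply: sB (gE xy) _; exact/AB.
by apply: filterS (conull_ae mX1 X10) => x Xx; split => [Ax|[]//].
Qed.

(** [saturated] speaks of all classes, while classes are known to be orbits only on a conull set
    [X1]. The saturation of the part of [A] inside [X1] is truly saturated and agrees with [A] on
    [X1]. *)
Lemma ginv_invariant_sets A : ginv g A -> invariant_sets mu E A.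
Proof.
move=> [mA iA]; split => //.
have [X1 [mX1 X10 X1P X1inv]] := ae_conull_invariant ga Eg.
exists [set x | exists2 y, (A `&` X1) y & E (y, x)].
  by move=> x y Exy [z Az Ezx]; exists z => //; exact: (pmp_trans hE Ezx).
exists (~` X1); split => //; first exact: measurableC.
move=> x [[Ax nB] Xx|[[y [Ay Xy] Eyx] nA] Xx].
  by apply: nB; exists x => //; exact: pmp_refl hE x.
by apply: nA; apply: iA Ay; exact: X1P Eyx.
Qed.

Lemma integral_mean A u : measurable A -> L1 mu u ->
  (\int[mu]_(x in A) (u x)%:E = (mean mu (fun x => \1_A x * u x))%:E)%E.
Proof.
move=> mA Lu; rewrite (EFin_mean (L1_indic mA Lu)) integral_mkcond.
apply: eq_integral => x _; rewrite patchE indicE.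
by case: ifP; rewrite ?mul1r ?mul0r.
Qed.

Lemma eq_mean_indic A B u : measurable A -> measurable B -> L1 mu u ->
  {ae mu, forall x, A x <-> B x} ->
  mean mu (fun x => \1_A x * u x) = mean mu (fun x => \1_B x * u x).
Proof.
move=> mA mB Lu AB; apply: mean_ae_eq; [exact: L1_indic|exact: L1_indic|].
apply: filterS AB => x ABx; rewrite !indicE.
by congr (_%:R * _); congr nat_of_bool; apply/idP/idP; rewrite !inE => /ABx.
Qed.

(** Since [h] is a version of the conditional expectation, [get] does return a version. Both
    versions are invariant almost everywhere and have equal integrals over invariant sets, so
    [L1_small_of_ginv] makes their distance vanish. *)
Lemma cond_expE f h : L1 mu f -> L1 mu h ->
  {ae mu, forall x, forall i, h (g i x) = h x} ->
  (forall A, ginv g A ->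
    mean mu (fun x => \1_A x * f x) = mean mu (fun x => \1_A x * h x)) ->
  {ae mu, forall x, cond_exp mu (invariant_sets mu E) f x = h x}.
Proof.
move=> Lf Lh ih fh.
have Hh : is_cond_exp mu (invariant_sets mu E) f h.
  split => //.
    move=> B mB; have mhB : measurable (h @^-1` B).
      by rewrite -[_ @^-1` _]setTI; exact: (L1_meas Lh).
    split => //.
    have ae2 : {ae mu, forall x, (forall i, h (g i x) = h x) /\
        (forall y, E (x, y) -> gorbit g x y)}.
      exact: ae_and.
    have [X1 [mX1 X10 X1P X1inv]] := ae_conull_invariant ga ae2.
    exists [set x | exists2 y, X1 y /\ B (h y) & E (y, x)].
      by move=> x y Exy [z Az Ezx]; exists z => //; exact: (pmp_trans hE Ezx).
    exists (~` X1); split => //; first exact: measurableC.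
    move=> x [[Ax nB] Xx|[[y [Xy By] Eyx] nA] Xx].
      by apply: nB; exists x => //; exact: pmp_refl hE x.
    by apply: nA => /=; have [hy /(_ _ Eyx)[i _ <-]] := X1P y Xy; rewrite hy.
  move=> A GA; have [A' gA' AA'] := invariant_sets_ginv GA; have mA := GA.1.
  have mA' := gA'.1.
  by rewrite !integral_mean// (eq_mean_indic mA mA' Lh AA') (eq_mean_indic mA mA' Lf AA') fh.
have := getPex (ex_intro _ h Hh).
rewrite -/(cond_exp mu (invariant_sets mu E) f).
set h' := cond_exp _ _ _ => -[Lh' mh' fh'].
(* Measurability of [h'] makes each of its upper level sets invariant only up to a null set;
   rational levels suffice to separate values and leave countably many null sets. *)
have ih' : {ae mu, forall x, forall i, h' (g i x) = h' x}.
  have : {ae mu, forall x, forall q : rat, forall i,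
      ratr q < h' (g i x) <-> ratr q < h' x}.
    have : {ae mu, forall x, forall n : nat, forall i,
        (ratr (odflt 0 (unpickle n)) < h' (g i x) <->
         ratr (odflt 0 (unpickle n)) < h' x)}.
      apply: ae_foralln => n; set q : R := ratr _.
      have := mh' `]q, +oo[%classic (measurable_itv _).
      move=> /invariant_sets_ginv[A gA hA].
      apply: filterS (ae_gorbit ga hA) => x Hx i.
      have qE y : `]q, +oo[%classic (h' y) <-> q < h' y by rewrite /= in_itv/= andbT.
      have h1 := Hx _ (gorbit_g g i x); have h2 := Hx _ (gorbit_refl ga x).
      rewrite -!qE; split => H.
        apply/h2; apply: gA.2 (gorbit_sym ga (gorbit_g g i x)) _; exact/h1.
      by apply/h1; apply: gA.2 (gorbit_g g i x) _; exact/h2.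
    by apply: filterS => x Hx q i; have := Hx (pickle q) i; rewrite pickleK.
  apply: filterS => x Hx i; apply/eqP; rewrite eq_le !leNgt; apply/andP.
  split; apply/negP => lt; have [q] := rat_in_itvoo lt; rewrite in_itv/= => /andP[q1 q2].
    by move/(Hx q i): q2 => /(lt_trans q1); rewrite ltxx.
  by move/(Hx q i): q2 => /(lt_trans q1); rewrite ltxx.
have mean0 : mean mu (fun x => `|h' x - h x|) = 0.
  apply/eqP; rewrite eq_le mean_ge0 ?andbT// -[X in _ <= X](mulr0 2).
  apply: (L1_small_of_ginv ga (L1B Lh' Lh)).
    by apply: filterS2 ih ih' => x h1 h2 i; rewrite h1 h2.
  move=> A gA; have mA := gA.1.
  under eq_fun do rewrite mulrBr.
  rewrite meanB; [|exact: L1_indic..].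
  have := fh' A (ginv_invariant_sets gA); rewrite !integral_mean// => -[->].
  by rewrite fh// subrr normr0.
by apply: filterS (mean_norm_eq0 (L1B Lh' Lh) mean0) => x /eqP; rewrite subr_eq0 => /eqP.
Qed.

End conditional_expectation.

Section pointwise.
Context {R : realType} d {X : measurableType d}.
Variables (mu : probability X R) (E : set (X * X)) (k : index_kind).
Variables (F : R -> X -> set X) (g : nat -> X -> X).
Hypothesis hF : borel_family E k F.
Hypothesis ga : pmp_action mu g.
Hypothesis Eg : {ae mu, forall x, forall y, E (x, y) -> gorbit g x y}.
Hypothesis F_ge1 : {ae mu, forall x, forall r, index_set R k r ->
  (1 <= (counting (F r x) : \bar R))%E}.

Lemma index_oo_filter : Filter (index_oo R k).
Proof. exact: within_filter. Qed.
#[local] Existing Instance index_oo_filter.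

Lemma near_index_set : \forall r \near index_oo R k, index_set R k r.
Proof. by rewrite /index_oo near_withinE; apply: nearW. Qed.

Lemma near_index_oo (P : R -> Prop) : (forall r, index_set R k r -> P r) ->
  \forall r \near index_oo R k, P r.
Proof. by move=> HP; rewrite /index_oo near_withinE; apply: nearW. Qed.

(** Collects what the two alternatives of the hypothesis must provide beyond asymptotic invariance;
    from here on they are treated together. *)
Definition good_set (X1 : set X) (K : R) : Prop :=
  [/\ measurable X1 /\ mu (~` X1) = 0%E,
      (forall x y, gorbit g x y -> X1 x -> X1 y),
      (forall x, X1 x -> forall y, E (x, y) -> gorbit g x y),
      (forall x, X1 x -> forall r, index_set R k r ->
        (1 <= (counting (F r x) : \bar R))%E) &
      0 <= K /\ stopping_bound mu k F X1 K].

Lemma regular_good_set : regular_family mu k F -> exists X1 K, good_set X1 K.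
Proof.
move=> [C C0 reg].
have ae1 := ae_and reg (ae_and Eg F_ge1).
have [X1 [mX1 X10 X1P X1inv]] := ae_conull_invariant ga ae1.
have X1o x : X1 x -> forall y, E (x, y) -> gorbit g x y.
  by move=> /X1P[_ [+ _]]; exact.
have X1g x : X1 x -> forall r, index_set R k r -> (1 <= (counting (F r x) : \bar R))%E.
  by move=> /X1P[_ [_ +]]; exact.
exists X1, (4 * C); split => //; split; first by rewrite mulr_ge0// ltW.
by apply: (regular_stopping_bound ga hF mX1 X1o X1g C0) => x /X1P[+ _]; exact.
Qed.

Lemma tempered_good_set : uniform_family mu k F -> tempered mu k F ->
  exists X1 K, good_set X1 K.
Proof.
move=> [Cu [a [b [Cu0 Hab unif]]]] [kN [C temp]].
have idxN n : index_set R k n%:R by rewrite kN; exists n.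
(* The null set in [uniform_family] may depend on the index; there are countably many indices here,
   so one null set serves them all. *)
have unif' : {ae mu, forall x, forall n : nat,
    ((a n%:R)%:E <= (counting (F n%:R x) : \bar R) <= (b n%:R)%:E)%E /\
    ((a n%:R)%:E <= (counting (sf_inv (F n%:R) x) : \bar R) <= (b n%:R)%:E)%E}.
  by apply: ae_foralln => n; exact: unif.
have ae1 := ae_and (ae_and unif' temp) (ae_and Eg F_ge1).
have [X1 [mX1 X10 X1P X1inv]] := ae_conull_invariant ga ae1.
have X1o x : X1 x -> forall y, E (x, y) -> gorbit g x y.
  by move=> /X1P[_ [+ _]]; exact.
have X1g x : X1 x -> forall r, index_set R k r -> (1 <= (counting (F r x) : \bar R))%E.
  by move=> /X1P[_ [_ +]]; exact.
have idxE r : index_set R k r -> exists n : nat, r = n%:R.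
  by rewrite kN => -[n _ <-]; exists n.
(* [tempered] says nothing about the sign of its constant, hence the maximum with 0. *)
exists X1, (2 * (Cu + Num.max 0 C)); split => //; split.
  by rewrite mulr_ge0// addr_ge0// ?(ltW Cu0)// le_max lexx.
apply: (tempered_stopping_bound ga hF mX1 X1inv X1o (a := a) (b := b) kN Cu0).
- by rewrite le_max lexx.
- by move=> r /Hab[].
- by move=> r /Hab[].
- by move=> x /X1P[[u _] _] r /idxE[n ->]; have [/andP[]] := u n.
- by move=> x /X1P[[u _] _] r /idxE[n ->]; have [_ /andP[]] := u n.
- move=> x /X1P[[_ t] _] n idn; apply: le_trans (t n idn) _.
  apply: lee_wpmul2r; first exact: counting_ge0.
  by rewrite lee_fin le_max lexx orbT.
Qed.

Variables (X1 : set X) (K : R).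
Hypothesis X1K : good_set X1 K.

Let X1_ae : {ae mu, forall x, X1 x}.
Proof. by case: X1K => -[mX X0] _ _ _ _; exact: conull_ae. Qed.

Let fin r x : index_set R k r -> finite_set (F r x).
Proof. exact: family_finite hF x r. Qed.

Let cnt_ge1 r x : X1 x -> index_set R k r -> 1 <= fine (counting (F r x) : \bar R).
Proof.
move=> Xx ir; apply: counting_fine_ge1; first exact: fin.
by case: X1K => _ _ _ H _; exact: H.
Qed.

(* A linear space containing the coboundaries [u - u \o psi], used in place of
   their span. *)
Definition null_averages (c : X -> R) : Prop :=
  [/\ bounded_meas c,
      {ae mu, forall x, average c (F r) x @[r --> index_oo R k] --> (0 : R)} &
      forall A, ginv g A -> mean mu (fun x => \1_A x * c x) = 0].

Lemma null_averages0 : null_averages (fun=> 0).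
Proof.
split; first exact: bounded_meas_cst.
- apply: aeW => x; rewrite (_ : (fun r => _) = (fun=> 0)); first exact: cvg_cst.
  by apply/funext => r; rewrite /average fsbig1 ?mulr0.
- by move=> A _; under eq_fun do rewrite mulr0; exact: mean_cst.
Qed.

Lemma null_averages_lin a c1 c2 : null_averages c1 -> null_averages c2 ->
  null_averages (fun x => c1 x + a * c2 x).
Proof.
move=> [b1 v1 i1] [b2 v2 i2]; split; first exact/bounded_measD/bounded_measZ.
- apply: filterS2 v1 v2 => x x1 x2.
  have lin : \forall r \near index_oo R k,
      average c1 (F r) x + a * average c2 (F r) x =
      average (fun x => c1 x + a * c2 x) (F r) x.
    apply: near_index_oo => r ir; rewrite /average fsbig_split/=; last exact: fin.
    by rewrite -mulr_fsumr mulrDr mulrCA.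
  apply: (cvg_trans (near_eq_cvg lin)).
  have x3 : a * average c2 (F r) x @[r --> index_oo R k] --> a * 0 by exact: cvgMr.
  by have := cvgD x1 x3; rewrite mulr0 addr0; apply; exact: index_oo_filter.
- move=> A gA; have mA := gA.1.
  under eq_fun do rewrite mulrDr mulrCA.
  rewrite meanD; [|exact/L1_indic/bounded_meas_L1|exact/L1Z/L1_indic/bounded_meas_L1].
  by rewrite meanZ ?i1 ?i2 ?mulr0 ?addr0//; exact/L1_indic/bounded_meas_L1.
Qed.

Lemma null_averages_cob u psi : bounded_meas u -> range g psi ->
  {ae mu, forall x,
      fine (counting (F r x `+` psi @` F r x) : \bar R) / fine (counting (F r x) : \bar R)
        @[r --> index_oo R k] --> (0 : R)} ->
  null_averages (fun x => u x - u (psi x)).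
Proof.
move=> bu [i _ gi] asy.
have bp : bounded_meas (fun x => u (psi x)).
  by rewrite -gi; exact: bounded_meas_comp (pa_meas ga i) bu.
split; first exact: bounded_measB.
- have [_ [M uM]] := bu.
  have M0 : 0 <= M by apply: le_trans (uM point); exact: normr_ge0.
  apply: filterS2 asy X1_ae => x ax Xx; apply/cvgr0Pnorm_le => e e0.
  (* [M] may be 0, so [M + 1] is used as the divisor. *)
  have e1 : 0 < e / (M + 1) by rewrite divr_gt0// ltr_wpDl.
  have := (cvgr0Pnorm_le _).1 ax _ e1.
  move=> /(_ index_oo_filter) near_r; apply: filterS2 near_index_set near_r => r ir le_r.
  have cF := lt_le_trans ltr01 (cnt_ge1 Xx ir).
  have ipsi : injective psi.
    by have [j [ij _]] := pa_inv ga i; rewrite -gi; exact: can_inj ij.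
  rewrite /average normrM ger0_norm ?invr_ge0 ?(ltW cF)// mulrC ler_pdivrMr//.
  apply: le_trans (fsum_cob_le (fin x ir) ipsi uM) _.
  move: le_r; rewrite ger0_norm; last first.
    by rewrite divr_ge0 ?(ltW cF)// fine_ge0// counting_ge0.
  rewrite ler_pdivrMr// => le_r.
  apply: (@le_trans _ _ ((M + 1) * (e / (M + 1) * fine (counting (F r x) : \bar R)))).
    apply: ler_pM => //; first by rewrite fine_ge0// counting_ge0.
    by rewrite lerDl.
  by rewrite mulrA mulrCA mulfV ?mulr1// gt_eqF// ltr_wpDl.
- move=> A gA; have mA := gA.1; have Lu := bounded_meas_L1 mu bu.
  under eq_fun do rewrite mulrBr.
  rewrite meanB; [|exact: L1_indic|exact/L1_indic/bounded_meas_L1].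
  rewrite -[X in X - _](mean_action ga i (L1_indic mA Lu)).
  have -> : (fun x => \1_A (g i x) * u (g i x)) = (fun x => \1_A x * u (psi x)).
    apply/funext => x; rewrite -gi !indicE; congr (_%:R * _); congr nat_of_bool.
    apply/idP/idP; rewrite !inE; last exact: gA.2 (gorbit_g g i x).
    exact: gA.2 (gorbit_sym ga (gorbit_g g i x)).
  by rewrite subrr.
Qed.

(** The remainder after [c j] has mean at most [4 ^- j]. At level [2 ^- j] the weak-type bound then
    leaves a bad set of measure at most [K * 2 ^- j]; these are summable, so almost every point lies
    in only finitely many of them. *)
Lemma decomposes_cvg (Psi : set (X -> X)) f h : L1 mu f ->
  decomposes mu Psi null_averages f h ->
  {ae mu, forall x, forall i, h (g i x) = h x} ->
  {ae mu, forall x, average f (F r) x @[r --> index_oo R k] --> h x}.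
Proof.
move=> Lf [Lh _ Hh] ih.
have [[mX1 X10] X1inv X1o X1g [K0 bound]] := X1K.
have r0 n : 0 < 2 ^- n :> R by rewrite invr_gt0 exprn_gt0.
have pow4 n : 2 ^- n * 2 ^- n = 4 ^- n :> R.
  by rewrite -invfM -exprMn; congr (_ ^- n); ring.
have /choice[c Hc] : forall j, exists c, null_averages c /\
    mean mu (fun x => `|f x - h x - c x|) <= 4 ^- j.
  move=> j; have e0 : 0 < 4 ^- j :> R by rewrite invr_gt0 exprn_gt0.
  by have [c Cc cj] := Hh _ e0; exists c.
pose e j x := `|f x - h x - c j x|.
have Le j : L1 mu (e j).
  apply: L1norm; apply: L1B; first exact: L1B.
  by apply: bounded_meas_L1; case: (Hc j) => -[].
have e_ge0 j x : 0 <= e j x by exact: normr_ge0.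
have /choice[Y HY] : forall j, exists Y, [/\ measurable Y,
    (mu Y <= (K * 2 ^- j)%:E)%E &
    {ae mu, forall x, X1 x -> ~ Y x -> forall r, index_set R k r ->
      (\esum_(y in F r x) (e j y)%:E <= (2 ^- j)%:E * counting (F r x))%E}].
  move=> j.
  have [||||Y [mY leY aeY]] := weak_type_bound ga hF mX1 X1o bound
    (lam := 2 ^- j) (f := fun x => (e j x)%:E).
  - exact: ltW.
  - by move=> x; rewrite lee_fin.
  - exact/measurable_EFinP/(L1_meas (Le j)).
  - by [].
  exists Y; split => //.
  have fY : mu Y \is a fin_num by exact: fin_num_measure.
  move: leY; rewrite -(fineK fY) -EFin_mean// -!EFinM !lee_fin => leY.
  rewrite -(ler_pM2l (r0 j)) (le_trans leY)// mulrCA pow4.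
  by rewrite ler_wpM2l//; case: (Hc j).
have mY j : measurable (Y j) by case: (HY j).
have limsup0 : mu (lim_sup_set Y) = 0%E.
  apply: lim_sup_set_cvg0 => //.
  apply: (@le_lt_trans _ _ (2 * K)%:E); last by rewrite ltry.
  apply: lime_le; first by apply: is_cvg_nneseries.
  apply: nearW => n.
  apply: (@le_trans _ _ (\sum_(0 <= j < n) (K * 2 ^- j)%:E)%E).
    by apply: lee_sum => j _; case: (HY j).
  rewrite sumEFin lee_fin.
  have : \sum_(0 <= j < n) K * 2 ^- j <= 2 * K - 2 * K * 2 ^- n.
    elim: n => [|n IH]; first by rewrite big_geq// expr0 invr1 mulr1 subrr.
    rewrite big_nat_recr//= exprS invfM.
    by apply: le_trans (lerD IH (lexx _)) _; lra.
  by move/le_trans; apply; rewrite gerBl mulr_ge0// ?mulr_ge0// ltW.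
have ae_limsup : {ae mu, forall x, ~ lim_sup_set Y x}.
  exists (lim_sup_set Y); split => //; last by move=> x /= /contrapT.
  apply: bigcap_measurable => // n _; exact: bigcup_measurable.
have ae_max : {ae mu, forall x, forall j, X1 x -> ~ Y j x ->
    forall r, index_set R k r ->
      (\esum_(y in F r x) (e j y)%:E <= (2 ^- j)%:E * counting (F r x))%E}.
  by apply: ae_foralln => j; case: (HY j).
have ae_c : {ae mu, forall x, forall j,
    average (c j) (F r) x @[r --> index_oo R k] --> (0 : R)}.
  by apply: ae_foralln => j; case: (Hc j) => -[].
apply: filterS (ae_and (ae_and X1_ae ih) (ae_and ae_limsup (ae_and ae_max ae_c))).
move=> x [[Xx hx] [nlim [Hmax Hcx]]].
apply/cvgrPdist_le => eps eps0.
have eps2 : 0 < eps / 2 by rewrite divr_gt0.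
have [N nY] : exists N, forall j, (N <= j)%N -> ~ Y j x.
  apply: contrapT => H; apply: nlim => n _; apply: contrapT => H'; apply: H.
  by exists n => j nj Yj; apply: H'; exists j.
have [M _ HM] := small_radius eps2.
pose j := maxn N M.
have nYj : ~ Y j x by apply: nY; exact: leq_maxl.
have jeps : 2 ^- j < eps / 2 by apply: HM; rewrite /= leq_maxr.
have := (cvgr0Pnorm_le _).1 (Hcx j) _ eps2.
move=> /(_ index_oo_filter) near_r; apply: filterS2 near_index_set near_r => r ir le_r.
have cF := lt_le_trans ltr01 (cnt_ge1 Xx ir).
have fF := fin x ir.
have avg_h : average h (F r) x = h x.
  apply: average_cst => //; first exact: X1g.
  move=> y Fy; have [|i _ <-] := X1o x Xx y; last exact: hx.
  by case: hF => /(_ r ir x y Fy).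
have -> : h x - average f (F r) x =
    - (average (c j) (F r) x + average (fun x => f x - h x - c j x) (F r) x).
  rewrite -avg_h /average !fsumB//.
  set a := fine _; set s1 := \sum_(y \in _) f y; set s2 := \sum_(y \in _) h y.
  by set s3 := \sum_(y \in _) c j y; ring.
rewrite normrN; apply: le_trans (ler_normD _ _) _.
rewrite [leRHS](splitr eps); apply: lerD => //.
apply: le_trans (ltW jeps).
rewrite /average normrM ger0_norm ?invr_ge0 ?(ltW cF)// mulrC ler_pdivrMr//.
apply: le_trans (ler_norm_fsum _ fF) _.
have := Hmax j Xx nYj r ir; rewrite esum_fsum//.
rewrite (_ : counting (F r x) = (fine (counting (F r x) : \bar R))%:E).
  by rewrite -EFinM lee_fin.
rewrite fineK// ge0_fin_numE ?counting_ge0//.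
by rewrite /counting asboolT// ltry.
Qed.

End pointwise.

Theorem theorem2p1 (R : realType) (d : measure_display) (X : measurableType d)
    (mu : probability X R) (E : set (X * X)) (k : index_kind)
    (F : R -> X -> set X)
    (hE : discrete_pmp mu E)
    (hF : borel_family E k F)
    (hyp : (asymptotically_invariant mu E k F /\ regular_family mu k F) \/
           [/\ asymptotically_invariant mu E k F, uniform_family mu k F &
               tempered mu k F])
    (f : X -> R) (hf : mu.-integrable setT (EFin \o f)) :
  {ae mu, forall x,
    average f (F r) x @[r --> index_oo R k]
      --> cond_exp mu (invariant_sets mu E) f x}.
Proof.
have [F1 [Psi [cPsi PsiE gen] asy]] : asymptotically_invariant mu E k F.
  by case: hyp => [[]|[]].
have [g [ga Psig gG Eg]] := generated_action hE cPsi PsiE gen.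
have gE x y : gorbit g x y -> E (x, y).
  by move=> [i _ <-]; have [_ _] := generated_Inn hE PsiE (gG i); exact.
have [X1 [K X1K]] : exists X1 K, good_set mu E k F g X1 K.
  case: hyp => [[_ reg]|[_ unif temp]].
    exact: regular_good_set hF ga Eg F1 reg.
  exact: tempered_good_set hF ga Eg F1 unif temp.
have Psi_gen (h : X -> R) : (forall psi, Psi psi -> {ae mu, forall x, h (psi x) = h x}) ->
    forall i, {ae mu, forall x, h (g i x) = h x}.
  by move=> Hh i; exact: (generated_invariant hE PsiE Hh (gG i)).
have C_bounded c : null_averages mu k F g c -> bounded_meas c by case.
have C_int c A : null_averages mu k F g c -> ginv g A ->
    mean mu (fun x => \1_A x * c x) = 0 by move=> [_ _ H]; exact: H.
have C_lin a c1 c2 : null_averages mu k F g c1 -> null_averages mu k F g c2 ->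
    null_averages mu k F g (fun x => c1 x + a * c2 x).
  exact: null_averages_lin hF a c1 c2.
have C_cob u psi : bounded_meas u -> Psi psi ->
    null_averages mu k F g (fun x => u x - u (psi x)).
  by move=> bu Pp; apply: (null_averages_cob hF ga X1K bu (Psig _ Pp)); exact: asy.
have [h Hh] := L1_decomposes ga Psig C_bounded (null_averages0 mu k F g) C_lin C_cob
  C_int Psi_gen hf.
have ih := decomposes_ae_invariant Psi_gen Hh.
have Lh : L1 mu h by case: Hh.
have hA A : ginv g A ->
    mean mu (fun x => \1_A x * f x) = mean mu (fun x => \1_A x * h x).
  exact: (decomposes_mean C_bounded C_int hf Hh).
apply: filterS2 (cond_expE hE ga gE Eg hf Lh ih hA) (decomposes_cvg hF ga X1K hf Hh ih).
by move=> x ->.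
Qed.
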